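(* Let $W$ be a block-increasing graphon such that $$0<\inf_{x,y\in[0,1]}W(x,y)\le\sup_{x,y\in[0,1]}W(x,y)<1,$$ and let $\boldsymbol{G}\sim\mathcal{G}(n,W)$. Then, with high probability as $n\to\infty$, $$\chi(\boldsymbol{G})=(1+o(1))\,\varphi_*(W)\frac{n}{2\log n};$$ that is, for every fixed $\epsilon>0$, $\mathbb{P}\big((1-\epsilon)\varphi_*(W)\frac{n}{2\log n}\le\chi(\boldsymbol{G})\le(1+\epsilon)\varphi_*(W)\frac{n}{2\log n}\big)\to1$ as $n\to\infty$.
   Context: A graphon is a symmetric measurable function $W:[0,1]^2\to[0,1]$. It is block-increasing if there is a finite family $\mathcal{F}$ of disjoint intervals partitioning $[0,1]$ such that, for all $S,S'\in\mathcal{F}$, $W$ is increasing (in the weak sense, i.e. non-decreasing) in each coordinate on $S\times S'$. The random graph $\mathcal{G}(n,W)$ has vertex set $[n]=\{1,\dots,n\}$: sample $X_1,\dots,X_n$ independently and uniformly from $[0,1]$; conditionally on these, each edge $ij$ ($i\ne j$) is present independently with probability $W(X_i,X_j)$. $\chi(G)$ is the chromatic number, $\log$ is the natural logarithm, $\lambda$ is the Lebesgue (uniform) measure on $[0,1]$, and $\mathcal{P}([0,1])$ is the set of probability measures on $[0,1]$. $\mathcal{C}_\lambda$ is the set of pairs $(\mathcal{M},\boldsymbol{\alpha})$ where $\mathcal{M}\subset\mathcal{P}([0,1])$ is finite and $\boldsymbol{\alpha}=(\alpha_\mu)_{\mu\in\mathcal{M}}\in[0,1]^{|\mathcal{M}|}$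 satisfies $\sum_{\mu\in\mathcal{M}}\alpha_\mu=1$ and $\sum_{\mu\in\mathcal{M}}\alpha_\mu\mu=\lambda$. For $\mu\in\mathcal{P}([0,1])$, $$\varphi(\mu,W):=\sup_{S\subseteq[0,1]:\ \mu(S)>0}\frac1{\mu(S)}\int_S\int_S\log\Big(\frac1{1-W(x,y)}\Big)\,d\mu(x)\,d\mu(y)$$ (supremum over measurable $S$), and $$\varphi_*(W):=\inf_{(\mathcal{M},\boldsymbol{\alpha})\in\mathcal{C}_\lambda}\ \sum_{\mu\in\mathcal{M}}\alpha_\mu\varphi(\mu,W).$$ *)

(* Defs.v *)
From HB Require Import structures.
From mathcomp Require Import all_boot all_order all_algebra.
From mathcomp Require Import all_classical all_reals all_analysis.

Set Implicit Arguments.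
Unset Strict Implicit.
Unset Printing Implicit Defensive.

Import Order.TTheory GRing.Theory Num.Theory.
Import numFieldNormedType.Exports.

Local Open Scope classical_set_scope.
Local Open Scope ring_scope.

Definition I01 (R : realType) : set R := `[0, 1].

Arguments I01 : clear implicits.

(* A graphon is represented by a function on the whole plane of which only the
   restriction to the unit square matters: every definition below looks at W
   on [0,1]^2 only.  Measurability is with respect to the Borel sets, so that
   integrals against arbitrary Borel probability measures make sense. *)
Definition graphon (R : realType) (W : R -> R -> R) : Prop :=
  [/\ measurable_fun (I01 R `*` I01 R)
        (fun z : measurableTypeR R * measurableTypeR R =>
           W z.1 z.2 : measurableTypeR R),
      forall x y, I01 R x -> I01 R y -> W x y = W y x
    & forall x y, I01 R x -> I01 R y -> 0 <= W x y <= 1].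

Definition block_increasing (R : realType) (W : R -> R -> R) : Prop :=
  exists (k : nat) (J : 'I_k -> interval R),
    [/\ trivIset setT (fun i => [set` J i]),
        \bigcup_i [set` J i] = I01 R,
        forall i j x x' y, x \in J i -> x' \in J i -> y \in J j ->
          x <= x' -> W x y <= W x' y
      & forall i j x y y', x \in J i -> y \in J j -> y' \in J j ->
          y <= y' -> W x y <= W x y'].

Definition values (R : realType) (W : R -> R -> R) : set R :=
  [set W x y | x in I01 R & y in I01 R].

Definition lambda01 (R : realType) : probability (measurableTypeR R) R :=
  uniform_prob (@ltr01 R).

(* Borel probability measures on [0,1] are the Borel probability measures on
   the line that give mass 1 to [0,1]. *)
Definition on_unit (R : realType) (mu : probability (measurableTypeR R) R) :
  Prop := mu (I01 R) = 1%E.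

(* The finite set M is enumerated without repetition by mu; two measures are
   identified when they agree on measurable sets. *)
Definition C_lambda (R : realType) (k : nat)
    (mu : 'I_k -> probability (measurableTypeR R) R) (alpha : 'I_k -> R) :
    Prop :=
  [/\ forall i, on_unit (mu i),
      forall i j, (forall A, measurable A -> mu i A = mu j A) -> i = j,
      forall i, 0 <= alpha i <= 1,
      \sum_i alpha i = 1
    & forall A, measurable A ->
        (\sum_i (alpha i)%:E * mu i A)%E = lambda01 R A].

(* The integrand takes values in the extended reals: it is +oo where W = 1. *)
Definition phi (R : realType) (mu : probability (measurableTypeR R) R)
    (W : R -> R -> R) : \bar R :=
  ereal_sup [set ((mu S)^-1 * \int[mu]_(y in S) \int[mu]_(x in S)
                    lne (1 / (1 - W x y)%:E))%E
            | S in [set S : set (measurableTypeR R) |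
                     [/\ measurable S, S `<=` I01 R & (0 < mu S)%E]]].

Definition phi_star (R : realType) (W : R -> R -> R) : \bar R :=
  ereal_inf [set v | exists (k : nat)
    (mu : 'I_k -> probability (measurableTypeR R) R) (alpha : 'I_k -> R),
    C_lambda mu alpha /\ v = (\sum_i (alpha i)%:E * phi (mu i) W)%E].

(* Simple graphs on n vertices, as symmetric irreflexive sets of arcs. *)
Definition is_simple (n : nat) (E : {set 'I_n * 'I_n}) : bool :=
  [forall i, (i, i) \notin E] &&
  [forall i, forall j, ((i, j) \in E) == ((j, i) \in E)].

Definition graph (n : nat) := {E : {set 'I_n * 'I_n} | is_simple E}.

Definition adj (n : nat) (G : graph n) (i j : 'I_n) : bool :=
  (i, j) \in sval G.

Definition colorable (n : nat) (G : graph n) (k : nat) : bool :=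
  [exists c : {ffun 'I_n -> 'I_k}, forall i, forall j,
    adj G i j ==> (c i != c j)].

Lemma ex_colorable (n : nat) (G : graph n) : exists k, colorable G k.
Proof.
exists n; apply/existsP; exists [ffun i => i].
apply/forallP => i; apply/forallP => j; apply/implyP; rewrite !ffunE.
apply: contraTneq => ->; rewrite /adj.
by case: G => E /= /andP[/forallP/(_ j)].
Qed.

Definition chi (n : nat) (G : graph n) : nat := ex_minn (ex_colorable G).

Definition edge_law (R : realType) (n : nat) (W : R -> R -> R)
    (x : n.-tuple R) (g : graph n) : R :=
  \prod_(e : 'I_n * 'I_n | (e.1 < e.2)%N)
    (if adj g e.1 e.2 then W (tnth x e.1) (tnth x e.2)
     else 1 - W (tnth x e.1) (tnth x e.2)).

(* The random graph G, defined on the probability space (T, P), is a sample of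
   G(n, W): for some X_1, ..., X_n independent and uniform on [0,1], the
   conditional law of G given (X_1, ..., X_n) makes each edge ij present
   independently with probability W(X_i, X_j).  The last clause is the defining
   property of the conditional probability of [G = g] given X. *)
Definition is_GnW (R : realType) (d : measure_display) (T : measurableType d)
    (P : probability T R) (n : nat) (W : R -> R -> R) (G : T -> graph n) :
    Prop :=
  exists X : T -> n.-tuple (measurableTypeR R),
    [/\ measurable_fun setT X,
        forall w i, I01 R (tnth (X w) i),
        forall i A, measurable A ->
          P [set w | A (tnth (X w) i)] = lambda01 R A,
        forall A : 'I_n -> set (measurableTypeR R),
          (forall i, measurable (A i)) ->
          P [set w | forall i, A i (tnth (X w) i)] =
            (\prod_i P [set w | A i (tnth (X w) i)])%E
      & forall g, measurable (G @^-1` [set g]) /\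
          forall B, measurable B ->
            P (G @^-1` [set g] `&` X @^-1` B) =
            (\int[P]_(w in X @^-1` B) (edge_law W (X w) g)%:E)%E].

(* Main.v *)
Require Import Defs.
From mathcomp Require Import all_boot all_order all_algebra.
From mathcomp Require Import all_classical all_reals all_analysis.
From mathcomp Require Import measurable_realfun.
From mathcomp Require Import ring lra.

Set Implicit Arguments.
Unset Strict Implicit.
Unset Printing Implicit Defensive.

Import Order.TTheory GRing.Theory Num.Theory.
Import numFieldNormedType.Exports.

Local Open Scope classical_set_scope.
Local Open Scope ring_scope.

(* Write w = - ln (1 - W) and L = ln n.  A vertex set S is independent with
   probability exp (- sum of w over the pairs of S), so by a first moment bound
   every independent S satisfies, with high probability, that the sum of w over
   S x S is at most about 2 L |S|.  Applied to all subsets of a colour class C,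
   this says that the measure mu_C given by the positions of the vertices of C has
   phi(mu_C) <= 2 L / |C| up to small errors.  The classes decompose the empirical
   measure, which is close to lambda, so that phi_* n <= 2 L chi(G) approximately.

   Conversely, take a nearly optimal decomposition of lambda.  Each mu in it gives
   a profile prescribing about 2 L mu(D) / phi(mu) vertices in each cell D, for which
   the second moment method works on every sub-profile.  By Janson's inequality
   every set of vertices meeting each cell in n^(1 - o(1)) points contains an
   independent set with this profile, except with probability
   exp (- n^(3/2) / 2), which beats the 2^n choices of the set.  Colour classes are
   then extracted greedily; the few vertices left over are coloured with smaller
   independent sets.

   As W is only monotone on blocks, and not continuous, both bounds move mass from
   a small interval to its neighbour, which changes W in the favourable direction;
   the price is the mass of the extreme intervals of each block. *)

(** * Product measures on finite power sets *)

(** The supremum over [S] in [phi] is what lets the two halves meet. For an independent set to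
    exist, every part of its profile must be affordable, since a small dense part may already be too
    unlikely; conversely, every part of a colour class is itself independent. The estimates control
    unions of whole cells, whereas a measurable set or an integer sub-profile fills cells only
    fractionally. As the quadratic form has nonnegative coefficients, randomised rounding closes
    this gap.

    Greedy extraction is applied to vertex sets that depend on the graph itself, so independent sets
    must exist in all large vertex sets at once. A variance bound is far too weak for this, hence
    Janson's inequality. To keep its overlap sum tractable, only transversals of reserved candidate
    lists are counted, not all sets with the given profile.

    The law of the positions enters only through the numbers of points in finitely many intervals.
    Everything else happens at fixed positions, where the non-edges form a random subset with a
    product law. *)

Definition subset_law (R : realType) (E : finType) (q : E -> R) (H : {set E}) : R :=
  \prod_e (if e \in H then q e else 1 - q e).

Definition Ex (R : realType) (E : finType) (q : E -> R) (f : {set E} -> R) : R :=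
  \sum_H subset_law q H * f H.

Section RandomSubset.
Context {R : realType} {E : finType}.
Implicit Types (q : E -> R) (f g : {set E} -> R) (H T : {set E}).

(** The conditional expectation of [f] given all elements but [e]. Iterating it computes [Ex] one
    coordinate at a time, so that inequalities for product laws reduce to two-point laws. *)
Definition avg q (e : E) f : {set E} -> R :=
  fun H => q e * f (e |: H) + (1 - q e) * f (H :\ e).

Definition avgs q (s : seq E) f := foldr (avg q) f s.

Lemma subset_law_ge0 q H : (forall e, 0 <= q e <= 1) -> 0 <= subset_law q H.
Proof.
move=> q01; apply: prodr_ge0 => e _; have /andP[q0 q1] := q01 e.
by case: ifP; rewrite ?subr_ge0.
Qed.

Lemma Ex_avg q e f : Ex q (avg q e f) = Ex q f.
Proof.
(* Each set without [e] is paired with the same set with [e] added. *)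
have law_split g : Ex q g = \sum_(H : {set E} | e \notin H)
    (\prod_(i | i != e) (if i \in H then q i else 1 - q i)) *
      (q e * g (e |: H) + (1 - q e) * g H).
  rewrite /Ex (bigID (fun H => e \in H)) /=.
  rewrite (reindex_onto (fun H : {set E} => e |: H) (fun H => H :\ e)); last first.
    by move=> H eH; rewrite finset.setD1K.
  under eq_bigl => H.
    rewrite finset.setU11 /=.
    have -> : ((e |: H) :\ e == H) = (e \notin H).
      apply/eqP/idP => [<-|/finset.setU1K //]; by rewrite !inE eqxx.
    over.
  rewrite -big_split /=; apply: eq_bigr => H eH.
  rewrite mulrDr !mulrA; congr (_ * _ + _ * _).
    rewrite /subset_law (bigD1 e) //= finset.setU11 mulrC; congr (_ * _).
    by apply: eq_bigr => i ie; rewrite !inE (negbTE ie).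
  by rewrite /subset_law (bigD1 e) //= (negbTE eH) mulrC.
rewrite !law_split; apply: eq_bigr => H eH; congr (_ * _).
rewrite /avg finset.setUA finset.setUid !finset.setU1K //.
have -> : H :\ e = H by apply/finset.setP => i; rewrite !inE; case: eqP => // ->; rewrite (negbTE eH).
by ring.
Qed.

Lemma Ex_avgs q s f : Ex q (avgs q s f) = Ex q f.
Proof. by elim: s => //= e s IH; rewrite Ex_avg. Qed.

Lemma Ex_cst q c : Ex q (fun=> c) = c.
Proof.
rewrite /Ex -mulr_suml; under eq_bigr => H _ do rewrite /subset_law.
have := @bigA_distr R 0 1 *%R +%R E q (fun e => 1 - q e).
rewrite /= => <-; rewrite big1 ?mul1r // => e _; by rewrite addrC subrK.
Qed.

Definition ignores (e : E) f := forall H, f (e |: H) = f (H :\ e).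

Lemma avg_id q e f : ignores e f -> avg q e f =1 f.
Proof.
move=> fe H; rewrite /avg fe; have -> : f (H :\ e) = f H.
  case: (boolP (e \in H)) => eH; first by rewrite -fe; congr f; apply/finset.setUidPr; rewrite finset.sub1set.
  by congr f; apply/finset.setP => i; rewrite !inE; case: eqP => // ->; rewrite (negbTE eH).
by ring.
Qed.

Lemma ignores_avg q e f : ignores e (avg q e f).
Proof.
move=> H; rewrite /avg; congr (_ * f _ + _ * f _);
 by apply/finset.setP => i; rewrite !inE; case: eqP.
Qed.

Lemma ignores_avgC q e e' f : ignores e f -> ignores e (avg q e' f).
Proof.
move=> fe H; case: (eqVneq e e') => [->|ne]; first exact: ignores_avg.
rewrite /avg; congr (_ * _ + _ * _).
  rewrite finset.setUCA fe; congr f; apply/finset.setP => i; rewrite !inE.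
  by case: (eqVneq i e) => //= ->; rewrite (negbTE ne).
have -> : (e |: H) :\ e' = e |: (H :\ e').
  by apply/finset.setP => i; rewrite !inE; case: (eqVneq i e) => //= ->; rewrite ne.
by rewrite fe; congr f; apply/finset.setP => i; rewrite !inE; case: (i == e); rewrite ?andbF.
Qed.

Lemma ignores_avgs q e s f : ignores e f -> ignores e (avgs q s f).
Proof. by move=> fe; elim: s => //= e' s; exact: ignores_avgC. Qed.

Lemma ignores_cst f : (forall e, ignores e f) -> forall H, f H = f finset.set0.
Proof.
move=> fe H; have [n] := ubnP #|H|; elim: n H => // n IH H ltH.
have [->//|[e eH]] := finset.set_0Vmem H.
rewrite -(IH (H :\ e)); last by move: ltH; rewrite (cardsD1 e H) eH.
by rewrite -(fe e H); congr f; apply/esym/finset.setUidPr; rewrite finset.sub1set.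
Qed.

(** Once every element has been averaged out, the function is constant, and averaging does not
    change the expectation. This gives access to induction along [enum E]. *)
Lemma ExE q f H : Ex q f = avgs q (enum E) f H.
Proof.
have ig e : ignores e (avgs q (enum E) f).
  have : e \in enum E by rewrite mem_enum.
  elim: (enum E) => //= e' s IH; rewrite inE => /predU1P[->|/IH es].
    exact: ignores_avg.
  exact: ignores_avgC.
rewrite (ignores_cst ig) -(Ex_avgs q (enum E)).
rewrite -[RHS](Ex_cst q); congr Ex; apply/funext => K; exact: ignores_cst.
Qed.

Lemma le_avg q e f g : (forall e, 0 <= q e <= 1) -> (forall H, f H <= g H) ->
  forall H, avg q e f H <= avg q e g H.
Proof.
move=> q01 fg H; have /andP[q0 q1] := q01 e.
by rewrite lerD // ler_wpM2l // subr_ge0.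
Qed.

Lemma le_Ex q f g : (forall e, 0 <= q e <= 1) -> (forall H, f H <= g H) ->
  Ex q f <= Ex q g.
Proof.
by move=> q01 fg; apply: ler_sum => H _; rewrite ler_wpM2l ?subset_law_ge0.
Qed.

Definition decreasing f := forall H K : {set E}, H \subset K -> f K <= f H.

Lemma decreasing_avg q e f : (forall e, 0 <= q e <= 1) ->
  decreasing f -> decreasing (avg q e f).
Proof.
move=> q01 df H K HK; have /andP[q0 q1] := q01 e.
by rewrite lerD // ler_wpM2l ?subr_ge0 // df // ?finset.setUS ?finset.setSD.
Qed.

Lemma decreasing_avgs q s f : (forall e, 0 <= q e <= 1) ->
  decreasing f -> decreasing (avgs q s f).
Proof. by move=> q01 df; elim: s => //= e s; exact: decreasing_avg. Qed.

(** Induction on the coordinates. For one coordinate the covariance is q (1 - q) times the product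
    of the two increments, which have the same sign. *)
Lemma harris q f g : (forall e, 0 <= q e <= 1) -> decreasing f -> decreasing g ->
  Ex q f * Ex q g <= Ex q (fun H => f H * g H).
Proof.
move=> q01 df dg; rewrite !(ExE _ _ finset.set0).
elim: (enum E) finset.set0 => //= e s IH H.
set F := avgs q s f; set G := avgs q s g.
apply: (@le_trans _ _ (avg q e (fun H => F H * G H) H)); last exact: le_avg.
have /andP[q0 q1] := q01 e.
have sHH : H :\ e \subset e |: H by rewrite (fintype.subset_trans (finset.subD1set _ _)) ?finset.subsetUr.
have Fd : F (e |: H) <= F (H :\ e) by exact: decreasing_avgs.
have Gd : G (e |: H) <= G (H :\ e) by exact: decreasing_avgs.
rewrite /avg -subr_ge0.
have -> : q e * (F (e |: H) * G (e |: H)) + (1 - q e) * (F (H :\ e) * G (H :\ e)) -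
    (q e * F (e |: H) + (1 - q e) * F (H :\ e)) *
    (q e * G (e |: H) + (1 - q e) * G (H :\ e)) =
  q e * (1 - q e) * ((F (H :\ e) - F (e |: H)) * (G (H :\ e) - G (e |: H))) by ring.
by rewrite !mulr_ge0 // subr_ge0.
Qed.

(** Same induction as for Harris' inequality: one coordinate contributes (q' - q) times a
    nonnegative increment. It serves to replace the true non-edge probabilities by their slot
    values. *)
Lemma Ex_decreasing_le q q' f : (forall e, 0 <= q e <= 1) ->
    (forall e, 0 <= q' e <= 1) -> (forall e, q e <= q' e) -> decreasing f ->
  Ex q' f <= Ex q f.
Proof.
move=> q01 q01' qq' df; rewrite !(ExE _ _ finset.set0).
elim: (enum E) finset.set0 => //= e s IH H.
apply: (@le_trans _ _ (avg q' e (avgs q s f) H)); first exact: le_avg.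
have sHH : H :\ e \subset e |: H by rewrite (fintype.subset_trans (finset.subD1set _ _)) ?finset.subsetUr.
have Fd : avgs q s f (e |: H) <= avgs q s f (H :\ e) by exact: decreasing_avgs.
rewrite /avg -subr_ge0.
set a := avgs _ _ _ (e |: H) in Fd *; set b := avgs _ _ _ (H :\ e) in Fd *.
have -> : q e * a + (1 - q e) * b - (q' e * a + (1 - q' e) * b) =
  (q' e - q e) * (b - a) by ring.
by rewrite mulr_ge0 // subr_ge0.
Qed.

Lemma Ex_ignores q q' T f : (forall e, e \notin T -> q e = q' e) ->
  (forall e, e \in T -> ignores e f) -> Ex q f = Ex q' f.
Proof.
move=> qq' fT; rewrite !(ExE _ _ finset.set0).
elim: (enum E) finset.set0 => //= e s IH H.
case: (boolP (e \in T)) => eT; last by rewrite /avg qq' // !IH.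
by rewrite !avg_id //; exact/ignores_avgs/fT.
Qed.

(** The product law conditioned on containing [T] is again a product law, with these marginals. *)
Definition cond (q : E -> R) T : E -> R := fun e => if e \in T then 1 else q e.

Lemma cond01 q T : (forall e, 0 <= q e <= 1) -> forall e, 0 <= cond q T e <= 1.
Proof. by move=> q01 e; rewrite /cond; case: ifP => // _; rewrite ler01 lexx. Qed.

Lemma Ex_cond q T f :
  Ex q (fun H => (T \subset H)%:R * f H) = (\prod_(e in T) q e) * Ex (cond q T) f.
Proof.
rewrite /Ex mulr_sumr; apply: eq_bigr => H _; rewrite !mulrA; congr (_ * _).
case: (boolP (T \subset H)) => TH.
  rewrite mulr1 /subset_law (bigID (mem T)) [X in _ = _ * X](bigID (mem T)) /=.
  rewrite [X in _ = _ * (X * _)]big1 ?mul1r; last first.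
    by move=> e eT; rewrite (fintype.subsetP TH) // /cond eT.
  congr (_ * _); apply: eq_bigr => e eT; first by rewrite (fintype.subsetP TH).
  by rewrite /cond (negbTE eT).
have /subsetPn[e eT eH] := TH.
by rewrite mulr0 /subset_law [X in _ = _ * X](bigD1 e) //= (negbTE eH) /cond eT subrr
  mul0r mulr0.
Qed.

Lemma Ex_sub q T : Ex q (fun H => (T \subset H)%:R) = \prod_(e in T) q e.
Proof.
rewrite -[RHS]mulr1 -[X in _ = _ * X](Ex_cst (cond q T)) -Ex_cond.
by congr Ex; apply/funext => H; rewrite mulr1.
Qed.

Lemma Ex_sum q (I : finType) (P : pred I) (F : I -> {set E} -> R) :
  Ex q (fun H => \sum_(i | P i) F i H) = \sum_(i | P i) Ex q (F i).
Proof.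
rewrite /Ex exchange_big /=; apply: eq_bigr => H _; by rewrite mulr_sumr.
Qed.

Lemma Ex_scale q c f : Ex q (fun H => c * f H) = c * Ex q f.
Proof. by rewrite /Ex mulr_sumr; apply: eq_bigr => H _; rewrite mulrCA. Qed.

Lemma Ex_ge0 q f : (forall e, 0 <= q e <= 1) -> (forall H, 0 <= f H) -> 0 <= Ex q f.
Proof.
by move=> q01 f0; rewrite -(Ex_cst q 0); exact: le_Ex.
Qed.

End RandomSubset.

(** * Janson's inequality *)

Lemma is_derive_bigsum (R : realType) (I : Type) (r : seq I) (F : I -> R -> R)
    (dF : I -> R) (x : R) : (forall i, is_derive x 1 (F i) (dF i)) ->
  is_derive x 1 (fun y => \sum_(i <- r) F i y) (\sum_(i <- r) dF i).
Proof.
move=> hF; elim: r => [|i r IH].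
  rewrite big_nil; have -> : (fun y => \sum_(i <- [::]) F i y) = cst 0.
    by apply/funext => y; rewrite big_nil.
  exact: is_derive_cst.
rewrite big_cons; have -> : (fun y => \sum_(j <- i :: r) F j y) =
    F i + (fun y => \sum_(j <- r) F j y).
  by apply/funext => y; rewrite big_cons.
exact: is_deriveD.
Qed.

Section Janson.
Context {R : realType} {E I : finType}.
Variables (q : E -> R) (T : I -> {set E}).
Hypothesis q01 : forall e, 0 <= q e <= 1.

Let X (H : {set E}) : R := \sum_i (T i \subset H)%:R.
Let mu : R := \sum_i \prod_(e in T i) q e.
Let Delta : R :=
  \sum_i \sum_(j | ~~ [disjoint T i & T j]) \prod_(e in T i :|: T j) q e.
Let f (t : R) : R := Ex q (fun H => expR (- (t * X H))).

Lemma decreasing_expN_count (J : pred I) (t : R) : 0 <= t ->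
  decreasing (fun H => expR (- (t * \sum_(j | J j) (T j \subset H)%:R))).
Proof.
move=> t0 H K HK; rewrite ler_expR lerN2 ler_wpM2l //.
apply: ler_sum => j _; rewrite ler_nat.
by case: (boolP (T j \subset H)) => // /fintype.subset_trans/(_ HK) ->.
Qed.

(* Conditionally on T i being selected, Harris' inequality separates the sets
   meeting T i from the others, on whose count the conditioning has no effect. *)
Lemma janson_step (i : I) (t : R) : 0 <= t ->
  (\prod_(e in T i) q e -
     t * \sum_(j | ~~ [disjoint T i & T j]) \prod_(e in T i :|: T j) q e) * f t
  <= Ex q (fun H => (T i \subset H)%:R * expR (- (t * X H))).
Proof.
move=> t0; rewrite Ex_cond; set q' := cond q (T i).
have q01' := cond01 (T i) q01.
pose near j := ~~ [disjoint T i & T j].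
pose Xn (H : {set E}) : R := \sum_(j | near j) (T j \subset H)%:R.
pose Xf (H : {set E}) : R := \sum_(j | ~~ near j) (T j \subset H)%:R.
have XE H : X H = Xn H + Xf H by rewrite /X (bigID near).
have p0 : 0 <= \prod_(e in T i) q e by apply: prodr_ge0 => e _; case/andP: (q01 e).
have f0 : 0 <= f t by apply: Ex_ge0 => // H; exact: expR_ge0.
(* From exp (- x) >= 1 - x and linearity of expectation under the conditioned law. *)
have Enear : 1 - t * (\sum_(j | near j) \prod_(e in T j) q' e) <=
    Ex q' (fun H => expR (- (t * Xn H))).
  apply: (@le_trans _ _ (Ex q' (fun H => 1 + - t * Xn H))); last first.
    by apply: le_Ex => // H; rewrite mulNr expR_ge1Dx.
  have -> : Ex q' (fun H => 1 + - t * Xn H) = Ex q' (fun=> 1) + - t * Ex q' Xn.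
    rewrite -Ex_scale /Ex -big_split /=; apply: eq_bigr => H _.
    by rewrite -mulrDr.
  rewrite Ex_cst Ex_sum mulNr; under [X in _ <= _ - _ * X]eq_bigr do rewrite Ex_sub.
  by [].
have Efar : f t <= Ex q' (fun H => expR (- (t * Xf H))).
  have <- : Ex q (fun H => expR (- (t * Xf H))) = Ex q' (fun H => expR (- (t * Xf H))).
    apply: (@Ex_ignores _ _ _ _ (T i)) => [e eT|e eT H]; first by rewrite /q' /cond (negbTE eT).
    congr (expR (- (t * _))); apply: eq_bigr => j; rewrite negbK => dis.
    congr (_%:R); congr nat_of_bool.
    have eTj : e \notin T j by rewrite (disjointFr dis eT).
    rewrite finset.subsetD1 eTj andbT; apply/idP/idP => [|/fintype.subset_trans->//]; last first.
      exact: finset.subsetUr.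
    move=> /fintype.subsetP s; apply/fintype.subsetP => a aT; move: (s _ aT).
    by rewrite !inE => /predU1P[ae|//]; rewrite ae (negbTE eTj) in aT.
  apply: le_Ex => // H; rewrite ler_expR lerN2 ler_wpM2l // XE ler_wpDl //.
  by apply: sumr_ge0.
have Har : Ex q' (fun H => expR (- (t * Xn H))) * Ex q' (fun H => expR (- (t * Xf H)))
    <= Ex q' (fun H => expR (- (t * X H))).
  have := harris q01' (decreasing_expN_count near t0)
    (decreasing_expN_count (fun j => ~~ near j) t0).
  congr (_ <= _); congr Ex; apply/funext => H.
  by rewrite -expRD -opprD -mulrDr XE.
have prodE j : (\prod_(e in T i) q e) * (\prod_(e in T j) q' e) =
    \prod_(e in T i :|: T j) q e.
  rewrite [RHS](bigID (mem (T i))) /=; congr (_ * _).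
    by apply: eq_bigl => e; rewrite !inE; case: (e \in T i); rewrite ?andbF.
  rewrite (bigID (mem (T i))) /= big1 ?mul1r; last first.
    by move=> e /andP[_ eT]; rewrite /q' /cond eT.
  apply: eq_big => [e|e /andP[_ eT]]; last by rewrite /q' /cond (negbTE eT).
  by rewrite !inE; case: (e \in T i); rewrite ?andbF.
have -> : \prod_(e in T i) q e - t * \sum_(j | near j) \prod_(e in T i :|: T j) q e =
    (\prod_(e in T i) q e) * (1 - t * (\sum_(j | near j) \prod_(e in T j) q' e)).
  rewrite mulrBr mulr1 mulrCA [X in _ = _ - _ * X]mulr_sumr; congr (_ - _ * _).
  by apply: eq_bigr => j _; rewrite prodE.
rewrite -mulrA ler_wpM2l //; apply: le_trans Har.
apply: (@le_trans _ _ (Ex q' (fun H => expR (- (t * Xn H))) * f t)).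
  by rewrite ler_wpM2r.
by rewrite ler_wpM2l // Ex_ge0 // => H; exact: expR_ge0.
Qed.

(** Summing [janson_step] over [i] gives f' <= - (mu - t D) f for the Laplace transform f of the
    count, so exp (mu t - D t^2 / 2) f(t) decreases from its value 1 at 0. The choice t = mu / D
    maximises the exponent. A bound [D] on [Delta] is used instead of [Delta] so as to divide by a
    positive number. *)
Lemma janson (D : R) : Delta <= D -> 0 < D ->
  Ex q (fun H => [forall i, ~~ (T i \subset H)]%:R) <=
    expR (- (mu ^+ 2 / (2 * D))).
Proof.
move=> DeltaD D0.
have mu0 : 0 <= mu.
  by apply: sumr_ge0 => i _; apply: prodr_ge0 => e _; case/andP: (q01 e).
pose h (t : R) := \sum_(H : {set E}) subset_law q H *
  expR (mu * t - D / 2 * t ^+ 2 - t * X H).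
pose dh (t : R) := \sum_(H : {set E}) subset_law q H *
  ((mu - D * t - X H) * expR (mu * t - D / 2 * t ^+ 2 - t * X H)).
have hE (t : R) : h t = expR (mu * t - D / 2 * t ^+ 2) * f t.
  rewrite /h /f /Ex mulr_sumr; apply: eq_bigr => H _.
  by rewrite expRD mulrCA.
have hd (t : R) : is_derive t 1 h (dh t).
  apply: is_derive_bigsum => H.
  apply: is_derive_eq; rewrite /GRing.scale /=; field => //.
have dh0 (s : R) : 0 <= s -> dh s <= 0.
  move=> s0; have -> : dh s = expR (mu * s - D / 2 * s ^+ 2) *
      ((mu - D * s) * f s - Ex q (fun H => X H * expR (- (s * X H)))).
    rewrite /dh /f /Ex [in RHS]mulr_sumr -sumrB mulr_sumr; apply: eq_bigr => K _.
    by rewrite expRD; ring.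
  rewrite pmulr_rle0 ?expR_gt0 // subr_le0.
  have -> : Ex q (fun H => X H * expR (- (s * X H))) =
      \sum_i Ex q (fun H => (T i \subset H)%:R * expR (- (s * X H))).
    rewrite -Ex_sum; congr Ex; apply/funext => H; by rewrite mulr_suml.
  have f0 : 0 <= f s by apply: Ex_ge0 => // H; exact: expR_ge0.
  apply: (@le_trans _ _ ((mu - Delta * s) * f s)).
    by rewrite ler_wpM2r // lerD2l lerN2 ler_wpM2r.
  have -> : (mu - Delta * s) * f s = \sum_i (\prod_(e in T i) q e -
     s * \sum_(j | ~~ [disjoint T i & T j]) \prod_(e in T i :|: T j) q e) * f s.
    by rewrite -mulr_suml sumrB -mulr_sumr [Delta * s]mulrC.
  by apply: ler_sum => i _; exact: janson_step.
pose tau := mu / D.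
have tau0 : 0 <= tau by rewrite divr_ge0 // ltW.
have hle : h tau <= h 0.
  apply: (@ler0_derive1_le_cc _ h 0 tau) => [x _|x||||].
  - by [].
  - by rewrite in_itv /= => /andP[x0 _]; rewrite derive1E derive_val dh0 // ltW.
  - by apply: derivable_within_continuous => x _.
  - by rewrite in_itv /= lexx tau0.
  - by rewrite in_itv /= lexx tau0.
  - by [].
have h0 : h 0 = 1.
  rewrite hE mulr0 expr0n /= mulr0 subrr expR0 mul1r /f -[RHS](Ex_cst q 1).
  by congr Ex; apply/funext => H; rewrite mul0r oppr0 expR0.
apply: (@le_trans _ _ (f tau)).
  apply: le_Ex => // H; case: (boolP [forall i, _]) => [/forallP noT|_]; last exact: expR_ge0.
  rewrite /X big1 ?mulr0 ?oppr0 ?expR0 // => i _.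
  by rewrite (negbTE (noT i)).
move: hle; rewrite h0 hE; set a := mu * tau - _ => hle.
have -> : f tau = expR (- a) * (expR a * f tau) by rewrite mulrA -expRD addNr expR0 mul1r.
rewrite (le_trans (ler_wpM2l (expR_ge0 _) hle)) // mulr1 ler_expR /a /tau.
rewrite le_eqVlt; apply/orP; left; apply/eqP; field; exact: lt0r_neq0.
Qed.

End Janson.

(** * Independent transversals *)

Lemma sum_expr_card (R : realType) (X : finType) (y : R) :
  \sum_(Q : {set X}) y ^+ #|Q| = (1 + y) ^+ #|X|.
Proof.
rewrite -[in RHS]prodr_const addrC bigA_distr; apply: eq_bigr => Q _.
by rewrite -big_mkcond /= prodr_const.
Qed.

Section Pairs.
Context {n : nat}.
Implicit Types S : {set 'I_n}.

Definition pairs S : {set 'I_n * 'I_n} :=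
  [set e : 'I_n * 'I_n | [&& (e.1 < e.2)%N, e.1 \in S & e.2 \in S]].

Lemma pairsI S S' : pairs (S :&: S') = pairs S :&: pairs S'.
Proof.
by apply/finset.setP => e; rewrite !inE; do ![case: (_ \in _)] => /=; rewrite ?andbF ?andbT ?andbb.
Qed.

Lemma sum_pairs (R : realType) (F : 'I_n -> 'I_n -> R) S :
  (forall i j, F i j = F j i) ->
  \sum_(e in pairs S) F e.1 e.2 =
    (\sum_(i in S) \sum_(j in S) F i j - \sum_(i in S) F i i) / 2.
Proof.
move=> Fsym; pose G (P : rel 'I_n) : R :=
  \sum_(e : 'I_n * 'I_n | [&& P e.1 e.2, e.1 \in S & e.2 \in S]) F e.1 e.2.
have GE : \sum_(i in S) \sum_(j in S) F i j = G (fun i j => i < j)%N + G (fun i j => i == j) + G (fun i j => j < i)%N.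
  rewrite pair_big /= (bigID (fun e : 'I_n * 'I_n => (e.1 < e.2)%N)) /=.
  rewrite -addrA; congr (_ + _); first by apply: eq_bigl => e; rewrite andbC.
  rewrite (bigID (fun e : 'I_n * 'I_n => e.1 == e.2)) /=; congr (_ + _); apply: eq_bigl => e /=.
    by rewrite andbC; case: eqP => //= ->; rewrite ltnn andbT.
  rewrite -val_eqE /=; case: (ltngtP e.1 e.2) => h; rewrite ?andbF ?andbT //=.
have Gsym : G (fun i j => j < i)%N = G (fun i j => i < j)%N.
  rewrite /G.
  rewrite (reindex (fun e : 'I_n * 'I_n => (e.2, e.1))) /=; last first.
    by exists (fun e : 'I_n * 'I_n => (e.2, e.1)) => -[].
  by apply: eq_big => [e|e _]; [rewrite [X in _ && X]andbC | rewrite Fsym].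
have Gdiag : G (fun i j => i == j) = \sum_(i in S) F i i.
  rewrite /G (eq_bigl (fun e : 'I_n * 'I_n => (e.1 \in S) && (e.2 == e.1))); last first.
    by move=> e; rewrite [e.2 == _]eq_sym; case: eqP => [->|]; rewrite ?andbb ?andbT ?andbF.
  rewrite -(pair_big_dep (fun i => i \in S) (fun i j => j == i) (fun i j => F i j)) /=.
  by apply: eq_bigr => i _; rewrite big_pred1_eq.
have -> : \sum_(e in pairs S) F e.1 e.2 = G (fun i j => i < j)%N by apply: eq_bigl => e; rewrite inE.
by rewrite GE Gsym Gdiag; field.
Qed.

End Pairs.

Section Transversal.
Context {R : realType} {n N : nat} {Pos A : finType}.
Variables (cl : 'I_n -> A) (v : A -> A -> R) (ty : Pos -> A)
  (x : Pos -> 'I_N -> 'I_n).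
Hypothesis v_sym : forall a b, v a b = v b a.
Hypothesis v_ge0 : forall a b, 0 <= v a b.
Hypothesis cl_x : forall p k, cl (x p k) = ty p.
Hypothesis x_inj : forall p k p' k', x p k = x p' k' -> p = p' /\ k = k'.
Hypothesis N_gt0 : (0 < N)%N.

(* q e is the probability that e is not an edge: the random set H is the set of
   non-edges, so that a vertex set S is independent iff pairs S is in H. *)
Let q (e : 'I_n * 'I_n) : R := expR (- v (cl e.1) (cl e.2)).

(** The sum of [v] over unordered pairs of distinct positions: exp (- energy Q) is the probability
    that the vertices chosen at the positions of [Q] are independent, whichever candidates are
    chosen. *)
Definition energy (Q : {set Pos}) : R :=
  (\sum_(p in Q) \sum_(p' in Q) v (ty p) (ty p') - \sum_(p in Q) v (ty p) (ty p)) / 2.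

(** Each position has its own list of [N] candidates and the lists are disjoint, so two transversals
    share exactly the vertices at the positions where they agree. The overlap sum thereby becomes a
    sum over sets of positions. *)
Definition transversal_of (f : {ffun Pos -> 'I_N}) (Q : {set Pos}) : {set 'I_n} :=
  [set x p (f p) | p in Q].

Let agree (f g : {ffun Pos -> 'I_N}) : {set Pos} := [set p | f p == g p].

Lemma prod_transversal (f : {ffun Pos -> 'I_N}) (Q : {set Pos}) :
  \prod_(e in pairs (transversal_of f Q)) q e = expR (- energy Q).
Proof.
rewrite /q -expR_sum; congr expR; rewrite sumrN; congr (- _).
rewrite (sum_pairs (F := fun i j => v (cl i) (cl j))) //.
have inj : {in Q &, injective (fun p => x p (f p))} by move=> p p' _ _ /x_inj[].
rewrite /energy /transversal_of !(big_imset _ inj) /=; congr ((_ - _) / 2).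
  apply: eq_bigr => p _; rewrite (big_imset _ inj) /=.
  by apply: eq_bigr => p' _; rewrite !cl_x.
by apply: eq_bigr => p _; rewrite !cl_x.
Qed.

Lemma transversalI f g :
  transversal_of f finset.setT :&: transversal_of g finset.setT =
    transversal_of f (agree f g).
Proof.
apply/finset.setP => i; rewrite !inE; apply/andP/imsetP => [[/imsetP[p _ ->]]|[p]].
  move=> /imsetP[p' _ /x_inj[pp' fg]]; exists p => //.
  by rewrite inE fg pp'.
rewrite inE => /eqP fg ->; split; apply/imsetP; exists p => //.
by rewrite fg.
Qed.

(** An upper bound for the ratio of Janson's overlap sum to the square of the expectation; the power
    of [N] is the proportion of choices that agree on [Q]. *)
Let overlap : R := \sum_(Q : {set Pos} | (2 <= #|Q|)%N) expR (energy Q) / N%:R ^+ #|Q|.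

Lemma card_agree_on (f : {ffun Pos -> 'I_N}) (Q : {set Pos}) :
  #|[set g : {ffun Pos -> 'I_N} | agree f g == Q]|%:R <=
    (N%:R ^+ #|Pos| / N%:R ^+ #|Q| : R).
Proof.
rewrite -expfB_cond; last by rewrite pnatr_eq0 (gtn_eqF N_gt0) max_card.
rewrite -natrX ler_nat.
pose F p : pred 'I_N := if p \in Q then pred1 (f p) else predT.
apply: (@leq_trans #|family F|).
  apply/subset_leq_card/fintype.subsetP => g; rewrite inE => /eqP fgQ.
  apply/familyP => p; rewrite /F -fgQ; case: ifP => //; rewrite inE => /eqP ->.
  by rewrite unfold_in /= eqxx.
rewrite card_family foldrE big_map -/(index_enum _) enumT.
rewrite (bigID (mem Q)) /= big1 ?mul1n; last first.
  by move=> p pQ; rewrite /F pQ card1.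
rewrite (eq_bigr (fun=> N)); last by move=> p /negbTE pQ; rewrite /F pQ cardT size_enum_ord.
by rewrite prod_nat_const -(cardsC Q) addKn cardsE.
Qed.

(* Janson's inequality for the N^|Pos| transversals: two of them share a pair of
   vertices only if they agree on a set Q of at least two positions, and the
   number of pairs agreeing on Q is at most N^(2|Pos| - |Q|). *)
Lemma no_clear_transversal (D : R) : overlap <= D -> 0 < D ->
  Ex q (fun H => [forall f : {ffun Pos -> 'I_N},
      ~~ (pairs (transversal_of f finset.setT) \subset H)]%:R) <=
    expR (- (1 / (2 * D))).
Proof.
move=> oD D0.
have q01 e : 0 <= q e <= 1 by rewrite expR_ge0 -[leRHS]expR0 ler_expR oppr_le0 v_ge0.
set P0 := expR (- energy finset.setT).
have N0 : 0 < N%:R :> R by rewrite ltr0n.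
set M : R := N%:R ^+ #|Pos|.
have M0 : 0 < M by rewrite exprn_gt0.
have cardF : #|{ffun Pos -> 'I_N}|%:R = M by rewrite card_ffun card_ord natrX.
pose T (f : {ffun Pos -> 'I_N}) := pairs (transversal_of f finset.setT).
have muE : \sum_f \prod_(e in T f) q e = M * P0.
  rewrite (eq_bigr (fun=> P0)); last by move=> f _; exact: prod_transversal.
  by rewrite sumr_const -mulr_natl cardF.
have P00 : 0 < P0 by exact: expR_gt0.
(* The product over a union is the product over both sets divided by that over their intersection,
   which turns the energy of the agreement set into a positive exponent. *)
have prodU f g : \prod_(e in T f :|: T g) q e = P0 ^+ 2 * expR (energy (agree f g)).
  have TI : T f :&: T g = pairs (transversal_of f (agree f g)).
    by rewrite /T -pairsI transversalI.
  have : (\prod_(e in T f :|: T g) q e) * (\prod_(e in T f :&: T g) q e) =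
      (\prod_(e in T f) q e) * (\prod_(e in T g) q e).
    rewrite (bigID (fun e => e \in T f)) /= (eq_bigl (fun e => e \in T f)); last first.
      by move=> e; rewrite finset.in_setU; case: (e \in T f); rewrite ?andbF.
    rewrite -mulrA; congr (_ * _); rewrite [RHS](bigID (fun e => e \in T f)) /= mulrC.
    congr (_ * _); apply: eq_bigl => e; rewrite ?finset.in_setU ?finset.in_setI.
      by rewrite andbC.
    by case: (e \in T f); rewrite ?andbF ?andbT.
  rewrite TI !prod_transversal => h.
  by rewrite expr2 -h -mulrA -expRD addNr expR0 mulr1.
have agree2 f g : ~~ [disjoint T f & T g] -> (2 <= #|agree f g|)%N.
  rewrite -finset.setI_eq0 => /finset.set0Pn[e]; rewrite /T -pairsI transversalI inE.
  case/and3P=> lt /imsetP[p pf e1] /imsetP[p' pf' e2].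
  rewrite (cardD1 p) pf (cardD1 p') /= inE pf' andbT.
  suff -> : p' != p by [].
  by apply: contraTneq lt => pp'; rewrite e1 e2 pp' ltnn.
have DeltaE : \sum_f \sum_(g | ~~ [disjoint T f & T g]) \prod_(e in T f :|: T g) q e
    <= (M * P0) ^+ 2 * D.
  apply: (@le_trans _ _ (\sum_(f : {ffun Pos -> 'I_N}) (M * P0 ^+ 2 * D))); last first.
    rewrite sumr_const -mulr_natl cardF; rewrite le_eqVlt; apply/orP; left; apply/eqP.
    by ring.
  apply: ler_sum => f _.
  apply: (@le_trans _ _ (\sum_(g | (2 <= #|agree f g|)%N) P0 ^+ 2 * expR (energy (agree f g)))).
    rewrite big_mkcond [leRHS]big_mkcond /=; apply: ler_sum => g _.
    rewrite prodU; case: ifP => [/agree2 -> //|_]; case: ifP => // _.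
    by rewrite mulr_ge0 ?exprn_ge0 ?expR_ge0 // ltW.
  have -> : M * P0 ^+ 2 * D = P0 ^+ 2 * (M * D) by ring.
  rewrite -mulr_sumr ler_wpM2l ?exprn_ge0 ?(ltW P00) //.
  rewrite (partition_big (agree f) (fun Q => (2 <= #|Q|)%N)) //=.
  apply: (@le_trans _ _ (M * overlap)); last by rewrite ler_wpM2l // ltW.
  rewrite /overlap mulr_sumr; apply: ler_sum => Q Q2.
  rewrite (eq_bigr (fun=> expR (energy Q))); last by move=> g /andP[_ /eqP ->].
  have -> : M * (expR (energy Q) / N%:R ^+ #|Q|) = M / N%:R ^+ #|Q| * expR (energy Q).
    by rewrite mulrCA mulrC.
  rewrite sumr_const -[leLHS]mulr_natl ler_wpM2r ?expR_ge0 //.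
  apply: le_trans (card_agree_on f Q).
  rewrite ler_nat; apply/subset_leq_card/fintype.subsetP => g; rewrite !inE.
  by case/andP.
have := @janson R _ _ q T q01 ((M * P0) ^+ 2 * D) DeltaE.
rewrite muE => /(_ _)/le_trans; apply.
  by rewrite mulr_gt0 // exprn_gt0 // mulr_gt0.
rewrite ler_expR lerN2 le_eqVlt; apply/orP; left; apply/eqP.
field; rewrite !lt0r_neq0 //.
Qed.

End Transversal.

(* For |Q| <= L / (10 B) the second bound on en is the better one and each term
   is about N^-|Q|; for larger Q the first bound makes it superpolynomially small. *)
Lemma overlap_le (R : realType) (Pos : finType) (N : nat) (eps B L : R)
    (en : {set Pos} -> R) :
  0 < eps <= 1 / 5 -> 0 < B -> 10 <= L -> 40 * B <= eps * L ->
  expR ((1 - eps / 4) * L) <= N%:R -> #|Pos|%:R <= expR (eps / 4 * L) ->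
  (forall Q, en Q <= (1 - eps) * L * #|Q|%:R) ->
  (forall Q, en Q <= B / 2 * #|Q|%:R ^+ 2) ->
  \sum_(Q : {set Pos} | (2 <= #|Q|)%N) expR (en Q) / N%:R ^+ #|Q| <=
    expR (- (3 / 2 * L)).
Proof.
move=> /andP[eps0 eps5] B0 L10 BL hN ht hen1 hen2.
have N0 : 0 < N%:R :> R by apply: lt_le_trans hN; exact: expR_gt0.
(* Each position of a small [Q] gains at least (1 - eps / 2 - 1 / 20) L >= (17 / 20) L, and [Q] has
   at least two. The weights t^(- |Q|) sum to at most (1 + 1 / t)^t <= e, a factor absorbed between
   17 / 10 and 3 / 2 because [L] is at least 10. *)
set t : R := #|Pos|%:R; pose M := expR (- (17 / 10 * L)).
apply: (@le_trans _ _ (\sum_(Q : {set Pos} | (2 <= #|Q|)%N) t^-1 ^+ #|Q| * M)).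
  apply: ler_sum => Q Q2; set k := #|Q|.
  have t0 : 0 < t.
    by rewrite ltr0n (leq_trans _ (max_card (mem Q))) // (leq_trans _ Q2).
  have k2 : 2 <= k%:R :> R by rewrite (ler_nat _ 2).
  have key : en Q + (eps / 4 * L) *+ k - ((1 - eps / 4) * L) *+ k <= - (17 / 10 * L).
    rewrite -(mulr_natr (eps / 4 * L)) -(mulr_natr ((1 - eps / 4) * L)); have h1 := hen1 Q; have h2 := hen2 Q.
    rewrite -/k in h1 h2; set x : R := k%:R in k2 h1 h2 *.
    have L0 : 0 <= L by lra.
    have x0 : 0 <= x by lra.
    have Lx : L * 2 <= L * x by rewrite ler_wpM2l.
    have [xs|xb] := leP (10 * B * x) L.
      have h3 : B / 2 * x ^+ 2 <= L / 20 * x.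
        rewrite expr2 mulrA ler_wpM2r //; lra.
      have h4 : eps * (L * x) <= 1 / 5 * (L * x) by rewrite ler_wpM2r // mulr_ge0.
      lra.
    have h3 : 40 * B * x <= eps * L * x by rewrite ler_wpM2r.
    lra.
  rewrite ler_pdivrMr ?exprn_gt0 // exprVn -mulrA mulrC ler_pdivlMr ?exprn_gt0 //.
  apply: (@le_trans _ _ (expR (en Q) * expR (eps / 4 * L) ^+ k)).
    by rewrite ler_wpM2l ?expR_ge0 // lerXn2r // nnegrE ?expR_ge0 // ltW.
  apply: (@le_trans _ _ (M * expR ((1 - eps / 4) * L) ^+ k)); last first.
    by rewrite ler_wpM2l ?expR_ge0 // lerXn2r // nnegrE ?expR_ge0 // ltW.
  rewrite -!expRM_natl -!expRD ler_expR !mulr_natl; lra.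
rewrite -mulr_suml.
apply: (@le_trans _ _ (expR 1 * M)).
  rewrite ler_wpM2r ?expR_ge0 //.
  apply: (@le_trans _ _ (\sum_(Q : {set Pos}) t^-1 ^+ #|Q|)).
    rewrite [leRHS](bigID (fun Q : {set Pos} => 2 <= #|Q|)%N) /= lerDl sumr_ge0 // => Q _.
    by rewrite exprn_ge0 // invr_ge0.
  rewrite sum_expr_card; apply: (@le_trans _ _ (expR t^-1 ^+ #|Pos|)).
    by rewrite lerXn2r // ?nnegrE ?expR_ge0 ?expR_ge1Dx // addr_ge0 ?invr_ge0.
  rewrite -expRM_natl ler_expR -/t; case: (eqVneq t 0) => [->|t0]; first by rewrite mul0r.
  by rewrite divff.
rewrite /M -expRD ler_expR; lra.
Qed.

Definition cell_part (n : nat) (A : finType) (cl : 'I_n -> A) (U : {set 'I_n}) (a : A) :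
  {set 'I_n} := [set i in U | cl i == a].

(** For K = 2 (1 - eps) ln n, each sub-profile of size r costs a factor at most n^((1 - eps) r) in
    probability, less than the roughly n^r ways to choose its vertices. This is what the second
    moment method needs. *)
Definition admissible (R : realType) (A : finType) (v : A -> A -> R) (K : R)
    (s : A -> nat) : Prop :=
  forall r : A -> nat, (forall a, (r a <= s a)%N) ->
    \sum_a \sum_b (r a)%:R * (r b)%:R * v a b <= K * \sum_a (r a)%:R.

(** Cells with fewer than [u] vertices left in [U] are exempt: no candidate lists can be carved out
    of them, and they leave at most [u] vertices each to be coloured separately. *)
Definition extracts (n : nat) (A : finType) (cl : 'I_n -> A) (u : nat) (s : A -> nat)
    (U I : {set 'I_n}) : bool :=
  (I \subset U) && [forall a, (u <= #|cell_part cl U a|)%N ==>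
                      (s a <= #|cell_part cl I a|)%N].

Section IndependentSets.
Context {R : realType} {n T N : nat} {A : finType}.
Variables (cl : 'I_n -> A) (v : A -> A -> R) (s : A -> nat) (eps B L : R).
Hypothesis i0 : 'I_n.
Hypothesis v_sym : forall a b, v a b = v b a.
Hypothesis v_ge0 : forall a b, 0 <= v a b.
Hypothesis v_le : forall a b, v a b <= B.
Hypothesis eps15 : 0 < eps <= 1 / 5.
Hypothesis B0 : 0 < B.
Hypothesis L10 : 10 <= L.
Hypothesis BL : 40 * B <= eps * L.
Hypothesis N_big : expR ((1 - eps / 4) * L) <= N%:R.
Hypothesis T_small : (#|A| * T)%:R <= expR (eps / 4 * L).
Hypothesis s_T : forall a, (s a <= T)%N.
Hypothesis s_adm : admissible v ((1 - eps) * (2 * L)) s.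

Let q (e : 'I_n * 'I_n) : R := expR (- v (cl e.1) (cl e.2)).
Let u := (T * N)%N.

(* The bound beats the number 2^n of sets U, which allows a union bound. *)
Lemma no_extraction (U : {set 'I_n}) :
  Ex q (fun H => [forall I : {set 'I_n}, (pairs I \subset H) ==> ~~ extracts cl u s U I]%:R)
    <= expR (- (expR (3 / 2 * L) / 2)).
Proof.
have N0 : (0 < N)%N by rewrite -(ltr0n R); apply: lt_le_trans N_big; exact: expR_gt0.
(* A position is a large cell with an index below its quota. Position (a, j) receives the j-th block
   of [N] consecutive vertices of the cell, so [T * N] vertices are enough for all blocks. *)
pose okp (p : A * 'I_T) := (u <= #|cell_part cl U p.1|)%N && (p.2 < s p.1)%N.
pose Pos : finType := {p : A * 'I_T | okp p}.
pose ty (p : Pos) : A := (val p).1.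
pose x (p : Pos) (k : 'I_N) : 'I_n :=
  nth i0 (enum (cell_part cl U (ty p))) ((val p).2 * N + k).
have xidx (p : Pos) (k : 'I_N) : ((val p).2 * N + k < #|cell_part cl U (ty p)|)%N.
  case/andP: (valP p) => h _; apply: leq_trans h.
  rewrite /u -addnS; apply: (@leq_trans ((val p).2 * N + N)); first by rewrite leq_add2l.
  by rewrite addnC -mulSn leq_mul2r ltn_ord orbT.
have xin p k : x p k \in cell_part cl U (ty p).
  by rewrite -mem_enum mem_nth // -cardE.
have clx p k : cl (x p k) = ty p.
  by have := xin p k; rewrite inE => /andP[_ /eqP].
have xinj p k p' k' : x p k = x p' k' -> p = p' /\ k = k'.
  move=> e; have tye : ty p = ty p' by rewrite -(clx p k) e clx.
  move: e; rewrite /x -tye => /eqP; rewrite nth_uniq ?enum_uniq -?cardE //; last first.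
    by rewrite tye.
  move=> /eqP e.
  have e2 : (val p).2 = (val p').2 :> nat.
    have := congr1 (divn^~ N) e; rewrite !divnMDl // !divn_small ?addn0 //.
  split; last first.
    by apply: val_inj; move: e; rewrite e2 => /addnI.
  apply: val_inj; move: tye e2; rewrite /ty.
  by case: (val p) (val p') => [a j] [a' j'] /= -> /val_inj ->.
have cardPos : #|Pos|%:R <= expR (eps / 4 * L).
  apply: le_trans T_small; rewrite ler_nat card_sig.
  by apply: (leq_trans (max_card _)); rewrite card_prod card_ord.
(* The numbers of positions of each type in [Q] form a sub-profile of [s], and dropping the diagonal
   only lowers the energy. *)
have en1 Q : energy v ty Q <= (1 - eps) * L * #|Q|%:R.
  pose r a := #|[set p in Q | ty p == a]|.
  have rs a : (r a <= s a)%N.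
    have hj (p : Pos) : p \in [set p in Q | ty p == a] -> ((val p).2 < s a)%N.
      by rewrite inE => /andP[_ /eqP <-]; case/andP: (valP p).
    case: (posnP (s a)) => [sa0|sa0].
      rewrite sa0 leqn0 cards_eq0; apply/eqP/finset.setP => p; rewrite finset.in_set0.
      by apply/negP => /hj; rewrite sa0.
    pose h (p : Pos) : 'I_(s a) := insubd (Ordinal sa0) (val (val p).2).
    have hinj : {in [set p in Q | ty p == a] &, injective h}.
      move=> p p' pi pi' /(congr1 val); rewrite !val_insubd !hj // => e2.
      apply: val_inj; move: pi pi' e2; rewrite !inE /ty => /andP[_ /eqP a1] /andP[_ /eqP a2].
      move: a1 a2; case: (val p) (val p') => [b j] [b' j'] /= -> -> /val_inj -> //.
    by rewrite /r -(card_in_imset hinj) -[leqRHS]card_ord max_card.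
  have := s_adm rs.
  have -> : \sum_a (r a)%:R = #|Q|%:R :> R.
    rewrite -sum1_card (partition_big ty predT) //= natr_sum; apply: eq_bigr => a _.
    by rewrite /r -sum1_card; congr (_%:R); apply: eq_bigl => p; rewrite inE.
  have -> : \sum_a \sum_b (r a)%:R * (r b)%:R * v a b =
      \sum_(p in Q) \sum_(p' in Q) v (ty p) (ty p').
    rewrite [RHS](partition_big ty predT) //=; apply: eq_bigr => a _.
    rewrite [RHS](eq_bigr (fun=> \sum_b (r b)%:R * v a b)); last first.
      move=> p /andP[_ /eqP ->]; rewrite (partition_big ty predT) //=.
      apply: eq_bigr => b _; rewrite (eq_bigr (fun=> v a b)); last by move=> p' /andP[_ /eqP ->].
      rewrite sumr_const -[LHS]mulr_natl; congr (_%:R * _).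
      by apply: eq_card => p'; rewrite [RHS]inE.
    rewrite sumr_const -[RHS]mulr_natl mulr_sumr.
    have -> : #|[pred p | (p \in Q) && (ty p == a)]| = r a.
      by apply: eq_card => p'; rewrite [RHS]inE.
    by apply: eq_bigr => b _; rewrite mulrA.
  have d0 : 0 <= \sum_(p in Q) v (ty p) (ty p) by apply: sumr_ge0.
  rewrite /energy; lra.
have en2 Q : energy v ty Q <= B / 2 * #|Q|%:R ^+ 2.
  have d0 : 0 <= \sum_(p in Q) v (ty p) (ty p) by apply: sumr_ge0.
  have : \sum_(p in Q) \sum_(p' in Q) v (ty p) (ty p') <= B * #|Q|%:R ^+ 2.
    apply: (@le_trans _ _ (\sum_(p in Q) \sum_(p' in Q) B)).
      by apply: ler_sum => p _; apply: ler_sum => p' _.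
    by rewrite !sumr_const -mulrnA -[leLHS]mulr_natr natrM -expr2 lexx.
  rewrite /energy; lra.
have := @no_clear_transversal R n N Pos A cl v ty x v_sym v_ge0 clx xinj N0
  (expR (- (3 / 2 * L))) (overlap_le eps15 B0 L10 BL N_big cardPos en1 en2) (expR_gt0 _).
have -> : 1 / (2 * expR (- (3 / 2 * L))) = expR (3 / 2 * L) / 2.
  by rewrite expRN; field; rewrite lt0r_neq0 ?expR_gt0.
apply: le_trans; apply: le_Ex => [e|H].
  by rewrite expR_ge0 -[leRHS]expR0 ler_expR oppr_le0 v_ge0.
rewrite ler_nat; case: (boolP [forall I, _]) => //= /forallP noI.
rewrite lt0b; apply/forallP => f; apply/negP => fH.
have /implyP/(_ fH)/negP := noI (transversal_of x f finset.setT); apply.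
apply/andP; split.
  apply/fintype.subsetP => i /imsetP[p _ ->].
  by have := xin p (f p); rewrite inE => /andP[].
apply/forallP => a; apply/implyP => ua.
have pok (j : 'I_(s a)) : okp (a, widen_ord (s_T a) j) by rewrite /okp /= ua ltn_ord.
pose h (j : 'I_(s a)) := x (Sub _ (pok j) : Pos) (f (Sub _ (pok j) : Pos)).
have hinj : injective h.
  by move=> j j' /xinj[/(congr1 val)/(congr1 snd)/(congr1 val) /= /val_inj].
rewrite -[leqLHS]card_ord -(card_imset _ hinj).
apply/subset_leq_card/fintype.subsetP => i /imsetP[j _ ->]; rewrite inE clx eqxx andbT.
by apply/imsetP; eexists.
Qed.

End IndependentSets.

(** * The random graph at fixed vertex positions *)

Section GraphLaw.
Context {n : nat}.

Definition nonedges (g : graph n) : {set 'I_n * 'I_n} := [set e | ~~ adj g e.1 e.2].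

(** The product law lives on all ordered pairs, but only the pairs (i, j) with i < j are read from
    [H], each deciding both arcs. *)
Definition arcs_of (H : {set 'I_n * 'I_n}) : {set 'I_n * 'I_n} :=
  [set e : 'I_n * 'I_n | [&& (e.1 < e.2)%N & e \notin H] || [&& (e.2 < e.1)%N & (e.2, e.1) \notin H]].

Lemma arcs_of_simple (H : {set 'I_n * 'I_n}) : is_simple (arcs_of H).
Proof.
apply/andP; split; first by apply/forallP => i; rewrite inE /= ltnn.
by apply/forallP => i; apply/forallP => j; rewrite !inE /= orbC.
Qed.

Definition graph_of (H : {set 'I_n * 'I_n}) : graph n :=
  exist _ (arcs_of H) (arcs_of_simple H).

Lemma adj_sym (g : graph n) i j : adj g i j = adj g j i.
Proof. by case: g => E hE; have /andP[_ /forallP/(_ i)/forallP/(_ j)/eqP] := hE. Qed.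

Lemma adj_irr (g : graph n) i : adj g i i = false.
Proof. by case: g => E hE; have /andP[/forallP/(_ i)/negbTE] := hE. Qed.

Lemma adj_graph_of H (e : 'I_n * 'I_n) : (e.1 < e.2)%N ->
  adj (graph_of H) e.1 e.2 = (e \notin H).
Proof.
by case: e => i j /= ij; rewrite /adj /= inE /= ij (ltnNge j) (ltnW ij) orbF.
Qed.

Lemma pairs_nonedges H (S : {set 'I_n}) :
  (pairs S \subset nonedges (graph_of H)) = (pairs S \subset H).
Proof.
by apply/fintype.subsetP/fintype.subsetP => h e eS; have := h e eS;
  move: eS; rewrite !inE => /andP[lt _]; rewrite adj_graph_of ?negbK.
Qed.

Lemma independentP (g : graph n) (S : {set 'I_n}) :
  reflect {in S &, forall i j, ~~ adj g i j} (pairs S \subset nonedges g).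
Proof.
apply: (iffP fintype.subsetP) => [h i j iS jS|h e]; last first.
  by rewrite !inE => /and3P[_ e1 e2]; exact: h.
case: (ltngtP i j) => ij.
- by have := h (i, j); rewrite !inE /= ij iS jS => /(_ isT).
- by have := h (j, i); rewrite !inE /= ij iS jS adj_sym => /(_ isT).
- by rewrite (val_inj ij) adj_irr.
Qed.

Variables (R : realType) (W : R -> R -> R) (x : n.-tuple R).
Hypothesis W01 : forall i j, 0 <= W (tnth x i) (tnth x j) <= 1.

Let q (e : 'I_n * 'I_n) : R := 1 - W (tnth x e.1) (tnth x e.2).

Lemma edge_law_ge0 g : 0 <= edge_law W x g.
Proof.
by apply: prodr_ge0 => e _; case: ifP => _; rewrite ?subr_ge0; case/andP: (W01 e.1 e.2).
Qed.

(** [edge_law] is the image of the product law under [graph_of]. The marginals of the pairs that are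
    never read may be set to 0, after which a single [H] in each fibre can carry weight. *)
Lemma sum_edge_law (F : graph n -> R) :
  \sum_g edge_law W x g * F g = Ex q (fun H => F (graph_of H)).
Proof.
pose q' (e : 'I_n * 'I_n) : R := if (e.1 < e.2)%N then q e else 0.
rewrite (@Ex_ignores _ _ q q' [set e : 'I_n * 'I_n | ~~ (e.1 < e.2)%N]); first last.
- move=> e; rewrite inE => elt H; congr F; apply: val_inj.
  apply/finset.setP => -[i j]; rewrite !inE /=.
  have neq (k l : 'I_n) : (k < l)%N -> ((k, l) == e) = false.
    by move=> kl; apply: contraNF elt => /eqP <-.
  case: (ltngtP i j) => ij //=; first by rewrite (neq _ _ ij).
  by rewrite (neq _ _ ij).
- by move=> e; rewrite inE negbK /q' => ->.
rewrite /Ex [RHS](partition_big graph_of predT) //=; apply: eq_bigr => g _.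
pose Hg : {set 'I_n * 'I_n} := [set e : 'I_n * 'I_n | (e.1 < e.2)%N && ~~ adj g e.1 e.2]%SET.
have gHg : graph_of Hg = g.
  apply: val_inj; apply/finset.setP => -[i j]; rewrite !inE /=.
  rewrite -[RHS]/(adj g i j).
  case: (ltngtP i j) => ij /=; first by rewrite negbK orbF.
    by rewrite negbK adj_sym.
  by rewrite (val_inj ij) adj_irr.
rewrite (bigD1 Hg) /=; last by rewrite gHg.
rewrite gHg big1 ?addr0 => [|H /andP[/eqP gH HHg]].
  congr (_ * _); rewrite /edge_law /subset_law [RHS](bigID (fun e : 'I_n * 'I_n => (e.1 < e.2)%N)) /=.
  rewrite [X in _ = _ * X]big1 ?mulr1 => [|e elt]; last first.
    by rewrite inE (negbTE elt) /q' (negbTE elt) subr0.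
  apply: eq_bigr => e elt; rewrite inE elt /q' elt /q.
  by case: (adj g _ _) => //=; rewrite opprB addrC subrK.
suff [e eH elt] : exists2 e, e \in H & ~~ (e.1 < e.2)%N.
  by rewrite /subset_law (bigD1 e) //= eH /q' (negbTE elt) !mul0r.
apply/exists_inP; apply: contraNT HHg => /exists_inPn hH.
apply/eqP/finset.setP => e; rewrite inE -gH.
case: (boolP (e.1 < e.2)%N) => elt; first by rewrite adj_graph_of // negbK.
by apply: contraNF elt => /hH; rewrite negbK.
Qed.

Lemma prob_edge_law (B : pred (graph n)) :
  \sum_(g | B g) edge_law W x g = Ex q (fun H => (B (graph_of H))%:R).
Proof.
rewrite -(sum_edge_law (fun g => (B g)%:R)) big_mkcond; apply: eq_bigr => g _.
by case: (B g); rewrite ?mulr1 ?mulr0.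
Qed.

Lemma q01 e : 0 <= q e <= 1.
Proof. by rewrite /q; have := W01 e.1 e.2; lra. Qed.

(* No independent set is much heavier than the first moment method allows. *)
Definition sparse (A : finType) (cl : 'I_n -> A) (v : A -> A -> R) (K : R) (g : graph n) : bool :=
  [forall S : {set 'I_n}, (pairs S \subset nonedges g) ==>
    (\sum_(e in pairs S) v (cl e.1) (cl e.2) <= K * #|S|%:R)].

(** Union bound: a violating [S] is nonempty and independent with probability at most exp (- K |S|),
    and these bounds sum to (1 + exp (- K))^n - 1 over the nonempty sets. This is small once [K]
    exceeds ln n by a constant factor. *)
Lemma prob_not_sparse (A : finType) (cl : 'I_n -> A) (v : A -> A -> R) (K : R) :
  (forall i j, 1 - W (tnth x i) (tnth x j) <= expR (- v (cl i) (cl j))) ->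
  \sum_(g | ~~ sparse cl v K g) edge_law W x g <= expR (n%:R * expR (- K)) - 1.
Proof.
move=> hv; rewrite prob_edge_law.
pose big (S : {set 'I_n}) := K * #|S|%:R < \sum_(e in pairs S) v (cl e.1) (cl e.2).
apply: (@le_trans _ _ (Ex q (fun H => \sum_(S | big S) (pairs S \subset H)%:R))).
  apply: le_Ex => [|H]; first exact: q01.
  case: (boolP (sparse _ _ _ _)) => /= [_|]; first by rewrite sumr_ge0.
  move=> /forallPn[S]; rewrite negb_imply pairs_nonedges -ltNge => /andP[SH bS].
  rewrite (bigD1 S) //= SH lerDl sumr_ge0 //.
rewrite Ex_sum.
apply: (@le_trans _ _ (\sum_(S : {set 'I_n} | S != finset.set0) expR (- K) ^+ #|S|)).
  rewrite big_mkcond [leRHS]big_mkcond /=; apply: ler_sum => S _.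
  case: ifPn => [bS|_]; last by case: ifP => // _; rewrite exprn_ge0 ?expR_ge0.
  rewrite ifT; last first.
    apply: contraTneq bS => ->; rewrite /big finset.cards0 mulr0 big1 ?ltxx // => e.
    by rewrite !inE /= andbF.
  rewrite Ex_sub; apply: (@le_trans _ _ (expR (- \sum_(e in pairs S) v (cl e.1) (cl e.2)))).
    rewrite -sumrN expR_sum; apply: ler_prod => e _.
    by case/andP: (q01 e) => -> _ /=; exact: hv.
  by rewrite -expRM_natl ler_expR mulrN lerN2 mulrC ltW.
have := sum_expr_card 'I_n (expR (- K)); rewrite (bigD1 finset.set0) //= finset.cards0 expr0 card_ord.
set Sg := \sum_(S | _) _ => e; have -> : Sg = (1 + expR (- K)) ^+ n - 1 by rewrite -e [1 + _]addrC addrK.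
rewrite lerD2r expRM_natl lerXn2r ?nnegrE ?expR_ge0 ?expR_ge1Dx //.
Qed.

(** Uniform in [U], so that it applies to the remainders of a greedy colouring, which depend on
    [g]. *)
Definition extractable (A Lam : finType) (cl : 'I_n -> A) (u : nat)
    (s : Lam -> A -> nat) (g : graph n) : bool :=
  [forall l, forall U : {set 'I_n}, exists I : {set 'I_n},
     (pairs I \subset nonedges g) && extracts cl u (s l) U I].

Lemma prob_not_extractable (A Lam : finType) (cl : 'I_n -> A) (v : A -> A -> R)
    (T N : nat) (s : Lam -> A -> nat) (eps B L : R) :
  (0 < n)%N -> (forall a b, v a b = v b a) -> (forall a b, 0 <= v a b <= B) ->
  0 < eps <= 1 / 5 -> 0 < B -> 10 <= L -> 40 * B <= eps * L ->
  expR ((1 - eps / 4) * L) <= N%:R -> (#|A| * T)%:R <= expR (eps / 4 * L) ->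
  (forall l a, (s l a <= T)%N) ->
  (forall l, admissible v ((1 - eps) * (2 * L)) (s l)) ->
  (forall i j, expR (- v (cl i) (cl j)) <= 1 - W (tnth x i) (tnth x j)) ->
  \sum_(g | ~~ extractable cl (T * N) s g) edge_law W x g <=
    #|Lam|%:R * 2 ^+ n * expR (- (expR (3 / 2 * L) / 2)).
Proof.
move=> n0 vsym v0B eps15 B0 L10 BL hN hT sT sadm hv; rewrite prob_edge_law.
pose bad l U (H : {set 'I_n * 'I_n}) : bool := [forall I : {set 'I_n},
  (pairs I \subset H) ==> ~~ extracts cl (T * N) (s l) U I].
apply: (@le_trans _ _ (Ex q (fun H => \sum_l \sum_(U : {set 'I_n}) (bad l U H)%:R))).
  apply: le_Ex => [|H]; first exact: q01.
  have bad0 l : 0 <= \sum_(U : {set 'I_n}) (bad l U H)%:R :> R by exact: sumr_ge0.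
  case: (boolP (extractable _ _ _ _)) => /= [_|]; first by rewrite sumr_ge0.
  move=> /forallPn[l] /forallPn[U] /existsPn nI.
  rewrite (bigD1 l) //= (bigD1 U) //=.
  have -> : bad l U H.
    apply/forallP => I; have := nI I; rewrite pairs_nonedges negb_and.
    by case: (_ \subset _).
  by rewrite -addrA lerDl addr_ge0 ?sumr_ge0.
rewrite Ex_sum; under eq_bigr do rewrite Ex_sum.
apply: (@le_trans _ _ (\sum_(l : Lam) \sum_(U : {set 'I_n}) expR (- (expR (3 / 2 * L) / 2)))).
  apply: ler_sum => l _; apply: ler_sum => U _.
  have v0 a b : 0 <= v a b by case/andP: (v0B a b).
  apply: le_trans (@no_extraction R n T N A cl v (s l) eps B L (Ordinal n0) vsym v0 _
    eps15 B0 L10 BL hN hT (sT l) (sadm l) U); last by move=> a b; case/andP: (v0B a b).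
  (* Failure to extract is decreasing in the set of non-edges, so replacing the non-edge
     probabilities by the smaller exp (- v) can only make it more likely. *)
  apply: Ex_decreasing_le => [e||e|H K HK].
  - by rewrite expR_ge0 -[leRHS]expR0 ler_expR oppr_le0 v0.
  - exact: q01.
  - exact: hv.
  rewrite ler_nat; case: (boolP (bad l U K)) => //= /forallP bK.
  rewrite lt0b; apply/forallP => I; apply/implyP => IH.
  by have /implyP := bK I; apply; exact: fintype.subset_trans HK.
rewrite !sumr_const -mulrnA -[leLHS]mulr_natl mulnC natrM ler_wpM2r ?expR_ge0 //.
rewrite ler_wpM2l //; have := sum_expr_card 'I_n (1 : R).
rewrite card_ord => <-; rewrite (eq_bigr (fun=> 1)) ?sumr_const // => S _.
by rewrite expr1n.
Qed.

End GraphLaw.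

(** * Greedy colouring *)

Section PartialColoring.
Context {n : nat}.
Implicit Types (g : graph n) (U I : {set 'I_n}).

(** Colours are natural numbers, so that two palettes are put side by side by a mere shift. *)
Definition pcolorable g U (k : nat) : Prop :=
  exists c : 'I_n -> nat, (forall i, i \in U -> (c i < k)%N) /\
    {in U &, forall i j, adj g i j -> c i <> c j}.

Lemma pcolorable_chi g k : pcolorable g finset.setT k -> (chi g <= k)%N.
Proof.
move=> [c [ck cadj]]; rewrite /chi; case: ex_minnP => m _; apply.
apply/existsP; exists [ffun i => Ordinal (ck i (finset.in_setT i))].
apply/forallP => i; apply/forallP => j; apply/implyP => ij; rewrite !ffunE.
by apply/eqP => /(congr1 val) /=; apply: cadj.
Qed.

Lemma pcolorableU g U U' k k' :
  pcolorable g U k -> pcolorable g U' k' -> pcolorable g (U :|: U') (k + k').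
Proof.
move=> [c [ck cadj]] [c' [ck' cadj']].
exists (fun i => if i \in U then c i else (k + c' i)%N); split => [i|i j].
  rewrite inE; case: ifP => [iU _|_ /= iU']; last by rewrite ltn_add2l ck'.
  by rewrite (leq_trans (ck i iU)) ?leq_addr.
rewrite !inE; case: ifP => [iU _|_ /= iU']; case: ifP => [jU _|_ /= jU'] ij.
- exact: cadj.
- by move=> e; have := ck i iU; rewrite e ltnNge leq_addr.
- by move=> e; have := ck j jU; rewrite -e ltnNge leq_addr.
- by move=> /addnI; exact: cadj'.
Qed.

Lemma pcolorable_sub g U U' k : U \subset U' -> pcolorable g U' k -> pcolorable g U k.
Proof.
move=> /fintype.subsetP s [c [ck cadj]]; exists c; split => [i /s|i j /s iU /s jU]; auto.
Qed.

Lemma pcolorable_independent g I : pairs I \subset nonedges g -> pcolorable g I 1.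
Proof.
move=> /independentP ind; exists (fun=> 0%N); split => // i j iI jI.
by move=> ij; have := ind i j iI jI; rewrite ij.
Qed.

Lemma pcolorable_card g U : pcolorable g U #|U|.
Proof.
exists (fun i => index i (enum U)); split => [i iU|i j iU jU ij].
  by rewrite cardE index_mem mem_enum.
move=> /(congr1 (nth i (enum U))); rewrite !nth_index ?mem_enum // => e.
by move: ij; rewrite e adj_irr.
Qed.

Section Greedy.
Context {A Lam : finType}.
Variables (cl : 'I_n -> A) (u : nat) (s : Lam -> A -> nat) (g : graph n).
Hypothesis ext : extractable cl u s g.

Lemma cell_partS U U' a : U \subset U' -> cell_part cl U a \subset cell_part cl U' a.
Proof.
move=> /fintype.subsetP sU; apply/fintype.subsetP => i; rewrite !inE.
by case/andP => /sU ->.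
Qed.

(** An extraction removes at least the prescribed number of vertices from each cell that still has
    [u] of them, and a cell below [u] stays below; hence the maximum. *)
Lemma greedy_steps (l : seq Lam) U :
  exists2 U' : {set 'I_n}, U' \subset U & pcolorable g (U :\: U') (size l) /\
    forall a, (#|cell_part cl U' a| <=
      maxn u (#|cell_part cl U a| - \sum_(j <- l) s j a))%N.
Proof.
elim: l U => [|j l IH] U.
  exists U => //; rewrite finset.setDv; split.
    by have := pcolorable_card g finset.set0; rewrite finset.cards0.
  by move=> a; rewrite big_nil subn0 leq_maxr.
have /forallP/(_ j)/forallP/(_ U)/existsP[I /and3P[indI sIU /forallP exI]] := ext.
have [U' sU' [colU' cellU']] := IH (U :\: I).
have sU'U : U' \subset U by apply: (fintype.subset_trans sU'); exact: finset.subsetDl.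
exists U' => //; split.
  apply: (@pcolorable_sub _ _ (I :|: (U :\: I :\: U'))).
    apply/fintype.subsetP => i; rewrite !inE => /andP[-> ->].
    by case: (i \in I).
  by rewrite -[size _]/(1 + size l)%N; apply: pcolorableU => //; exact: pcolorable_independent.
move=> a; case: (leqP u #|cell_part cl U a|) => hu; last first.
  rewrite leq_max; apply/orP; left; apply: leq_trans (ltnW hu).
  exact/subset_leq_card/cell_partS.
apply: leq_trans (cellU' a) _; rewrite geq_max leq_maxl /= leq_max; apply/orP; right.
rewrite big_cons subnDA leq_sub2r //.
have -> : cell_part cl (U :\: I) a = cell_part cl U a :\: cell_part cl I a.
  by apply/finset.setP => i; rewrite !inE; case: (i \in I); case: (_ == _); rewrite ?andbF.
rewrite cardsD (finset.setIidPr _) ?cell_partS //; apply: leq_sub2l.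
by have /implyP := exI a; apply.
Qed.

(** Profile [j] is extracted [M j] times. Since these extractions would exhaust every cell, at most
    [u] vertices per cell survive, and each survivor gets its own colour. *)
Lemma chi_le_greedy (M : Lam -> nat) :
  (forall a, (#|[set i | cl i == a]%SET| <= \sum_j M j * s j a)%N) ->
  (chi g <= \sum_j M j + #|A| * u)%N.
Proof.
move=> hM; pose l := flatten [seq nseq (M j) j | j <- enum Lam].
have [U' _ [col cell]] := greedy_steps l finset.setT.
have sumE (F : Lam -> nat) : (\sum_(j <- l) F j = \sum_j M j * F j)%N.
  rewrite /l big_flatten /= big_map big_enum /=; apply: eq_bigr => j _.
  by rewrite big_nseq iter_addn addn0 mulnC.
have cardU' : (#|U'| <= #|A| * u)%N.
  rewrite -sum1_card (partition_big cl predT) //= -sum_nat_const leq_sum // => a _.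
  have -> : \sum_(i in U' | cl i == a) 1 = #|cell_part cl U' a|.
    by rewrite /cell_part -sum1_card; apply: eq_bigl => i; rewrite inE.
  apply: leq_trans (cell a) _; rewrite geq_max leqnn /= sumE.
  have -> : (#|cell_part cl finset.setT a| - \sum_j M j * s j a = 0)%N.
    apply/eqP; rewrite subn_eq0; apply: leq_trans (hM a).
    by apply/subset_leq_card/fintype.subsetP => i; rewrite !inE.
  by [].
apply: (@leq_trans (size l + #|U'|)); last first.
  rewrite leq_add // -sum1_size sumE; apply: leq_sum => j _; by rewrite muln1.
apply: pcolorable_chi; apply: (@pcolorable_sub _ _ ((finset.setT :\: U') :|: U')).
  by apply/fintype.subsetP => i _; rewrite !inE; case: (i \in U').
by apply: pcolorableU => //; exact: pcolorable_card.
Qed.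

End Greedy.
End PartialColoring.

(** * Quadratic forms on subsets and on fractional profiles *)

(* The inequality passes from indicator vectors to the whole cube because its
   left-hand side has nonnegative diagonal coefficients: choosing each index a
   independently with probability theta a, it can only grow on average. *)
Lemma quadratic_le_cube (R : realType) (A : finType) (u : A -> A -> R) (m th : A -> R)
    (K : R) :
  (forall a b, 0 <= u a b) -> (forall a, 0 <= m a) -> (forall a, 0 <= th a <= 1) ->
  (forall Th : {set A}, \sum_(a in Th) \sum_(b in Th) m a * m b * u a b <=
     K * \sum_(a in Th) m a) ->
  \sum_a \sum_b (th a * m a) * (th b * m b) * u a b <= K * \sum_a th a * m a.
Proof.
move=> u0 m0 th01 h.
pose ind (a : A) (Th : {set A}) : R := (a \in Th)%:R.
have sumI (F : A -> R) (Th : {set A}) : \sum_(a in Th) F a = \sum_a ind a Th * F a.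
  rewrite big_mkcond; apply: eq_bigr => a _; rewrite /ind.
  by case: (a \in Th); rewrite ?mul1r ?mul0r.
have Eind a : Ex th (ind a) = th a.
  have <- : Ex th (fun Th => ([set a]%SET \subset Th)%:R) = th a by rewrite Ex_sub big_set1.
  by congr Ex; apply/funext => Th; rewrite /ind finset.sub1set.
have := @le_Ex _ _ th _ _ th01 h.
have -> : Ex th (fun Th => K * \sum_(a in Th) m a) = K * \sum_a th a * m a.
  rewrite Ex_scale; congr (_ * _).
  under eq_bigr => a _ do rewrite -Eind mulrC -Ex_scale.
  rewrite -Ex_sum; congr Ex; apply/funext => Th.
  by rewrite sumI; apply: eq_bigr => a _; rewrite mulrC.
apply: le_trans.
have -> : Ex th (fun Th => \sum_(a in Th) \sum_(b in Th) m a * m b * u a b) =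
    \sum_a \sum_b (m a * m b * u a b) * Ex th (fun Th => ([set a; b]%SET \subset Th)%:R).
  under [RHS]eq_bigr => a _.
    under eq_bigr => b _ do rewrite -Ex_scale.
    rewrite -Ex_sum; over.
  rewrite -Ex_sum; congr Ex; apply/funext => Th.
  rewrite sumI; apply: eq_bigr => a _; rewrite sumI mulr_sumr; apply: eq_bigr => b _.
  rewrite finset.subUset !finset.sub1set /ind.
  by case: (a \in Th); case: (b \in Th); rewrite ?mulr1 ?mul1r ?mulr0 ?mul0r.
apply: ler_sum => a _; apply: ler_sum => b _.
rewrite Ex_sub; have -> : th a * m a * (th b * m b) * u a b = m a * m b * u a b * (th a * th b) by ring.
rewrite ler_wpM2l ?mulr_ge0 //; have /andP[a0 a1] := th01 a; have /andP[b0 b1] := th01 b.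
case: (eqVneq a b) => [->|ab]; first by rewrite finset.setUid big_set1 ler_piMr.
by rewrite big_setU1 ?inE //= big_set1.
Qed.

(** A sub-profile of [s] is a fraction of [c * m] in each class, hence a point of the cube to which
    [quadratic_le_cube] applies; one factor [c] is left over and turns [K] into [c * K]. *)
Lemma admissible_quadratic (R : realType) (A : finType) (v : A -> A -> R) (m : A -> R)
    (c K K' : R) (s : A -> nat) :
  (forall a b, 0 <= v a b) -> (forall a, 0 <= m a) -> 0 <= c -> c * K <= K' ->
  (forall Th : {set A}, \sum_(a in Th) \sum_(b in Th) m a * m b * v a b <=
     K * \sum_(a in Th) m a) ->
  (forall a, (s a)%:R <= c * m a) -> admissible v K' s.
Proof.
move=> v0 m0 c0 cK h hs r rs.
have rc a : (r a)%:R <= c * m a by apply: le_trans (hs a); rewrite ler_nat.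
(* Where [c * m a] vanishes so does [r a], and the convention x / 0 = 0 gives an admissible
   fraction. *)
pose th a := (r a)%:R / (c * m a).
have thE a : (r a)%:R = c * (th a * m a).
  rewrite /th; case: (eqVneq (c * m a) 0) => [e|ne].
    have := rc a; rewrite e => r0.
    have -> : (r a)%:R = 0 :> R by apply: le_anti; rewrite r0 ler0n.
    by rewrite !mul0r mulr0.
  by rewrite mulrCA divfK.
have th01 a : 0 <= th a <= 1.
  have cm0 : 0 <= c * m a by rewrite mulr_ge0.
  rewrite /th divr_ge0 ?ler0n //=; move: cm0; rewrite le_eqVlt => /predU1P[<-|cm0].
    by rewrite invr0 mulr0 ler01.
  by rewrite ler_pdivrMr // mul1r.
have := quadratic_le_cube v0 m0 th01 h => hq.
have -> : \sum_a \sum_b (r a)%:R * (r b)%:R * v a b =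
    c * (c * \sum_a \sum_b (th a * m a) * (th b * m b) * v a b).
  rewrite !mulr_sumr; apply: eq_bigr => a _; rewrite !mulr_sumr; apply: eq_bigr => b _.
  by rewrite !thE; ring.
have -> : \sum_a (r a)%:R = c * \sum_a th a * m a.
  by rewrite mulr_sumr; apply: eq_bigr => a _.
have t0 : 0 <= \sum_a th a * m a.
  by apply: sumr_ge0 => a _; rewrite mulr_ge0 //; case/andP: (th01 a).
rewrite [leRHS]mulrCA ler_wpM2l //; apply: (@le_trans _ _ (c * (K * \sum_a th a * m a))).
  by rewrite ler_wpM2l.
by rewrite mulrA ler_wpM2r.
Qed.

(** * Step integrals and the functional phi *)

Section StepIntegral.
Context {d : measure_display} {T : measurableType d} {R : realType}.
Variable mu : probability T R.

Definition pr (S : set T) : R := fine (mu S).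

Lemma prE S : measurable S -> (pr S)%:E = mu S.
Proof. by move=> mS; rewrite fineK // fin_num_measure. Qed.

Lemma pr_ge0 S : 0 <= pr S.
Proof. exact: fine_ge0. Qed.

Lemma le_pr S S' : measurable S -> measurable S' -> S `<=` S' -> pr S <= pr S'.
Proof. by move=> mS mS' SS'; rewrite -lee_fin !prE // le_measure ?inE. Qed.

(** The integral of a nonnegative function is a supremum over the simple functions below it, which
    is monotone for arbitrary functions. It is applied to inner integrals, whose measurability in
    the outer variable is never established. *)
Lemma ge0_le_integral_nonmeasurable (S : set T) (f g : T -> \bar R) :
  (forall x, S x -> (0 <= f x)%E) -> (forall x, S x -> (f x <= g x)%E) ->
  (\int[mu]_(x in S) f x <= \int[mu]_(x in S) g x)%E.
Proof.
move=> f0 fg; have g0 x : S x -> (0 <= g x)%E by move=> Sx; exact: le_trans (f0 x Sx) (fg x Sx).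
rewrite !ge0_integralE //; apply: ge_ereal_sup => _ [h /= hf <-].
apply: ereal_sup_ubound; exists h => //= x; apply: (le_trans (hf x)).
exact: lee_restrict.
Qed.

Section Steps.
Context {I : finType}.
Variables (S : set T) (D : I -> set T) (c : I -> R).
Hypotheses (mS : measurable S) (mD : forall i, measurable (D i)).
Hypothesis c0 : forall i, 0 <= c i.

Lemma integral_step :
  (\int[mu]_(x in S) (\sum_i c i * \1_(D i) x)%:E = (\sum_i c i * pr (S `&` D i))%:E)%E.
Proof.
under eq_integral do rewrite -sumEFin.
rewrite ge0_integral_sum //; first last.
- by move=> i x _; rewrite lee_fin mulr_ge0.
- move=> i; apply/measurable_EFinP; exact: measurable_funM.
rewrite -sumEFin; apply: eq_bigr => i _; rewrite EFinM.
transitivity (\int[mu]_(x in S) ((c i)%:E * (\1_(D i) x)%:E))%E.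
  by apply: eq_integral => x _; rewrite EFinM.
rewrite ge0_integralZl_EFin //; last by apply/measurable_EFinP; exact: measurable_indic.
by rewrite integral_indic // classical_sets.setIC prE //; exact: measurableI.
Qed.

(** The upper bound asks the cells to cover [S], its counterpart asks them to be disjoint: overlaps
    raise the step function and gaps lower it. *)
Lemma integral_step_le (f : T -> \bar R) :
  (forall x, S x -> (0 <= f x)%E) -> (forall x, S x -> exists i, D i x) ->
  (forall i x, S x -> D i x -> (f x <= (c i)%:E)%E) ->
  (\int[mu]_(x in S) f x <= (\sum_i c i * pr (S `&` D i))%:E)%E.
Proof.
move=> f0 cov fc; rewrite -integral_step.
apply: ge0_le_integral_nonmeasurable => // x Sx; have [i Dx] := cov x Sx.
apply: (le_trans (fc i x Sx Dx)); rewrite lee_fin (bigD1 i) //= indicE mem_set // mulr1.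
by rewrite lerDl sumr_ge0 // => j _; rewrite mulr_ge0.
Qed.

Lemma integral_step_ge (f : T -> \bar R) :
  (forall x, S x -> (0 <= f x)%E) -> (forall i j x, D i x -> D j x -> i = j) ->
  (forall i x, S x -> D i x -> ((c i)%:E <= f x)%E) ->
  ((\sum_i c i * pr (S `&` D i))%:E <= \int[mu]_(x in S) f x)%E.
Proof.
move=> f0 dis cf; rewrite -integral_step.
apply: ge0_le_integral_nonmeasurable => x Sx.
  by rewrite lee_fin sumr_ge0 // => i _; rewrite mulr_ge0.
have [[i Dx]|nD] := pselect (exists i, D i x).
  rewrite (bigD1 i) //= indicE mem_set // mulr1 big1 ?addr0 ?cf // => j ji.
  rewrite indicE memNset ?mulr0 // => Dj; move: ji; by rewrite (dis j i x) ?eqxx.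
rewrite big1 ?f0 // => i _; rewrite indicE memNset ?mulr0 // => Di.
by apply: nD; exists i.
Qed.

End Steps.

Section DoubleSteps.
Context {I : finType}.
Variables (S : set T) (D : I -> set T) (u : I -> I -> R) (h : T -> T -> \bar R).
Hypotheses (mS : measurable S) (mD : forall i, measurable (D i)).
Hypothesis u0 : forall i j, 0 <= u i j.
Hypothesis h0 : forall x y, S x -> S y -> (0 <= h x y)%E.

Let p i := pr (S `&` D i).

Lemma double_integral_le : (forall x, S x -> exists i, D i x) ->
  (forall i j x y, S x -> S y -> D i x -> D j y -> (h x y <= (u i j)%:E)%E) ->
  (\int[mu]_(y in S) \int[mu]_(x in S) h x y <=
    (\sum_i \sum_j p i * p j * u i j)%:E)%E.
Proof.
move=> cov hu.
have -> : \sum_i \sum_j p i * p j * u i j = \sum_j (\sum_i u i j * p i) * p j.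
  rewrite exchange_big; apply: eq_bigr => j _; rewrite mulr_suml.
  by apply: eq_bigr => i _; ring.
apply: integral_step_le => // [j|y Sy|j y Sy Dy].
- by apply: sumr_ge0 => i _; rewrite mulr_ge0 ?pr_ge0.
- by apply: integral_ge0 => x Sx; exact: h0.
- apply: integral_step_le => // [x Sx|i x Sx Dx]; first exact: h0.
  exact: hu.
Qed.

Lemma double_integral_ge : (forall i j x, D i x -> D j x -> i = j) ->
  (forall i j x y, S x -> S y -> D i x -> D j y -> ((u i j)%:E <= h x y)%E) ->
  ((\sum_i \sum_j p i * p j * u i j)%:E <=
    \int[mu]_(y in S) \int[mu]_(x in S) h x y)%E.
Proof.
move=> dis uh.
have -> : \sum_i \sum_j p i * p j * u i j = \sum_j (\sum_i u i j * p i) * p j.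
  rewrite exchange_big; apply: eq_bigr => j _; rewrite mulr_suml.
  by apply: eq_bigr => i _; ring.
apply: integral_step_ge => // [j|y Sy|j y Sy Dy].
- by apply: sumr_ge0 => i _; rewrite mulr_ge0 ?pr_ge0.
- by apply: integral_ge0 => x Sx; exact: h0.
- apply: integral_step_ge => // [x Sx|i x Sx Dx]; first exact: h0.
  exact: uh.
Qed.

Lemma sum_pr_le : (forall i j x, D i x -> D j x -> i = j) -> \sum_i p i <= pr S.
Proof.
move=> dis; rewrite -lee_fin prE // -(mul1e (mu S)) -integral_cst //.
have -> : \sum_i p i = \sum_i 1 * p i by apply: eq_bigr => i _; rewrite mul1r.
by apply: integral_step_ge => // x _; rewrite lee01.
Qed.

Lemma pr_le_sum : (forall x, S x -> exists i, D i x) -> pr S <= \sum_i p i.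
Proof.
move=> cov; rewrite -lee_fin prE // -(mul1e (mu S)) -integral_cst //.
have -> : \sum_i p i = \sum_i 1 * p i by apply: eq_bigr => i _; rewrite mul1r.
by apply: integral_step_le => // x _; rewrite lee01.
Qed.

End DoubleSteps.
End StepIntegral.

Lemma measurable_I01 (R : realType) : measurable (I01 R : set (measurableTypeR R)).
Proof. exact: measurable_itv. Qed.

Definition logw (R : realType) (W : R -> R -> R) (x y : R) : R := - ln (1 - W x y).

Lemma big_unit (R : realType) (F : unit -> R) : \sum_i F i = F tt.
Proof. by rewrite (big_pred1 tt) // => -[]. Qed.

Section Phi.
Context {R : realType}.
Variables (W : R -> R -> R) (lo hi : R).
Hypothesis lo0 : 0 < lo.
Hypothesis hi1 : hi < 1.
Hypothesis W_bounds : forall x y, I01 R x -> I01 R y -> lo <= W x y <= hi.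
Implicit Types mu : probability (measurableTypeR R) R.

Lemma lne_logw x y : I01 R x -> I01 R y ->
  lne (1 / (1 - W x y)%:E)%E = (logw W x y)%:E.
Proof.
move=> xI yI; have p : 0 < 1 - W x y by have /andP[h1 h2] := W_bounds xI yI; have := hi1; lra.
rewrite div1e inver gt_eqF // lne_EFin ?invr_gt0 //.
by rewrite /logw lnV // posrE.
Qed.

Lemma logw_ge x y : I01 R x -> I01 R y -> - ln (1 - lo) <= logw W x y.
Proof.
by move=> xI yI; have /andP[h1 h2] := W_bounds xI yI; rewrite lerN2 ler_ln ?posrE; have := hi1; lra.
Qed.

Lemma logw_le x y : I01 R x -> I01 R y -> logw W x y <= - ln (1 - hi).
Proof.
by move=> xI yI; have /andP[h1 h2] := W_bounds xI yI; rewrite lerN2 ler_ln ?posrE; have := hi1; lra.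
Qed.

Lemma logw_lo_gt0 : lo < 1 -> 0 < - ln (1 - lo).
Proof. by move=> l1; rewrite oppr_gt0 ln_lt0 //; have := lo0; lra. Qed.

Lemma I01_0 : I01 R 0.
Proof. by rewrite /I01 /= in_itv /= lexx ler01. Qed.

Lemma lo_hi : lo <= hi.
Proof. by have /andP[h1 h2] := W_bounds I01_0 I01_0; lra. Qed.

Lemma logw_ge0 x y : I01 R x -> I01 R y -> 0 <= logw W x y.
Proof.
move=> xI yI; apply: le_trans (logw_ge xI yI); rewrite ltW // logw_lo_gt0 //.
have := lo_hi; have := hi1; lra.
Qed.

Definition dint mu (S : set (measurableTypeR R)) : \bar R :=
  (\int[mu]_(y in S) \int[mu]_(x in S) lne (1 / (1 - W x y)%:E))%E.

Lemma phi_le mu (K : R) :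
  (forall S : set (measurableTypeR R), measurable S -> S `<=` I01 R ->
     (dint mu S <= (K * pr mu S)%:E)%E) ->
  (phi mu W <= K%:E)%E.
Proof.
move=> h; apply: ge_ereal_sup => _ [S [mS SI S0] <-].
rewrite -(prE mu mS) in S0 *; rewrite lte_fin in S0.
by rewrite inver gt_eqF // lee_pdivrMl // muleC -EFinM; exact: h.
Qed.

Lemma phi_ge mu (S : set (measurableTypeR R)) (f : R) : phi mu W = f%:E ->
  measurable S -> S `<=` I01 R -> 0 < pr mu S -> (dint mu S <= (f * pr mu S)%:E)%E.
Proof.
move=> fE mS SI S0.
rewrite mulrC EFinM -lee_pdivrMl // -fE.
apply: ereal_sup_ubound; exists S; last by rewrite -(prE mu mS) inver gt_eqF.
by split => //; rewrite -(prE mu mS) lte_fin.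
Qed.

Lemma dint_nneg (S : set (measurableTypeR R)) : S `<=` I01 R ->
  forall x y, S x -> S y -> (0 <= lne (1 / (1 - W x y)%:E))%E.
Proof.
by move=> SI x y /SI xI /SI yI; rewrite lne_logw // lee_fin logw_ge0.
Qed.

Lemma phi_le_hi mu : on_unit mu -> (phi mu W <= (- ln (1 - hi))%:E)%E.
Proof.
move=> mu1; apply: phi_le => S mS SI.
have B0 : 0 <= - ln (1 - hi) by exact: le_trans (logw_ge0 I01_0 I01_0) (logw_le I01_0 I01_0).
have := @double_integral_le _ _ _ mu unit S (fun=> setT) (fun _ _ => - ln (1 - hi)) _
  mS (fun=> measurableT) (fun _ _ => B0) (dint_nneg SI) _ _.
move=> /(_ _ _)/le_trans; apply.
- by move=> x _; exists tt.
- by move=> _ _ x y /SI xI /SI yI _ _; rewrite lne_logw // lee_fin logw_le.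
have p1 : pr mu S <= 1.
  by rewrite -lee_fin prE // -mu1 le_measure ?inE //; exact: measurable_I01.
rewrite lee_fin !big_unit classical_sets.setIT.
rewrite mulrC ler_wpM2l // ler_piMr ?pr_ge0 //.
Qed.

Lemma phi_ge_lo mu : on_unit mu -> ((- ln (1 - lo))%:E <= phi mu W)%E.
Proof.
move=> mu1; have mI := @measurable_I01 R.
have l1 : lo < 1 by exact: le_lt_trans lo_hi hi1.
have b0 : 0 <= - ln (1 - lo) by rewrite ltW // logw_lo_gt0.
have := @double_integral_ge _ _ _ mu unit (I01 R) (fun=> setT) (fun _ _ => - ln (1 - lo)) _
  mI (fun=> measurableT) (fun _ _ => b0) (dint_nneg (@subset_refl _ _)) _ _.
rewrite !big_unit ?classical_sets.setIT.
have -> : pr mu (I01 R) = 1 by rewrite /pr mu1.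
rewrite !mul1r => /(_ _ _)/le_trans; apply.
- by case=> -[].
- by move=> _ _ x y xI yI _ _; rewrite lne_logw // lee_fin logw_ge.
apply: ereal_sup_ubound; exists (I01 R); first by split => //; rewrite mu1 lte01.
by rewrite mu1 inve1 mul1e.
Qed.

Lemma phi_fin mu : on_unit mu ->
  exists2 f : R, phi mu W = f%:E & - ln (1 - lo) <= f <= - ln (1 - hi).
Proof.
move=> mu1; have := phi_ge_lo mu1; have := phi_le_hi mu1.
case: (phi mu W) => [r| |] //=; rewrite !lee_fin => h1 h2.
by exists r => //; rewrite h1 h2.
Qed.

Lemma phi_cells_le (I : finType) mu (D : I -> set R) (u : I -> I -> R) (K : R) :
  (forall i, measurable (D i : set (measurableTypeR R))) ->
  (forall i j x, D i x -> D j x -> i = j) ->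
  (forall x, I01 R x -> exists i, D i x) -> (forall i j, 0 <= u i j) ->
  (forall i j x y, I01 R x -> I01 R y -> D i x -> D j y -> logw W x y <= u i j) ->
  (forall S : set (measurableTypeR R), measurable S -> S `<=` I01 R ->
    \sum_i \sum_j pr mu (S `&` D i) * pr mu (S `&` D j) * u i j <=
      K * \sum_i pr mu (S `&` D i)) -> 0 <= K ->
  (phi mu W <= K%:E)%E.
Proof.
move=> mD dis cov u0 wu h K0; apply: phi_le => S mS SI.
apply: (le_trans (@double_integral_le _ _ _ mu I S D u _ mS mD u0 (dint_nneg SI) _ _)).
- by move=> x /SI; exact: cov.
- by move=> i j x y /SI xI /SI yI Dx Dy; rewrite lne_logw // lee_fin; exact: wu.
rewrite lee_fin (le_trans (h S mS SI)) // ler_wpM2l //; exact: sum_pr_le.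
Qed.

(** The supremum defining [phi] is tested on the union of the cells in [Th]. *)
Lemma phi_cells_ge (I : finType) mu (D : I -> set R) (v : I -> I -> R) (f : R) :
  (forall i, measurable (D i : set (measurableTypeR R))) ->
  (forall i, D i `<=` I01 R) ->
  (forall i j x, D i x -> D j x -> i = j) -> (forall i j, 0 <= v i j) ->
  (forall i j x y, D i x -> D j y -> v i j <= logw W x y) ->
  phi mu W = f%:E -> 0 <= f ->
  forall Th : {set I}, \sum_(i in Th) \sum_(j in Th) pr mu (D i) * pr mu (D j) * v i j <=
    f * \sum_(i in Th) pr mu (D i).
Proof.
move=> mD DI dis v0 vw fE f0 Th.
pose S : set (measurableTypeR R) := \bigcup_(i in [set i | i \in Th]) D i.
have mS : measurable S by apply: fin_bigcup_measurable => //; exact: finite_finset.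
have SI : S `<=` I01 R by move=> x [i _ Dx]; exact: DI Dx.
have DS i : i \in Th -> S `&` D i = D i.
  by move=> iT; apply/setIidPr => x Dx; exists i.
have DN i : i \notin Th -> S `&` D i = set0.
  move=> iT; rewrite -subset0 => x [[j /= jT Dj] Di].
  by move: iT; rewrite (dis i j x) // jT.
have sumT (F : I -> R) : (forall i, i \notin Th -> F i = 0) -> \sum_i F i = \sum_(i in Th) F i.
  move=> F0; rewrite (bigID (fun i => i \in Th)) /= [X in _ + X]big1 ?addr0 //.
have prN i : i \notin Th -> pr mu (S `&` D i) = 0.
  by move=> /DN ->; rewrite /pr measure0.
(* [phi] tests only sets of positive measure; on a null union both sides vanish. *)
have [S0|S0] := leP (pr mu S) 0.
  have D0 i : i \in Th -> pr mu (D i) = 0.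
    move=> iT; apply: le_anti; rewrite pr_ge0 andbT (le_trans _ S0) // le_pr //.
    by move=> x Dx; exists i.
  rewrite [X in _ <= _ * X]big1 // mulr0 big1 // => i iT.
  by rewrite big1 // => j jT; rewrite D0 // !mul0r.
have hge i j x y : S x -> S y -> D i x -> D j y ->
    ((v i j)%:E <= lne (1 / (1 - W x y)%:E))%E.
  by move=> Sx Sy Dx Dy; rewrite lne_logw ?lee_fin ?vw //; exact: SI.
have := @double_integral_ge _ _ _ mu I S D v _ mS mD v0 (dint_nneg SI) dis hge.
move=> /le_trans/(_ (phi_ge fE mS SI S0)); rewrite lee_fin => h.
apply: (@le_trans _ _ (f * pr mu S)); last first.
  rewrite ler_wpM2l //; apply: (le_trans (@pr_le_sum _ _ _ mu I S D mS mD _)).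
    by move=> x [i _ Dx]; exists i.
  rewrite sumT // le_eqVlt; apply/orP; left; apply/eqP.
  by apply: eq_bigr => i iT; rewrite DS.
have e : \sum_(i in Th) \sum_(j in Th) pr mu (D i) * pr mu (D j) * v i j =
    \sum_i \sum_j pr mu (S `&` D i) * pr mu (S `&` D j) * v i j.
  rewrite [RHS]sumT; last first.
    by move=> i iT; rewrite big1 // => j _; rewrite prN // !mul0r.
  apply: eq_bigr => i iT; rewrite sumT; last by move=> j jT; rewrite (prN j) // mulr0 mul0r.
  by apply: eq_bigr => j jT; rewrite !DS.
by rewrite e.
Qed.

End Phi.

Section Families.
Context {R : realType}.
Variable W : R -> R -> R.
Implicit Types mu nu : probability (measurableTypeR R) R.

Definition same_measure mu nu : Prop :=
  forall A : set (measurableTypeR R), measurable A -> mu A = nu A.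

Lemma phi_same_measure mu nu : same_measure mu nu -> phi mu W = phi nu W.
Proof.
have sub m1 m2 : same_measure m1 m2 -> (phi m1 W <= phi m2 W)%E.
  move=> e; apply: ge_ereal_sup => _ [S [mS SI S0] <-].
  have S0' : (0 < m2 S)%E by rewrite -e.
  apply: ereal_sup_ubound; exists S => //; rewrite e //; congr (_ * _)%E.
  transitivity (dint W m1 S).
    transitivity (\int[m2]_(y in S) \int[m1]_(x in S) lne (1 / (1 - W x y)%:E))%E.
      by apply: eq_integral => y _; apply: eq_measure_integral => A mA _; exact/esym/e.
    by apply: eq_measure_integral => A mA _; exact/esym/e.
  by [].
by move=> e; apply: le_anti; rewrite !sub // => A mA; rewrite e.
Qed.

(* Measures that agree are merged, as C_lambda asks for distinct ones. *)
Lemma phi_star_le_family (J : finType) (alpha kappa : J -> R)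
    (mu : J -> probability (measurableTypeR R) R) :
  (forall j, 0 <= alpha j) -> \sum_j alpha j = 1 -> (forall j, on_unit (mu j)) ->
  (forall A : set (measurableTypeR R), measurable A ->
     (\sum_j (alpha j)%:E * mu j A)%E = lambda01 R A) ->
  (forall j, phi (mu j) W <= (kappa j)%:E)%E ->
  (phi_star W <= (\sum_j alpha j * kappa j)%:E)%E.
Proof.
move=> a0 a1 muI mul hk.
pose same i j := `[< same_measure (mu i) (mu j) >].
(* A canonical representative: [pick] depends only on the predicate, which is the same for all
   indices of one class. *)
pose rep j := odflt j [pick i | same i j].
have same_rep j : same_measure (mu (rep j)) (mu j).
  by rewrite /rep; case: pickP => [i /asboolP|] //.
have rep_same i j : same_measure (mu i) (mu j) -> rep i = rep j.
  move=> e; have sE l : same l i = same l j.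
    by apply/asboolP/asboolP => h A mA; rewrite h // e.
  rewrite /rep (eq_pick sE); case: pickP => [//|/(_ i)].
  by move=> /asboolP; case.
pose I0 := [set i | rep i == i]%SET.
have repI j : rep j \in I0 by rewrite inE; apply/eqP/rep_same/same_rep.
pose e (i : 'I_#|I0|) : J := enum_val i.
have sumE (V : nmodType) (F : J -> V) :
    \sum_j F j = \sum_(i < #|I0|) \sum_(j | rep j == e i) F j.
  rewrite (partition_big rep (fun i => i \in I0)) //=.
  by rewrite (big_enum_val (fun i => \sum_(j | rep j == i) F j)).
pose alpha' i := \sum_(j | rep j == e i) alpha j.
have sumA x : (\sum_(i < #|I0|) (alpha' i)%:E * x (e i) =
    \sum_(i < #|I0|) \sum_(j | rep j == e i) (alpha j)%:E * x (e i))%E.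
  apply: eq_bigr => i _; rewrite /alpha' -sumEFin ge0_sume_distrl // => j _.
  by rewrite lee_fin.
have cl : C_lambda (fun i => mu (e i)) alpha'.
  split => //.
  - move=> i i' /rep_same; have /= := enum_valP i; have /= := enum_valP i'.
    by rewrite !inE => /eqP h1 /eqP h2; rewrite h2 h1 => /enum_val_inj.
  - move=> i; rewrite sumr_ge0 //= -a1 [leRHS](bigID (fun j => rep j == e i)) /=.
    by rewrite lerDl sumr_ge0.
  - by rewrite -sumE.
  - move=> A mA; rewrite -mul // (sumA (fun j => mu j A)) sumE.
    apply: eq_bigr => i _; apply: eq_bigr => j /eqP <-.
    by rewrite same_rep.
apply: (@le_trans _ _ (\sum_i (alpha' i)%:E * phi (mu (e i)) W)%E).
  by apply: ereal_inf_lbound; exists #|I0|, (fun i => mu (e i)), alpha'.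
rewrite (sumA (fun j => phi (mu j) W)) -sumEFin sumE.
apply: lee_sum => i _; apply: lee_sum => j /eqP <-.
by rewrite (phi_same_measure (same_rep j)) EFinM lee_wpmul2l // lee_fin.
Qed.

Lemma mnormalize_total1 (d : measure_display) (T : measurableType d)
    (m : {measure set T -> \bar R}) (P : probability T R) (A : set T) :
  m setT = 1%E -> mnormalize m P A = m A.
Proof.
by move=> m1; rewrite /mnormalize m1 onee_eq0 /= invr1 mule1.
Qed.

(** A weighted sum of restrictions of [lambda01]. Its mass is already 1, and [mnormalize] merely
    gives it the type of a probability. *)
Lemma step_probability (I : finType) (D : I -> set R) (c : I -> R) :
  (forall i, measurable (D i : set (measurableTypeR R))) -> (forall i, 0 <= c i) ->
  \sum_i c i * pr (lambda01 R) (D i) = 1 ->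
  exists nu : probability (measurableTypeR R) R,
    forall A : set (measurableTypeR R), measurable A ->
      pr nu A = \sum_i c i * pr (lambda01 R) (A `&` D i).
Proof.
move=> mD c0 c1.
have [i0 _|I0] := pickP I; last first.
  by move: c1; rewrite big_pred0 // => /esym/eqP; rewrite oner_eq0.
pose f (k : nat) := nth i0 (enum I) k.
pose m (k : nat) := mscale (NngNum (c0 (f k))) (mrestr (lambda01 R) (mD (f k))).
pose ms := msum (fun k => m k) #|I|.
have msE A : measurable A -> ms A = (\sum_i c i * pr (lambda01 R) (A `&` D i))%:E.
  move=> mA; rewrite /ms /= /msum -sumEFin.
  rewrite -[RHS]big_enum /= (big_nth i0) big_mkord -cardE.
  apply: eq_bigr => k _; rewrite /m /= /mscale /= /mrestr EFinM prE //.
  exact: measurableI.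
have ms1 : ms setT = 1%E.
  rewrite msE //; congr (_%:E); rewrite -c1; apply: eq_bigr => i _.
  by rewrite classical_sets.setTI.
exists (mnormalize ms (lambda01 R)) => A mA.
exact: (congr1 fine (etrans (@mnormalize_total1 _ _ ms (lambda01 R) A ms1) (msE A mA))).
Qed.

Lemma on_unit_lambda01 : on_unit (lambda01 R).
Proof.
rewrite /on_unit /lambda01 /= /uniform_prob.
by rewrite integral_uniform_pdf1 ?ltr01.
Qed.

End Families.

Section StepFamilies.
Context {R : realType}.
Variables (W : R -> R -> R) (lo hi : R).
Hypothesis lo0 : 0 < lo.
Hypothesis hi1 : hi < 1.
Hypothesis W_bounds : forall x y, I01 R x -> I01 R y -> lo <= W x y <= hi.

Let lam : probability (measurableTypeR R) R := lambda01 R.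

Lemma pr_on_unit (mu : probability (measurableTypeR R) R) (A : set (measurableTypeR R)) :
  on_unit mu -> measurable A -> pr mu (A `&` I01 R) = pr mu A.
Proof.
move=> mu1 mA; have mI := @measurable_I01 R.
have h : mu A = (mu (A `\` I01 R) + mu (A `&` I01 R))%E by exact: measureDI.
have h0 : mu (A `\` I01 R) = 0%E.
  apply/eqP; rewrite -measure_le0; apply: (@le_trans _ _ (mu (~` I01 R))).
    apply: le_measure; rewrite ?inE; [exact: measurableD|exact: measurableC|].
    by move=> x [].
  by rewrite probability_setC // mu1 subee.
by rewrite /pr h h0 add0e.
Qed.

Section Steps.
Context {I J : finType}.
Variables (D : I -> set R) (u : I -> I -> R) (m : J -> I -> R) (kappa : J -> R).
Hypothesis mD : forall i, measurable (D i : set (measurableTypeR R)).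
Hypothesis disD : forall i j x, D i x -> D j x -> i = j.
Hypothesis covD : forall x, exists i, D i x.
Hypothesis u0 : forall i j, 0 <= u i j.
Hypothesis wu : forall i j x y, I01 R x -> I01 R y -> D i x -> D j y -> logw W x y <= u i j.
Hypothesis m0 : forall j i, 0 <= m j i.
Hypothesis m1 : forall i, \sum_j m j i = 1.
Hypothesis kappa0 : forall j, 0 <= kappa j.

Let len i := pr lam (D i).
Hypothesis mkappa : forall j (Th : {set I}),
  \sum_(a in Th) \sum_(b in Th) (m j a * len a) * (m j b * len b) * u a b <=
    kappa j * \sum_(a in Th) m j a * len a.

Let alpha j := \sum_i m j i * len i.

Lemma sum_pr_cells (A : set (measurableTypeR R)) : measurable A ->
  \sum_i pr lam (A `&` D i) = pr lam A.
Proof.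
move=> mA; apply: le_anti; rewrite sum_pr_le // pr_le_sum // => x _; exact: covD.
Qed.

(** [nu] is the part of [lambda01] with density [m j i] on [D i], divided by its mass [alpha j]. A
    measurable [S] fills a fraction of each cell, so [quadratic_le_cube] carries the hypothesis from
    unions of cells over to all [S]. *)
Lemma step_measure (j : J) : exists nu : probability (measurableTypeR R) R,
  [/\ on_unit nu,
      forall A : set (measurableTypeR R), measurable A ->
        alpha j * pr nu A = \sum_i m j i * pr lam (A `&` D i) &
      exists2 k, (phi nu W <= k%:E)%E & alpha j * k <= kappa j].
Proof.
have len0 i : 0 <= len i by exact: pr_ge0.
have al0 : 0 <= alpha j by apply: sumr_ge0 => i _; rewrite mulr_ge0.
have [al_eq0|al_neq0] := eqVneq (alpha j) 0.
  (* For a part of mass zero, [lam] is a default value that is only ever multiplied by 0. *)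
  exists lam; split.
  - exact: on_unit_lambda01.
  - move=> A mA; rewrite al_eq0 mul0r; apply/esym/eqP; rewrite psumr_eq0; last first.
      by move=> i _; rewrite mulr_ge0 ?pr_ge0.
    apply/allP => i _; apply/implyP => _.
    have : m j i * len i = 0.
      by move/eqP: al_eq0; rewrite psumr_eq0 => [/allP/(_ i)/(_ (mem_index_enum _))/eqP//|k _];
        rewrite mulr_ge0.
    move=> h; rewrite eq_le mulr_ge0 ?pr_ge0 // andbT -h ler_wpM2l // le_pr //.
    exact: measurableI.
  - exists (- ln (1 - hi)); first exact: (phi_le_hi lo0 hi1 W_bounds on_unit_lambda01).
    by rewrite al_eq0 mul0r.
have al_gt0 : 0 < alpha j by rewrite lt_neqAle eq_sym al_neq0.
have c0 i : 0 <= m j i / alpha j by rewrite divr_ge0.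
have c1 : \sum_i (m j i / alpha j) * pr lam (D i) = 1.
  transitivity (alpha j / alpha j); last by rewrite divff.
  by rewrite /alpha mulr_suml; apply: eq_bigr => i _; rewrite mulrAC.
have [nu nuE] := step_probability mD c0 c1.
have nuI : on_unit nu.
  rewrite /on_unit -prE; last exact: measurable_I01.
  rewrite nuE; last exact: measurable_I01.
  congr (_%:E); rewrite -c1; apply: eq_bigr => i _.
  by rewrite classical_sets.setIC pr_on_unit //; exact: on_unit_lambda01.
exists nu; split => //.
  move=> A mA; rewrite nuE // mulr_sumr; apply: eq_bigr => i _.
  by rewrite mulrA [alpha j * _]mulrC divfK.
exists (kappa j / alpha j); last by rewrite mulrC divfK.
apply: (phi_cells_le lo0 hi1 W_bounds mD disD _ u0 wu) => [x _|S mS SI|]; first exact: covD.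
  pose th i := pr lam (S `&` D i) / len i.
  have prS i : pr lam (S `&` D i) <= len i.
    by apply: le_pr => //; exact: measurableI.
  have thE i : pr lam (S `&` D i) = th i * len i.
    rewrite /th; case: (eqVneq (len i) 0) => [l0|l0]; last by rewrite divfK.
    by rewrite l0 mulr0; apply: le_anti; rewrite pr_ge0 andbT -l0.
  have th01 i : 0 <= th i <= 1.
    rewrite /th divr_ge0 ?pr_ge0 //=; have := len0 i; rewrite le_eqVlt => /predU1P[<-|l0].
      by rewrite invr0 mulr0 ler01.
    by rewrite ler_pdivrMr // mul1r.
  have nuS i : pr nu (S `&` D i) = th i * (m j i * len i / alpha j).
    rewrite nuE; last exact: measurableI.
    rewrite (bigD1 i) //= big1 ?addr0 => [|k ki]; last first.
      have -> : S `&` D i `&` D k = set0.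
        by rewrite -subset0 => x [[_ Di] Dk]; move: ki; rewrite (disD Dk Di) eqxx.
      by rewrite /pr measure0 mulr0.
    rewrite -classical_sets.setIA classical_sets.setIid thE; ring.
  under eq_bigr => i _ do under eq_bigr => k _ do rewrite !nuS.
  under [X in _ <= _ * X]eq_bigr => i _ do rewrite nuS.
  apply: quadratic_le_cube => // [i|Th].
    by rewrite divr_ge0 ?mulr_ge0.
  have -> : \sum_(a in Th) m j a * len a / alpha j = (\sum_(a in Th) m j a * len a) / alpha j.
    by rewrite mulr_suml.
  have -> : kappa j / alpha j * ((\sum_(a in Th) m j a * len a) / alpha j) =
    (kappa j * \sum_(a in Th) m j a * len a) / alpha j ^+ 2 by field.
  rewrite ler_pdivlMr ?exprn_gt0 //; apply: le_trans (mkappa j Th).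
  rewrite le_eqVlt; apply/orP; left; apply/eqP.
  rewrite mulr_suml; apply: eq_bigr => a _; rewrite mulr_suml; apply: eq_bigr => b _.
  by field.
by rewrite divr_ge0.
Qed.

(** The densities add up to 1 on every cell, so the normalised parts with weights [alpha j]
    decompose [lambda01]. The weight cancels the normalisation inside [phi], leaving [kappa j]. *)
Lemma phi_star_le_steps : (phi_star W <= (\sum_j kappa j)%:E)%E.
Proof.
have [nu hnu] := choice step_measure.
have [k hk] := choice (fun j => let: And3 _ _ h := hnu j in
  match h with ex_intro2 x a b => ex_intro _ x (conj a b) end).
have len0 i : 0 <= len i by exact: pr_ge0.
apply: (@le_trans _ _ (\sum_j alpha j * k j)%:E); last first.
  by rewrite lee_fin; apply: ler_sum => j _; case: (hk j).
apply: (@phi_star_le_family _ W J alpha k nu) => [j|||A mA|j].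
- by apply: sumr_ge0 => i _; rewrite mulr_ge0.
- rewrite /alpha exchange_big /=; under eq_bigr do rewrite -mulr_suml m1 mul1r.
  transitivity (pr lam setT); last by rewrite /pr probability_setT.
  rewrite -(sum_pr_cells measurableT); apply: eq_bigr => i _.
  by rewrite classical_sets.setTI.
- by move=> j; case: (hnu j).
- rewrite -(prE (lambda01 R) mA) -sum_pr_cells //.
  transitivity (\sum_j (\sum_i m j i * pr lam (A `&` D i))%:E)%E.
    apply: eq_bigr => j _; have [_ h _] := hnu j.
    by rewrite -h // EFinM prE.
  rewrite sumEFin exchange_big /=; congr (_%:E); apply: eq_bigr => i _.
  by rewrite -mulr_suml m1 mul1r.
- by case: (hk j).
Qed.

End Steps.
End StepFamilies.

(** * Slots and the lower bound *)

Lemma sum_option (V : nmodType) (A : finType) (F : option A -> V) :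
  \sum_a F a = F None + \sum_a F (Some a).
Proof.
rewrite (bigD1 None) //=; congr (_ + _).
rewrite (reindex_omap (Some : A -> option A) id) //= => [|[a|] //].
by apply: eq_bigl => a; rewrite eqxx.
Qed.

(* D a and D' a are neighbouring intervals of the same block separated by the
   point z a, so that monotonicity compares W on D a x D b, at (z a, z b), and
   on D' a x D' b.  Working with the two families instead of a partition into
   steps absorbs the oscillation of W. *)
Record slots (R : realType) (W : R -> R -> R) (A : finType) (D D' : A -> set R)
    (z : A -> R) (len : A -> R) (kap : R) : Prop := Slots {
  slots_meas : forall a, measurable (D a : set (measurableTypeR R));
  slots_meas' : forall a, measurable (D' a : set (measurableTypeR R));
  slots_sub : forall a, D a `<=` I01 R;
  slots_sub' : forall a, D' a `<=` I01 R;
  slots_z : forall a, I01 R (z a);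
  slots_dis : forall a b x, D a x -> D b x -> a = b;
  slots_dis' : forall a b x, D' a x -> D' b x -> a = b;
  slots_len : forall a, pr (lambda01 R) (D a) = len a;
  slots_len' : forall a, pr (lambda01 R) (D' a) = len a;
  slots_pos : forall a, 0 < len a;
  slots_sum : 1 - kap <= \sum_a len a;
  slots_le : forall a b x y, D a x -> D b y -> W x y <= W (z a) (z b);
  slots_ge : forall a b x y, D' a x -> D' b y -> W (z a) (z b) <= W x y }.

Section Lower.
Context {R : realType}.
Variables (W : R -> R -> R) (lo hi : R).
Hypothesis lo0 : 0 < lo.
Hypothesis hi1 : hi < 1.
Hypothesis W_bounds : forall x y, I01 R x -> I01 R y -> lo <= W x y <= hi.
Hypothesis W_sym : forall x y, I01 R x -> I01 R y -> W x y = W y x.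
Context {A : finType}.
Variables (D D' : A -> set R) (z : A -> R) (len : A -> R) (kap : R).
Hypothesis hs : slots W D D' z len kap.

Let B := - ln (1 - hi).

(** [c] is the weight of pairs with a vertex outside all slots: 0 when a lower estimate of - ln (1 -
    W) is wanted, its bound [B] when an upper one is. *)
Definition slot_weight (c : R) (a b : option A) : R :=
  if a is Some a then if b is Some b then logw W (z a) (z b) else c else c.

Definition cells (E : A -> set R) (a : option A) : set R :=
  if a is Some a then E a else ~` (\bigcup_(i in setT) E i).

Lemma cells_measurable (E : A -> set R) :
  (forall a, measurable (E a : set (measurableTypeR R))) ->
  forall a, measurable (cells E a : set (measurableTypeR R)).
Proof.
move=> mE [a|] /=; first exact: mE.
by apply: measurableC; apply: fin_bigcup_measurable => // a _; exact: mE.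
Qed.

Lemma cells_disjoint (E : A -> set R) :
  (forall a b x, E a x -> E b x -> a = b) ->
  forall a b x, cells E a x -> cells E b x -> a = b.
Proof.
move=> dis [a|] [b|] x //= h1 h2; first by rewrite (dis _ _ _ h1 h2).
- by exfalso; apply: h2; exists a.
- by exfalso; apply: h1; exists b.
Qed.

Lemma cells_cover (E : A -> set R) x : exists a, cells E a x.
Proof.
have [[a Ea]|nE] := pselect (exists a, E a x); first by exists (Some a).
by exists None => /= -[a _ Ea]; apply: nE; exists a.
Qed.

Lemma slot_weight_le c a b : 0 <= c -> c <= B -> 0 <= slot_weight c a b <= B.
Proof.
move=> c0 cB; case: a b => [a|] [b|] /=; rewrite ?c0 ?cB //.
have za := slots_z hs a; have zb := slots_z hs b.
by rewrite (logw_ge0 lo0 hi1 W_bounds) // (logw_le hi1 W_bounds).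
Qed.

Lemma slot_weight_sym c a b : slot_weight c a b = slot_weight c b a.
Proof.
by case: a b => [a|] [b|] //=; rewrite /logw W_sym //; exact: (slots_z hs).
Qed.

Lemma le_logw x y x' y' : I01 R x -> I01 R y -> I01 R x' -> I01 R y' ->
  W x y <= W x' y' -> logw W x y <= logw W x' y'.
Proof.
move=> xI yI xI' yI' h; rewrite lerN2.
have /andP[_ h2] := W_bounds xI' yI'; have h1 := hi1.
by rewrite ler_ln ?posrE; lra.
Qed.

(** Colour class [j] becomes the part of [lambda01] with density [r j a / (N * len a)] on [D a],
    where [cl] may count points of the neighbouring [D' a]. All missing density, including that
    outside the slots, forms one further part of mass at most [kap + 2 * eta], on which the crude
    bound [B] is used. In [2 * K + B], the term [2 * K] comes from [sparse] and [B] from the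
    diagonal. *)
Lemma phi_star_le_chi (n : nat) (cl : 'I_n -> option A) (eta K : R) (g : graph n) :
  (0 < n)%N -> 0 <= kap <= 1 -> 0 <= eta <= 1 / 2 -> 0 <= K ->
  (forall a, (1 - eta) * (len a * n%:R) <= #|[set i | cl i == Some a]%SET|%:R
     <= (1 + eta) * (len a * n%:R)) ->
  sparse cl (slot_weight 0) K g ->
  (phi_star W <= ((chi g)%:R * ((2 * K + B) / ((1 + eta) * n%:R)) + B * (kap + 2 * eta))%:E)%E.
Proof.
move=> n0 /andP[kap0 kap1] /andP[eta0 eta1] K0 count sp.
have B0 : 0 <= B by have /andP[] := @slot_weight_le 0 None None (lexx _) (ltac:(
  exact: le_trans (logw_ge0 lo0 hi1 W_bounds I01_0 I01_0) (logw_le hi1 W_bounds I01_0 I01_0))).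
have [c hc] : exists c : {ffun 'I_n -> 'I_(chi g)}, forall i j, adj g i j -> c i != c j.
  have : colorable g (chi g) by rewrite /chi; case: ex_minnP.
  move=> /existsP[c /forallP hc]; exists c => i j ij.
  by have /forallP/(_ j)/implyP := hc i; apply.
(* The factor [1 + eta] dominates all counts, so that the leftover density is nonnegative. *)
pose N : R := (1 + eta) * n%:R.
have n0' : 0 < n%:R :> R by rewrite ltr0n.
have N0 : 0 < N by rewrite mulr_gt0 //; lra.
pose r (j : 'I_(chi g)) (a : option A) : R :=
  if a is Some _ then #|[set i | (c i == j) && (cl i == a)]%SET|%:R else 0.
pose cnt (a : A) : R := #|[set i | cl i == Some a]%SET|%:R.
have sum_r a : \sum_j r j (Some a) = cnt a.
  rewrite /cnt -sum1_card (partition_big c predT) //= natr_sum; apply: eq_bigr => j _.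
  rewrite /r -sum1_card; congr (_%:R); apply: eq_bigl => i.
  by rewrite !inE andbC.
pose ln_ (a : option A) : R := pr (lambda01 R) (cells D a).
pose m (j : option 'I_(chi g)) (a : option A) : R :=
  match j, a with
  | Some j, Some b => r j (Some b) / (N * len b)
  | Some j, None => 0
  | None, Some b => 1 - cnt b / (N * len b)
  | None, None => 1
  end.
have lnS a : ln_ (Some a) = len a by exact: (slots_len hs).
have len0 a : 0 < len a by exact: (slots_pos hs).
have NL a : 0 < N * len a by exact: mulr_gt0.
have mS j a : m (Some j) a * ln_ a = r j a / N.
  case: a => [a|] /=; last by rewrite !mul0r.
  rewrite lnS; field; rewrite !lt0r_neq0 //.
have m0 j a : 0 <= m j a.
  case: j a => [j|] [a|] //=; first by rewrite divr_ge0 // ltW.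
  rewrite subr_ge0 ler_pdivrMr ?NL // mul1r /N.
  by have /andP[_] := count a; rewrite /cnt -mulrA [n%:R * _]mulrC.
have m1 a : \sum_j m j a = 1.
  rewrite sum_option; case: a => [a|] /=; last by rewrite big1 ?addr0.
  by rewrite -mulr_suml sum_r subrK.
pose u := slot_weight B.
have u01 a b : 0 <= u a b <= B by exact: slot_weight_le.
pose kappa (j : option 'I_(chi g)) : R := if j is Some _ then (2 * K + B) / N else B * (kap + 2 * eta).
have sumln : ln_ None + \sum_a len a = 1.
  have := @sum_pr_cells R (option A) (cells D) (cells_measurable (slots_meas hs))
    (cells_disjoint (slots_dis hs)) (cells_cover D) setT measurableT.
  rewrite sum_option classical_sets.setTI /pr probability_setT /= => <-.
  by congr (_ + _); apply: eq_bigr => a _; rewrite classical_sets.setTI -lnS.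
have -> : (chi g)%:R * ((2 * K + B) / ((1 + eta) * n%:R)) + B * (kap + 2 * eta) =
    \sum_j kappa j.
  by rewrite sum_option /= sumr_const card_ord [LHS]addrC -[X in _ = _ + X]mulr_natl.
apply: (@phi_star_le_steps R W lo hi lo0 hi1 W_bounds (option A) (option 'I_(chi g))
  (cells D) u m kappa (cells_measurable (slots_meas hs)) (cells_disjoint (slots_dis hs))
  (cells_cover D)) => //.
- by move=> a b; case/andP: (u01 a b).
- move=> [a|] [b|] x y xI yI Dx Dy //=; try exact: (logw_le hi1 W_bounds).
  by apply: le_logw => //; [exact: (slots_z hs)|exact: (slots_z hs)|exact: (slots_le hs) Dx Dy].
- case=> [j|] /=; first by rewrite divr_ge0 ?(ltW N0) //; lra.
  by rewrite mulr_ge0 //; lra.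
move=> [j|] Th; last first.
  have Mtot : \sum_a m None a * ln_ a <= kap + 2 * eta.
    rewrite sum_option /= mul1r.
    have -> : \sum_a (1 - cnt a / (N * len a)) * ln_ (Some a) =
        \sum_a len a - (\sum_a cnt a) / N.
      rewrite mulr_suml -sumrB; apply: eq_bigr => a _; rewrite lnS.
      field; rewrite !lt0r_neq0 //.
    have hcnt : (1 - eta) * n%:R * \sum_a len a <= \sum_a cnt a.
      rewrite mulr_sumr; apply: ler_sum => a _.
      by have /andP[+ _] := count a; rewrite -mulrA [n%:R * _]mulrC.
    have hS := slots_sum hs; set s := \sum_a len a in hcnt hS sumln *.
    have s1 : s <= 1 by have : 0 <= ln_ None by [exact: pr_ge0]; lra.
    have hq : (1 - 2 * eta) * s <= (\sum_a cnt a) / N.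
      rewrite ler_pdivlMr //; apply: le_trans hcnt; rewrite /N.
      have -> : (1 - eta) * n%:R * s = (1 - eta) * (n%:R * s) by ring.
      have -> : (1 - 2 * eta) * s * ((1 + eta) * n%:R) =
        (1 - eta - 2 * eta ^+ 2) * (n%:R * s) by ring.
      rewrite ler_wpM2r //; first by rewrite mulr_ge0 //; lra.
      have : 0 <= eta ^+ 2 by exact: sqr_ge0.
      lra.
    have : (1 - 2 * eta) * (1 - kap) <= (1 - 2 * eta) * s by rewrite ler_wpM2l //; lra.
    have : 0 <= eta * kap by exact: mulr_ge0.
    lra.
  have M0 a : 0 <= m None a * ln_ a by rewrite mulr_ge0 // pr_ge0.
  rewrite /kappa -/(\sum_(a in Th) m None a * ln_ a).
  apply: (@le_trans _ _ (B * (\sum_(a in Th) m None a * ln_ a) * (\sum_(a in Th) m None a * ln_ a))).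
    rewrite -mulrA [X in _ <= _ * X]mulr_suml mulr_sumr; apply: ler_sum => a _.
    rewrite mulr_sumr mulr_sumr; apply: ler_sum => b _.
    rewrite mulrC ler_wpM2r ?mulr_ge0 ?pr_ge0 //.
    by case/andP: (u01 a b).
  rewrite ler_wpM2r ?sumr_ge0 // ler_wpM2l //; apply: le_trans Mtot.
  rewrite [leRHS](bigID (fun a => a \in Th)) /= lerDl.
  by apply: sumr_ge0 => a _; exact: M0.
rewrite -/ln_; under eq_bigr => a _ do under eq_bigr => b _ do rewrite !mS.
under [X in _ <= _ * X]eq_bigr => a _ do rewrite mS.
(* The vertices of colour [j] in the slots of [Th]: being independent, they obey the bound given by
   [sparse]. *)
pose S := [set i | [&& c i == j, cl i != None & cl i \in Th]]%SET.
have sumS (G : option A -> R) : \sum_(i in S) G (cl i) = \sum_(a in Th) r j a * G a.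
  rewrite (partition_big cl (fun a => a \in Th)) /=; last by move=> i; rewrite inE => /and3P[].
  apply: eq_bigr => -[a|] aT /=; last first.
    rewrite mul0r big_pred0 // => i; rewrite inE.
    by case: (cl i) => [b|]; rewrite ?eqxx /= ?andbF.
  rewrite (eq_bigr (fun=> G (Some a))) => [|i /andP[_ /eqP -> //]].
  rewrite sumr_const -[LHS]mulr_natl; congr (_%:R * _).
  apply: eq_card => i; rewrite [RHS]inE /= unfold_in /= inE.
  by case: (eqVneq (cl i) (Some a)) => [->|_]; rewrite ?andbF ?andbT //= aT andbT.
have indS : pairs S \subset nonedges g.
  apply/independentP => i i'; rewrite !inE => /and3P[/eqP ci _ _] /and3P[/eqP ci' _ _].
  by apply/negP => /hc; rewrite ci ci' eqxx.
have := sp => /forallP/(_ S)/implyP/(_ indS).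
have v0sym a b : slot_weight 0 a b = slot_weight 0 b a by exact: slot_weight_sym.
rewrite (sum_pairs (F := fun i j => slot_weight 0 (cl i) (cl j))) => [|i i']; last exact: v0sym.
have diag : \sum_(i in S) slot_weight 0 (cl i) (cl i) <= B * #|S|%:R.
  rewrite mulr_natr -sumr_const; apply: ler_sum => i _.
  by have /andP[] := slot_weight_le (cl i) (cl i) (lexx 0) B0.
have dbl : \sum_(i in S) \sum_(i' in S) slot_weight 0 (cl i) (cl i') =
    \sum_(a in Th) \sum_(b in Th) r j a * r j b * u a b.
  rewrite (sumS (fun a => \sum_(i' in S) slot_weight 0 a (cl i'))); apply: eq_bigr => a _.
  rewrite (sumS (fun b => slot_weight 0 a b)) mulr_sumr; apply: eq_bigr => b _.
  by case: a b => [a|] [b|] /=; rewrite /u /=; ring.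
have cardS : #|S|%:R = \sum_(a in Th) r j a.
  have := sumS (fun=> 1); rewrite sumr_const => ->.
  by apply: eq_bigr => a _; rewrite mulr1.
rewrite dbl cardS => h; rewrite cardS in diag.
have -> : \sum_(a in Th) \sum_(b in Th) r j a / N * (r j b / N) * u a b =
    (\sum_(a in Th) \sum_(b in Th) r j a * r j b * u a b) / N ^+ 2.
  rewrite mulr_suml; apply: eq_bigr => a _; rewrite mulr_suml; apply: eq_bigr => b _.
  by field; rewrite lt0r_neq0.
rewrite /= -mulr_suml.
have -> : (2 * K + B) / N * ((\sum_(a in Th) r j a) / N) =
  ((2 * K + B) * \sum_(a in Th) r j a) / N ^+ 2 by field; rewrite lt0r_neq0.
rewrite ler_wpM2r ?invr_ge0 ?exprn_ge0 ?(ltW N0) //.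
lra.
Qed.

End Lower.

Section SlotsExist.
Context {R : realType}.

Lemma lambda01_sub (A : set R) : measurable (A : set (measurableTypeR R)) -> A `<=` I01 R ->
  lambda01 R A = @lebesgue_measure R A.
Proof.
move=> mA AI; rewrite /lambda01 /= /uniform_prob.
rewrite (eq_integral (fun=> 1%E)) => [|x]; first by rewrite integral_cst // mul1e.
rewrite inE => /AI; rewrite /I01 /= in_itv /= /uniform_pdf => ->.
by rewrite subr0 invr1.
Qed.

Lemma pr_itv (a b : bool) (s t : R) : 0 <= s -> s <= t -> t <= 1 ->
  pr (lambda01 R) [set` Interval (BSide a s) (BSide b t)] = t - s.
Proof.
move=> s0 st t1; rewrite /pr lambda01_sub; last first.
- move=> x; rewrite /I01 /= !in_itv /=; move=> /andP[/lteifW sx /lteifW xt].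
  by rewrite (le_trans s0 sx) (le_trans xt t1).
- exact: measurable_itv.
rewrite lebesgue_measure_itv /= lte_fin; move: st; rewrite le_eqVlt => /predU1P[->|st].
  by rewrite ltxx subrr.
by rewrite st.
Qed.

(* The slots of a nondegenerate block with endpoints c < d: cut ]c, d[ into
   N + 2 equal pieces and let D, z, D' be the pieces and cut points j, j + 1, j + 1. *)
Lemma slots_exist (W : R -> R -> R) (kap : R) : block_increasing W -> 0 < kap ->
  exists (A : finType) (D D' : A -> set R) (z len : A -> R), slots W D D' z len kap.
Proof.
move=> [k [J [trivJ covJ inc1 inc2]]] kap0.
have JI i : [set` J i] `<=` I01 R by rewrite -covJ => x Jx; exists i.
pose c i := inf [set` J i]; pose d i := sup [set` J i].
have lbJ i : has_lbound [set` J i].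
  by exists 0 => x /JI; rewrite /I01 /= in_itv /= => /andP[].
have ubJ i : has_ubound [set` J i].
  by exists 1 => x /JI; rewrite /I01 /= in_itv /= => /andP[].
have Jcd i x : [set` J i] x -> c i <= x <= d i.
  by move=> Jx; rewrite (ge_inf (lbJ i) Jx) (ub_le_sup (ubJ i) Jx).
have cdJ i x : c i < x < d i -> x \in J i.
  move=> /andP[cx xd]; have [J0|J0] := pselect ([set` J i] !=set0).
    have [y Jy yx] := inf_lt J0 cx; have [y' Jy' xy'] := sup_gt J0 xd.
    by apply: (@interval_is_interval R (J i) y y' Jy Jy'); rewrite (ltW yx) (ltW xy').
  have J00 : [set` J i] = set0.
    by rewrite -subset0 => y Jy; apply: J0; exists y.
  (* The infimum and supremum of the empty set are 0 by convention, so an empty block has c = d and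
     no point strictly between. *)
  by move: cx xd; rewrite /c /d J00 inf0 sup0 => /lt_trans h /h; rewrite ltxx.
have cd01 i : 0 <= c i /\ d i <= 1.
  have [[y Jy]|J0] := pselect ([set` J i] !=set0).
    split; last by apply: ge_sup; [exists y|move=> x /JI; rewrite /I01 /= in_itv /= => /andP[]].
    by apply: lb_le_inf; [exists y|move=> x /JI; rewrite /I01 /= in_itv /= => /andP[]].
  have J00 : [set` J i] = set0.
    by rewrite -subset0 => y Jy; apply: J0; exists y.
  by rewrite /c /d J00 inf0 sup0 lexx ler01.
(* Each of the two families leaves out two of the [N + 2] pieces of a block: [D] the two extreme
   ones, [D'] the first two. The lost proportion 2 / (N + 2) has to be at most [kap]. *)
pose N := (Num.truncn (2 / kap)).+1.
have hN : 2 / (N.+2)%:R <= kap.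
  rewrite ler_pdivrMr // mulrC -ler_pdivrMr // ltW //.
  by apply: (lt_le_trans (truncnS_gt _)); rewrite ler_nat /N ltnW.
pose P (p : 'I_k * 'I_N) := c p.1 < d p.1.
pose A : finType := {p : 'I_k * 'I_N | P p}.
pose del i := (d i - c i) / (N.+2)%:R.
pose t i (j : nat) := c i + del i * (j.+1)%:R.
pose D (a : A) : set R := [set` `]t (val a).1 (val a).2, t (val a).1 (val a).2.+1[].
pose D' (a : A) : set R := [set` `]t (val a).1 (val a).2.+1, t (val a).1 (val a).2.+2[].
pose z (a : A) := t (val a).1 (val a).2.+1.
pose len (a : A) := del (val a).1.
have len0 a : 0 < len a.
  by rewrite divr_gt0 // subr_gt0; exact: (valP a).
have tmono i (j j' : nat) : 0 < del i -> (t i j < t i j') = (j < j')%N.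
  by move=> d0; rewrite /t ltrD2l ltr_pM2l // ltr_nat ltnS.
have tmonoe i (j j' : nat) : 0 < del i -> (t i j <= t i j') = (j <= j')%N.
  by move=> d0; rewrite /t lerD2l ler_pM2l // ler_nat ltnS.
have ct i (j : nat) : 0 < del i -> c i < t i j.
  by move=> d0; rewrite /t ltrDl mulr_gt0.
have td i (j : nat) : 0 < del i -> (j.+1 <= N.+2)%N -> t i j <= d i.
  move=> d0 jN; apply: (@le_trans _ _ (t i N.+1)); first by rewrite tmonoe.
  by rewrite /t /del divfK // addrC subrK.
have tdlt i (j : nat) : 0 < del i -> (j.+1 < N.+2)%N -> t i j < d i.
  move=> d0 jN; apply: (@lt_le_trans _ _ (t i N.+1)); first by rewrite tmono.
  exact: td.
have ltN (a : A) : ((val a).2 < N)%N by [].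
have DJ a x : D a x -> x \in J (val a).1.
  rewrite /D /= in_itv /= => /andP[h1 h2]; apply: cdJ; apply/andP; split.
    exact: lt_trans (ct _ _ (len0 a)) h1.
  apply: lt_le_trans h2 _; apply: td (len0 a) _; exact: ltnW (ltN a).
have DJ' a x : D' a x -> x \in J (val a).1.
  rewrite /D' /= in_itv /= => /andP[h1 h2]; apply: cdJ; apply/andP; split.
    exact: lt_trans (ct _ _ (len0 a)) h1.
  apply: lt_le_trans h2 _; apply: td (len0 a) _; exact: ltN a.
have zJ a : z a \in J (val a).1.
  apply: cdJ; apply/andP; split; first exact: ct (len0 a).
  by apply: tdlt (len0 a) _; exact: ltN a.
have inI i x : x \in J i -> I01 R x by move=> Jx; apply: (JI i).
have same (a b : A) x : x \in J (val a).1 -> x \in J (val b).1 -> (val a).1 = (val b).1.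
  by move=> xa xb; apply: (trivJ _ _ I I); exists x.
have disj (o : nat) (a b : A) x :
    x \in `]t (val a).1 ((val a).2 + o)%N, t (val a).1 ((val a).2 + o).+1[ ->
    x \in `]t (val b).1 ((val b).2 + o)%N, t (val b).1 ((val b).2 + o).+1[ ->
    (val a).1 = (val b).1 -> a = b.
  move=> + + e; rewrite !in_itv /= -e => /andP[h1 h2] /andP[h3 h4].
  have e2 : (val a).2 = (val b).2.
    apply: val_inj; apply/eqP; rewrite eqn_leq.
    move: (lt_trans h1 h4) (lt_trans h3 h2); rewrite !tmono ?(len0 a) //.
    by rewrite !ltnS !leq_add2r => -> ->.
  apply: val_inj; case: a b e e2 {h1 h2 h3 h4} => [[i j] Pa] [[i' j'] Pb] /= e e2.
  by rewrite e e2.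
have tt (a : A) (j : nat) : (j <= N.+1)%N -> 0 <= t (val a).1 j <= 1.
  move=> jN; have [c0 d1] := cd01 (val a).1.
  by rewrite (le_trans c0) ?(ltW (ct _ _ (len0 a))) // (le_trans (td _ _ (len0 a) _) d1).
have tS i j : t i j.+1 - t i j = del i by rewrite /t -[j.+2]addn1 natrD; ring.
exists A, D, D', z, len; split.
- by move=> a; exact: measurable_itv.
- by move=> a; exact: measurable_itv.
- by move=> a x /DJ; exact: inI.
- by move=> a x /DJ'; exact: inI.
- by move=> a; exact: inI (zJ a).
- move=> a b x Da Db; have e := same _ _ _ (DJ _ _ Da) (DJ _ _ Db).
  by apply: (disj 0%N a b x); rewrite ?addn0.
- move=> a b x Da Db; have e := same _ _ _ (DJ' _ _ Da) (DJ' _ _ Db).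
  by apply: (disj 1%N a b x); rewrite ?addn1.
- move=> a; rewrite /D pr_itv ?tS //.
  + by have /andP[] := tt a (val a).2 (leqW (ltnW (ltN a))).
  + by rewrite tmonoe ?(len0 a).
  + by have /andP[] := tt a (val a).2.+1 (ltnW (ltN a)).
- move=> a; rewrite /D' pr_itv ?tS //.
  + by have /andP[] := tt a (val a).2.+1 (ltnW (ltN a)).
  + by rewrite tmonoe ?(len0 a).
  + by have /andP[] := tt a (val a).2.+2 (ltN a).
- exact: len0.
- have tot : 1 <= \sum_i (d i - c i).
    have mJ i : measurable ([set` J i] : set (measurableTypeR R)) by exact: measurable_itv.
    have := @pr_le_sum _ _ _ (lambda01 R) _ (I01 R) (fun i => [set` J i])
      (@measurable_I01 R) mJ _.
    rewrite {1}/pr on_unit_lambda01 /= => /(_ _)/le_trans; apply.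
      by move=> x; rewrite -covJ => -[i _ Jx]; exists i.
    apply: ler_sum => i _.
    have [[y Jy]|J0] := pselect ([set` J i] !=set0); last first.
      have J00 : [set` J i] = set0.
        by rewrite -subset0 => y Jy; apply: J0; exists y.
      by rewrite J00 classical_sets.setI0 /pr measure0 /c /d J00 inf0 sup0 subrr.
    have [c0 d1] := cd01 i; have /andP[cy yd] := Jcd i y Jy.
    rewrite -(pr_itv true false c0 (le_trans cy yd) d1); apply: le_pr.
    + by apply: measurableI => //; exact: measurable_I01.
    + exact: measurable_itv.
    + by move=> x [_ /Jcd]; rewrite /= in_itv /=.
  have -> : \sum_a len a = \sum_(i | c i < d i) (d i - c i) * (N%:R / (N.+2)%:R).
    rewrite /len -(@big_sub_cond R 0 +%R _ P predT (fun p => del p.1)).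
    rewrite (eq_bigl (fun p : 'I_k * 'I_N => (c p.1 < d p.1) && true)) => [|p]; last first.
      by rewrite unfold_in.
    rewrite -(pair_big (fun i => c i < d i) xpredT (fun i _ => del i)) /=.
    apply: eq_bigr => i _; rewrite sumr_const card_ord -[LHS]mulr_natr /del; ring.
  rewrite -mulr_suml.
  have tot' : 1 <= \sum_(i | c i < d i) (d i - c i).
    apply: (le_trans tot); rewrite (bigID (fun i => c i < d i)) /= gerDl.
    by apply: sumr_le0 => i; rewrite -leNgt subr_le0.
  have e : N%:R / (N.+2)%:R = 1 - 2 / (N.+2)%:R :> R.
    by rewrite -[N.+2]addn2 natrD; field; rewrite -natrD pnatr_eq0 addn2.
  apply: (@le_trans _ _ (N%:R / (N.+2)%:R)); first by rewrite e lerD2l lerN2.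
  by rewrite ler_peMl // divr_ge0.
- move=> a b x y Da Db.
  have xz : x <= z a by move: Da; rewrite /D /= in_itv /= => /andP[_ /ltW].
  have yz : y <= z b by move: Db; rewrite /D /= in_itv /= => /andP[_ /ltW].
  apply: (@le_trans _ _ (W (z a) y)).
    by apply: (inc1 (val a).1 (val b).1); rewrite ?zJ ?DJ.
  by apply: (inc2 (val a).1 (val b).1); rewrite ?zJ ?DJ.
- move=> a b x y Da Db.
  have xz : z a <= x by move: Da; rewrite /D' /= in_itv /= => /andP[/ltW].
  have yz : z b <= y by move: Db; rewrite /D' /= in_itv /= => /andP[/ltW].
  apply: (@le_trans _ _ (W (z a) y)).
    by apply: (inc2 (val a).1 (val b).1); rewrite ?zJ ?DJ'.
  by apply: (inc1 (val a).1 (val b).1); rewrite ?zJ ?DJ'.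
Qed.

End SlotsExist.

(** * Concentration of the vertex positions *)

Lemma measurable_graph_event (d : measure_display) (T : measurableType d)
    (n : nat) (G : T -> graph n) (Q : pred (graph n)) :
  (forall g, measurable (G @^-1` [set g])) -> measurable [set w | Q (G w)].
Proof.
move=> mG; have -> : [set w | Q (G w)] = \bigcup_(g in [set g | Q g]) (G @^-1` [set g]).
  by apply/seteqP; split => [w Qw|w [g /= Qg Gw] /=]; [exists (G w)|rewrite Gw].
by apply: fin_bigcup_measurable => [|g _]; [exact: finite_finset|exact: mG].
Qed.

Section Glue.
Context {R : realType} {d : measure_display} {T : measurableType d}.
Variables (P : probability T R) (n : nat) (W : R -> R -> R) (G : T -> graph n).
Variable X : T -> n.-tuple (measurableTypeR R).
Hypothesis mX : measurable_fun setT X.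
Hypothesis XI : forall w i, I01 R (tnth (X w) i).
Hypothesis X_unif : forall i A, measurable A -> P [set w | A (tnth (X w) i)] = lambda01 R A.
Hypothesis X_indep : forall A : 'I_n -> set (measurableTypeR R),
  (forall i, measurable (A i)) ->
  P [set w | forall i, A i (tnth (X w) i)] = (\prod_i P [set w | A i (tnth (X w) i)])%E.
Hypothesis G_law : forall g, measurable (G @^-1` [set g]) /\
  forall B, measurable B ->
    P (G @^-1` [set g] `&` X @^-1` B) =
    (\int[P]_(w in X @^-1` B) (edge_law W (X w) g)%:E)%E.
Hypothesis hW : graphon W.

Lemma measurable_coord i : measurable_fun setT (fun w => tnth (X w) i).
Proof. exact: measurableT_comp (measurable_tnth i) mX. Qed.

Lemma measurable_edge_law g : measurable_fun setT (fun w => edge_law W (X w) g).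
Proof.
have [mW _ _] := hW; rewrite /edge_law.
under eq_fun do rewrite big_mkcond.
apply: measurable_prod => e _; case: (e.1 < e.2)%N; last exact: measurable_cst.
have mWX : measurable_fun setT
    (fun w => W (tnth (X w) e.1) (tnth (X w) e.2) : measurableTypeR R).
  apply: (@measurable_comp _ _ _ _ _ _ (I01 R `*` I01 R) _ setT
    (fun w => (tnth (X w) e.1, tnth (X w) e.2))) mW _.
  - by apply: measurableX; exact: measurable_I01.
  - by move=> _ [w _ <-]; split => /=; exact: XI.
  - by apply: measurable_fun_pair; exact: measurable_coord.
case: (adj g e.1 e.2) => //.
by apply: measurable_funB => //; exact: measurable_cst.
Qed.

(** Joint independence is used with the whole line at every index other than [i] and [j]. *)
Lemma prob_pair (E : set (measurableTypeR R)) (l : R) i j : measurable E ->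
  pr (lambda01 R) E = l -> i != j ->
  pr P [set w | E (tnth (X w) i) /\ E (tnth (X w) j)] = l ^+ 2.
Proof.
move=> mE lE ij; pose A (k : 'I_n) : set (measurableTypeR R) :=
  if (k == i) || (k == j) then E else setT.
have mA k : measurable (A k) by rewrite /A; case: ifP.
have -> : [set w | E (tnth (X w) i) /\ E (tnth (X w) j)] =
    [set w | forall k, A k (tnth (X w) k)].
  apply/seteqP; split => w /= h.
    by move=> k; rewrite /A; case: eqP => [->|_]; case: eqP => [->|_] //=; case: h.
  by split; [have := h i|have := h j]; rewrite /A eqxx ?orbT.
rewrite /pr X_indep //.
have -> : (\prod_k P [set w | A k (tnth (X w) k)])%E =
    (\prod_k (if (k == i) || (k == j) then l else 1)%:E)%E.
  apply: eq_bigr => k _; rewrite X_unif // /A; case: ifP => _.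
    by rewrite -lE prE.
  by rewrite probability_setT.
rewrite prodEFin /= -big_mkcond /= (bigD1 i) ?eqxx //= (bigD1 j) /=; last first.
  by rewrite eqxx orbT eq_sym.
by rewrite big1 ?mulr1 ?expr2 // => k /andP[/andP[/orP[]/eqP->]]; rewrite eqxx // andbF.
Qed.

Definition count_in (E : set R) (x : n.-tuple R) : R := \sum_i \1_E (tnth x i).

(* Chebyshev's inequality, the second moment being expanded into probabilities
   of the events that X_i and X_j both lie in E. *)
Lemma count_deviation (E : set (measurableTypeR R)) (l c : R) : measurable E ->
  pr (lambda01 R) E = l -> 0 < c ->
  pr P [set w | c < `|count_in E (X w) - n%:R * l|] <= n%:R / c ^+ 2.
Proof.
move=> mE lE c0.
pose Y w := count_in E (X w).
have mY : measurable_fun setT Y.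
  by apply: measurable_sum => i; apply: measurableT_comp (measurable_coord i); exact: measurable_indic.
set Bad := [set w | c < `|count_in E (X w) - n%:R * l|].
have mBad : measurable Bad.
  have -> : Bad = (fun w => `|Y w - n%:R * l|) @^-1` `]c, +oo[.
    by apply/seteqP; split => w /=; rewrite in_itv /= andbT.
  rewrite -[X in measurable X]classical_sets.setTI.
  apply: (measurableT_comp (@normr_measurable R setT)) => //.
  by apply: measurable_funB => //; exact: measurable_cst.
pose F i : set T := [set w | E (tnth (X w) i)].
have mF i : measurable (F i).
  by rewrite -[F i]classical_sets.setTI; apply: measurable_coord.
have prF i : pr P (F i) = l by rewrite /pr /F X_unif.
have YE w : Y w = \sum_i \1_(F i) w by [].
have l0 : 0 <= l by rewrite -lE pr_ge0.
(* In c^2 1_Bad <= Y^2 - 2 n l Y + (n l)^2 the negative term is moved to the left. Both sides are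
   then nonnegative step functions, Y^2 being a sum of indicators over pairs of indices, and
   [integral_step] integrates them. *)
pose D1 (a : option 'I_n) := if a is Some i then F i else Bad.
pose c1 (a : option 'I_n) : R := if a is Some i then 2 * (n%:R * l) else c ^+ 2.
pose D2 (a : option ('I_n * 'I_n)) := if a is Some p then F p.1 `&` F p.2 else setT.
pose c2 (a : option ('I_n * 'I_n)) : R := if a is Some _ then 1 else (n%:R * l) ^+ 2.
have pw w : \sum_a c1 a * \1_(D1 a) w <= \sum_a c2 a * \1_(D2 a) w.
  rewrite !sum_option /= -mulr_sumr -YE indicT mulr1.
  have -> : \sum_(p : 'I_n * 'I_n) 1 * \1_(F p.1 `&` F p.2) w = Y w ^+ 2.
    rewrite YE expr2 mulr_suml -(pair_bigA _ (fun i j => 1 * \1_(F i `&` F j) w)) /=.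
    apply: eq_bigr => i _; rewrite mulr_sumr; apply: eq_bigr => j _.
    by rewrite mul1r indicI.
  have [bw|bw] := pselect (Bad w).
    rewrite indicE mem_set // mulr1.
    have : c ^+ 2 <= (Y w - n%:R * l) ^+ 2.
      rewrite -[leRHS]real_normK ?num_real // lerXn2r ?nnegrE ?(ltW c0) //.
      exact: ltW.
    by rewrite sqrrB; lra.
  rewrite indicE memNset // mulr0 add0r.
  have : 0 <= (Y w - n%:R * l) ^+ 2 by exact: sqr_ge0.
  by rewrite sqrrB; lra.
have c10 a : 0 <= c1 a by case: a => [i|] /=; rewrite ?exprn_ge0 ?mulr_ge0 ?(ltW c0).
have c20 a : 0 <= c2 a by case: a => [i|] /=; rewrite ?exprn_ge0 ?mulr_ge0.
have mD1 a : measurable (D1 a) by case: a => [i|] /=.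
have mD2 a : measurable (D2 a) by case: a => [p|] //=; exact: measurableI.
have h : \sum_a c1 a * pr P (setT `&` D1 a) <= \sum_a c2 a * pr P (setT `&` D2 a).
  rewrite -lee_fin -!integral_step //.
  apply: ge0_le_integral_nonmeasurable => w _; rewrite lee_fin //.
  by apply: sumr_ge0 => a _; rewrite mulr_ge0.
rewrite !sum_option /= !classical_sets.setTI in h.
have prT : pr P setT = 1 by rewrite /pr probability_setT.
have s1 : \sum_a 2 * (n%:R * l) * pr P (setT `&` F a) = 2 * (n%:R * l) ^+ 2.
  under eq_bigr => a _ do rewrite classical_sets.setTI prF.
  by rewrite sumr_const card_ord -[LHS]mulr_natl; ring.
have s2 : \sum_(p : 'I_n * 'I_n) 1 * pr P (setT `&` (F p.1 `&` F p.2)) <=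
    (n%:R * l) ^+ 2 + n%:R.
  rewrite -(pair_bigA _ (fun i j => 1 * pr P (setT `&` (F i `&` F j)))) /=.
  apply: (@le_trans _ _ (\sum_(i < n) (n%:R * l ^+ 2 + 1))); last first.
    by rewrite sumr_const card_ord -[leLHS]mulr_natl le_eqVlt; apply/orP; left; apply/eqP; ring.
  apply: ler_sum => i _; rewrite (bigD1 i) //= addrC lerD //; last first.
    by rewrite mul1r -prT le_pr // classical_sets.setTI; apply: measurableI.
  apply: (@le_trans _ _ (\sum_(j < n) l ^+ 2)); last first.
    by rewrite sumr_const card_ord -[leLHS]mulr_natl.
  rewrite [leRHS](bigD1 i) //= ler_wpDl ?sqr_ge0 //; apply: ler_sum => j ji.
  rewrite mul1r classical_sets.setTI.
  by rewrite -(@prob_pair E l i j) // eq_sym.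
rewrite ler_pdivlMr ?exprn_gt0 // mulrC.
rewrite s1 prT in h; lra.
Qed.

(** Where all counts are within a factor 1 - eta to 1 + eta of their means, the conditional law
    given the positions is integrated against the bound [delta]. The complement is covered by one
    deviation event per [j], with c = eta len n in Chebyshev's bound n / c^2. *)
Lemma prob_bad (J : finType) (E : J -> set (measurableTypeR R)) (len : J -> R)
    (eta delta : R) (Bad : pred (graph n)) :
  (0 < n)%N -> (forall j, measurable (E j)) -> (forall j, pr (lambda01 R) (E j) = len j) ->
  (forall j, 0 < len j) -> 0 < eta ->
  (forall x : n.-tuple R, (forall i, I01 R (tnth x i)) ->
    (forall j, (1 - eta) * (len j * n%:R) <= count_in (E j) x <= (1 + eta) * (len j * n%:R)) ->
    \sum_(g | Bad g) edge_law W x g <= delta) ->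
  0 <= delta ->
  pr P [set w | Bad (G w)] <= delta + \sum_j 1 / ((eta * len j) ^+ 2 * n%:R).
Proof.
move=> n0 mE lE len0 eta0 hdelta delta0.
have n0' : 0 < n%:R :> R by rewrite ltr0n.
have mG (Q : pred (graph n)) : measurable [set w | Q (G w)].
  by apply: measurable_graph_event => g; case: (G_law g).
have m_count j : measurable_fun setT (fun x : n.-tuple (measurableTypeR R) => count_in (E j) x).
  apply: measurable_sum => i; apply: measurableT_comp (measurable_tnth i).
  exact: measurable_indic.
pose C : set (n.-tuple (measurableTypeR R)) :=
  \bigcap_(j in setT) [set x | (1 - eta) * (len j * n%:R) <= count_in (E j) x <=
                              (1 + eta) * (len j * n%:R)].
have mC : measurable C.
  apply: fin_bigcap_measurable => // j _.
  have -> : [set x | (1 - eta) * (len j * n%:R) <= count_in (E j) x <= (1 + eta) * (len j * n%:R)] =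
      (fun x => count_in (E j) x) @^-1` `[(1 - eta) * (len j * n%:R), (1 + eta) * (len j * n%:R)].
    by apply/seteqP; split => x /=; rewrite in_itv.
  by rewrite -[X in measurable X]classical_sets.setTI; apply: m_count.
have mXC : measurable (X @^-1` C) by rewrite -[X @^-1` C]classical_sets.setTI; exact: mX.
pose dev j : set T := [set w | eta * (len j * n%:R) < `|count_in (E j) (X w) - n%:R * len j|].
have mdev j : measurable (dev j).
  have -> : dev j = (fun w => `|count_in (E j) (X w) - n%:R * len j|) @^-1` `]eta * (len j * n%:R), +oo[.
    by apply/seteqP; split => w /=; rewrite in_itv /= andbT.
  rewrite -[X in measurable X]classical_sets.setTI.
  apply: (measurableT_comp (@normr_measurable R setT)) => //.
  apply: measurable_funB; last exact: measurable_cst.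
  exact: measurableT_comp (m_count j) mX.
have cover w : [set w | Bad (G w)] w -> exists a : option J,
    (if a is Some j then dev j else [set w | Bad (G w)] `&` X @^-1` C) w.
  move=> Bw; have [Cw|nC] := pselect (C (X w)); first by exists None.
  have [[j dj]|nd] := pselect (exists j, dev j w); first by exists (Some j).
  exfalso; apply: nC => j _ /=; have : ~ dev j w by move=> dj; apply: nd; exists j.
  by rewrite /dev /= => /negP; rewrite -leNgt ler_norml => /andP[h1 h2]; apply/andP; split; lra.
have mcov a : measurable (if a is Some j then dev j else [set w | Bad (G w)] `&` X @^-1` C).
  by case: a => [j|]; [exact: mdev|exact: measurableI].
have mBad : measurable [set w | Bad (G w)] by exact: mG.
have mBC : measurable ([set w | Bad (G w)] `&` X @^-1` C) by exact: measurableI.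
apply: (le_trans (@pr_le_sum _ _ _ P _ [set w | Bad (G w)] _ (mG Bad) mcov cover)).
rewrite sum_option; apply: lerD.
  apply: (@le_trans _ _ (pr P ([set w | Bad (G w)] `&` X @^-1` C))).
    by apply: le_pr => //; exact: measurableI.
  rewrite -lee_fin prE //.
  have el0 w g : 0 <= edge_law W (X w) g.
    by apply: edge_law_ge0 => i k; have [_ _] := hW; apply; exact: XI.
  have -> : [set w | Bad (G w)] `&` X @^-1` C =
      \bigcup_(g in [set g | Bad g]) (G @^-1` [set g] `&` X @^-1` C).
    apply/seteqP; split => [w [Bw Cw]|w [g /= Bg [Gw Cw]] /=]; first by exists (G w).
    by rewrite Gw.
  rewrite measure_fin_bigcup //; last 3 first.
  - exact: finite_finset.
  - by move=> g g' _ _ [w [[/= -> _] [/= -> _]]].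
  - by move=> g _; apply: measurableI => //; case: (G_law g).
  have fsE (F : graph n -> \bar R) : (\sum_(g \in [set g | Bad g]) F g = \sum_(g | Bad g) F g)%E.
    rewrite (@fsbigE _ _ _ _ _ [seq g <- index_enum (graph n) | Bad g]).
    - rewrite big_filter_cond; apply: eq_bigl => g.
      by apply/andP/idP => [[]//|Bg]; split => //; rewrite inE.
    - by rewrite filter_uniq // index_enum_uniq.
    - by move=> g /=; rewrite mem_filter => /andP[].
    - by move=> g /= Bg; rewrite mem_filter Bg mem_index_enum.
  rewrite fsE.
  rewrite (eq_bigr (fun g => (\int[P]_(w in X @^-1` C) (edge_law W (X w) g)%:E)%E)) => [|g _]; last first.
    by case: (G_law g) => _; apply.
  rewrite big_mkcond /= (eq_bigr (fun g => (\int[P]_(w in X @^-1` C)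
      (if Bad g then edge_law W (X w) g else 0)%:E)%E)) => [|g _]; last first.
    by case: ifP => //; rewrite integral0.
  rewrite -ge0_integral_sum //; last first.
  - by move=> g w _; rewrite lee_fin; case: ifP.
  - move=> g; case: (Bad g); last exact: measurable_cst.
    by apply/measurable_EFinP/measurable_funTS; exact: measurable_edge_law.
  apply: (@le_trans _ _ (\int[P]_(w in X @^-1` C) delta%:E)%E).
    apply: ge0_le_integral_nonmeasurable => w Cw.
      by rewrite sumEFin lee_fin sumr_ge0 // => g _; case: ifP.
    rewrite sumEFin lee_fin -big_mkcond; apply: hdelta; first exact: XI.
    by move=> j; apply: Cw.
  rewrite integral_cst // -[leRHS]mule1 lee_wpmul2l ?lee_fin //.
  exact: probability_le1.
apply: ler_sum => j _; apply: (@le_trans _ _ (pr P (dev j))).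
  by apply: le_pr => //; exact: measurableI.
have p0 : 0 < eta * (len j * n%:R) by rewrite !mulr_gt0.
apply: (le_trans (count_deviation (mE j) (lE j) p0)).
rewrite le_eqVlt; apply/orP; left; apply/eqP; field.
by rewrite !lt0r_neq0.
Qed.

End Glue.

(** * The upper bound *)

Section Upper.
Context {R : realType}.
Variables (W : R -> R -> R) (lo hi : R).
Hypothesis lo0 : 0 < lo.
Hypothesis hi1 : hi < 1.
Hypothesis W_bounds : forall x y, I01 R x -> I01 R y -> lo <= W x y <= hi.
Context {A : finType}.
Variables (D D' : A -> set R) (z : A -> R) (len : A -> R) (kap : R).
Hypothesis hs : slots W D D' z len kap.

Let B := - ln (1 - hi).
Let b0 := - ln (1 - lo).
Let v := slot_weight W z B.

Lemma b0_gt0 : 0 < b0.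
Proof. by rewrite oppr_gt0 ln_lt0 //; have := lo_hi W_bounds; have := hi1; have := lo0; lra. Qed.

Lemma b0_le_B : b0 <= B.
Proof. exact: le_trans (logw_ge hi1 W_bounds I01_0 I01_0) (logw_le hi1 W_bounds I01_0 I01_0). Qed.

Lemma B_gt0 : 0 < B.
Proof. exact: lt_le_trans b0_gt0 b0_le_B. Qed.

Lemma v_bounds a b : 0 <= v a b <= B.
Proof. by apply: (slot_weight_le lo0 hi1 W_bounds hs) => //; exact: ltW B_gt0. Qed.

(** On [D'] the weight is at least its value at the points [z], so testing [phi] on unions of the
    [D' a] bounds the quadratic form of [v]. The class [None] gets no vertex and never competes. *)
Lemma measure_profile_admissible (mu : probability (measurableTypeR R) R) (f c K : R)
    (s : option A -> nat) :
  phi mu W = f%:E -> 0 <= f -> 0 <= c -> c * f <= K ->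
  (forall a, (s (Some a))%:R <= c * pr mu (D' a)) -> s None = 0%N ->
  admissible v K s.
Proof.
move=> fE f0 c0 cf sS sN.
pose E (a : option A) : set R := if a is Some a then D' a else set0.
apply: (@admissible_quadratic R _ v (fun a => pr mu (E a)) c f K s) => //.
- by move=> a b; case/andP: (v_bounds a b).
- by move=> a; exact: pr_ge0.
- apply: (@phi_cells_ge R W lo hi lo0 hi1 W_bounds _ mu E v f) => //.
  + by case=> [a|] /=; [exact: (slots_meas' hs)|exact: measurable0].
  + by case=> [a|] //=; exact: (slots_sub' hs).
  + by case=> [a|] [b|] x //= xa xb; rewrite (slots_dis' hs xa xb).
  + by move=> a b; case/andP: (v_bounds a b).
  + move=> [a|] [b|] x y //= Dx Dy.
    apply: (le_logw hi1 W_bounds) (slots_ge hs Dx Dy);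
      [exact: (slots_z hs)|exact: (slots_z hs)|exact: (slots_sub' hs) Dx|exact: (slots_sub' hs) Dy].
- by case=> [a|] /=; rewrite ?sN ?mulr_ge0 ?pr_ge0.
Qed.

(** An affordable profile for any single class, since [v] is at most [B]. Such sets absorb rounding
    losses and the vertices outside the slots. *)
Lemma single_profile_admissible (t : nat) (K : R) (b : option A) :
  t%:R * B <= K -> admissible v K (fun a => if a == b then t else 0%N).
Proof.
move=> tK; apply: (@admissible_quadratic R _ v (fun a => (a == b)%:R) t%:R B K) => //.
- by move=> a a'; case/andP: (v_bounds a a').
- move=> Th; pose s : R := \sum_(a in Th) (a == b)%:R.
  have s1 : s <= 1.
    apply: (@le_trans _ _ (\sum_a (a == b)%:R)).
      by rewrite [leRHS](bigID (fun a => a \in Th)) /= lerDl sumr_ge0.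
    by rewrite (bigD1 b) //= eqxx big1 ?addr0 // => a /negbTE ->.
  have s0 : 0 <= s by exact: sumr_ge0.
  apply: (@le_trans _ _ (B * s * s)); last first.
    by rewrite ler_piMr // mulr_ge0 // ltW // B_gt0.
  rewrite -mulrA mulr_suml mulr_sumr; apply: ler_sum => a _.
  rewrite mulr_sumr mulr_sumr; apply: ler_sum => a' _.
  by rewrite mulrC ler_wpM2r ?mulr_ge0 //; case/andP: (v_bounds a a').
- by move=> a; case: eqP => _; rewrite ?mulr1 ?mulr0.
Qed.

Section Profiles.
Variables (k : nat) (mu : 'I_k -> probability (measurableTypeR R) R) (f alpha : 'I_k -> R).
Variables (eps L : R).
Hypothesis fE : forall l, phi (mu l) W = (f l)%:E.
Hypothesis f_bounds : forall l, b0 <= f l <= B.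
Hypothesis eps01 : 0 < eps <= 1 / 5.
Hypothesis L0 : 0 < L.

(** The profiles [inl l] read their masses on [D' a] but will prescribe vertices of [D a]: this is
    the shift of mass between neighbours. The profiles [inr b] take vertices from one class only. *)
Definition profile (l : 'I_k + option A) (a : option A) : nat :=
  match l with
  | inl l => if a is Some a then
      Num.truncn ((1 - eps) * (2 * L) / f l * pr (mu l) (D' a)) else 0%N
  | inr b => if a == b then Num.truncn ((1 - eps) * (2 * L) / B) else 0%N
  end.

Let K := (1 - eps) * (2 * L).

Lemma K_gt0 : 0 < K.
Proof. by have /andP[e0 e1] := eps01; rewrite !mulr_gt0 //; lra. Qed.

Lemma f_gt0 l : 0 < f l.
Proof. by have /andP[h _] := f_bounds l; exact: lt_le_trans b0_gt0 h. Qed.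

Lemma profile_admissible l : admissible v K (profile l).
Proof.
have K0 := K_gt0; case: l => [l|b].
  have f0 := f_gt0 l; apply: (@measure_profile_admissible (mu l) (f l) (K / f l)) => //.
  - exact: ltW.
  - by rewrite divr_ge0 ?ltW.
  - by rewrite divfK // gt_eqF.
  - by move=> a /=; rewrite truncn_le // mulr_ge0 ?pr_ge0 // divr_ge0 ?ltW.
apply: single_profile_admissible.
rewrite -ler_pdivlMr ?B_gt0 // truncn_le // divr_ge0 ?ltW //; exact: B_gt0.
Qed.

Lemma profile_le l a : ((profile l a)%:R : R) <= 2 * L / b0.
Proof.
have K0 := K_gt0; have b00 := b0_gt0; have B0 := B_gt0.
have KL : K <= 2 * L by rewrite ler_piMl ?mulr_ge0 ?ltW //; have /andP[] := eps01; lra.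
have P0 : 0 <= 2 * L / b0 by rewrite divr_ge0 ?mulr_ge0 ?ltW.
have step (g p : R) : b0 <= g -> 0 <= p <= 1 -> (Num.truncn (K / g * p))%:R <= 2 * L / b0.
  move=> bg /andP[p0 p1]; have g0 : 0 < g by exact: lt_le_trans b00 bg.
  apply: (@le_trans _ _ (K / g * p)).
    by rewrite truncn_le // mulr_ge0 // divr_ge0 ?ltW.
  apply: (@le_trans _ _ (K / g)); first by rewrite ler_piMr // divr_ge0 ?ltW.
  apply: ler_pM; [exact: ltW|by rewrite invr_ge0 ltW|exact: KL|by rewrite lef_pV2 ?posrE].
case: l => [l|b] /=.
  case: a => [a|] //; apply: step; first by have /andP[] := f_bounds l.
  rewrite pr_ge0 /=; have -> : (1 : R) = pr (mu l) setT by rewrite /pr probability_setT.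
  by apply: le_pr => //; exact: (slots_meas' hs).
case: eqP => // _; rewrite -[K / B]mulr1; apply: step; first exact: b0_le_B.
by rewrite ler01 lexx.
Qed.

(** Without rounding, [alpha l * (1 + eta) * n * f l / K] extractions of each profile [l] would
    exhaust every slot. The four [tau] pay for rounding these [k] numbers up, for the single-class
    sets that repair the rounded profiles, for rounding the numbers of single-class sets, and for
    the survivors. The last term pays for the vertices outside the slots. *)
Lemma chi_le_profiles (n : nat) (cl : 'I_n -> option A) (u : nat) (eta tau : R) (g : graph n) :
  (0 < n)%N -> 0 <= kap <= 1 -> 0 <= eta <= 1 -> (forall l, 0 <= alpha l) ->
  (forall a, \sum_l alpha l * pr (mu l) (D' a) = len a) ->
  (forall a, (1 - eta) * (len a * n%:R) <= #|[set i | cl i == Some a]%SET|%:R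
     <= (1 + eta) * (len a * n%:R)) ->
  extractable cl u profile g ->
  let y := n%:R / (2 * L) in
  let C1 := (1 + eta) * (\sum_l alpha l * f l) / (1 - eps) in
  B <= eps * (2 * L) -> #|A|%:R * (C1 + tau) <= tau * ((1 - 2 * eps) * (2 * L) / B) ->
  k%:R <= tau * y -> #|A|%:R + 1 <= tau * y -> (#|A|%:R + 1) * u%:R <= tau * y ->
  (chi g)%:R <= y * (C1 + 4 * tau + 2 * B * (kap + eta)).
Proof.
move=> n0 /andP[kap0 kap1] /andP[eta0 eta1] al0 hal count ext y C1 BL hA hk hA1 hu.
have K0 := K_gt0; have B0 := B_gt0; have /andP[e0 e5] := eps01.
have n0' : 0 < n%:R :> R by rewrite ltr0n.
have y0 : 0 < y by rewrite divr_gt0 ?mulr_gt0.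
set t0 := Num.truncn (K / B).
have ht0 : (1 - 2 * eps) * (2 * L) / B <= t0%:R.
  have h : K / B < t0%:R + 1 by rewrite natr1 truncnS_gt.
  have h1 : 1 <= eps * (2 * L) / B by rewrite ler_pdivlMr // mul1r.
  have -> : (1 - 2 * eps) * (2 * L) / B = K / B - eps * (2 * L) / B by rewrite /K; ring.
  lra.
have q0 : 0 < (1 - 2 * eps) * (2 * L) / B by rewrite divr_gt0 ?mulr_gt0 //; lra.
have t00 : 0 < t0%:R :> R by exact: lt_le_trans q0 ht0.
pose X l : R := alpha l * (1 + eta) * n%:R * f l / K.
have X0 l : 0 <= X l by rewrite divr_ge0 ?(ltW K0) // !mulr_ge0 ?(ltW (f_gt0 l)) //; lra.
pose Mm l := (Num.truncn (X l)).+1.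
pose Mt := (\sum_l Mm l)%N.
pose Z : R := (kap + eta) * n%:R / t0%:R.
have Z0 : 0 <= Z by rewrite divr_ge0 // mulr_ge0 //; lra.
(* Rounding a profile down loses less than one vertex per slot and extraction, hence at most [Mt]
   per slot, repaired by about [Mt / t0] sets of size [t0]. At most (kap + eta) n vertices lie
   outside the slots, hence [Z]. *)
pose M (l : 'I_k + option A) : nat :=
  match l with
  | inl l => Mm l
  | inr (Some _) => (Mt %/ t0).+1
  | inr None => (Num.truncn Z).+1
  end.
have sumM (F : 'I_k + option A -> nat) :
    (\sum_l F l = \sum_l F (inl l) + (F (inr None) + \sum_a F (inr (Some a))))%N.
  by rewrite big_sumType /=; congr (_ + _)%N; exact: (@sum_option nat).
have XM l : X l <= (Mm l)%:R by rewrite ltW // truncnS_gt.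
have cover a : (#|[set i | cl i == a]%SET| <= \sum_l M l * profile l a)%N.
  rewrite sumM; case: a => [a|] /=; last first.
    rewrite -(ler_nat R); apply: (@le_trans _ _ (((Num.truncn Z).+1 * t0)%N%:R : R)); last first.
      by rewrite ler_nat -/t0 (leq_trans _ (leq_addl _ _)) // leq_addr.
    have Zt : (kap + eta) * n%:R <= ((Num.truncn Z).+1 * t0)%N%:R :> R.
      by rewrite natrM -ler_pdivrMr // ltW // truncnS_gt.
    apply: le_trans Zt.
    have tot : n%:R = #|[set i | cl i == None]%SET|%:R +
        \sum_a #|[set i | cl i == Some a]%SET|%:R :> R.
      transitivity ((\sum_(a : option A) #|[set i | cl i == a]%SET|)%N%:R : R); last first.
        by rewrite natr_sum sum_option.
      congr (_%:R); rewrite -[LHS](card_ord n) -[LHS]sum1_card (partition_big cl predT) //=.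
      by apply: eq_bigr => a _; rewrite -sum1_card; apply: eq_bigl => i; rewrite inE.
    have low : (1 - eta) * n%:R * \sum_a len a <= \sum_a #|[set i | cl i == Some a]%SET|%:R.
      rewrite mulr_sumr; apply: ler_sum => a _.
      by have /andP[+ _] := count a; rewrite -mulrA [n%:R * _]mulrC.
    have hS := slots_sum hs.
    have h1 : (1 - eta) * n%:R * (1 - kap) <= (1 - eta) * n%:R * \sum_a len a.
      by rewrite ler_wpM2l // mulr_ge0 //; lra.
    have h2 : 0 <= eta * n%:R * kap by rewrite !mulr_ge0.
    lra.
  apply: (@leq_trans (\sum_l Mm l * profile (inl l) (Some a) + (Mt %/ t0).+1 * t0)); last first.
    by rewrite leq_add2l -/t0 (leq_trans _ (leq_addl _ _)) // (bigD1 a) //= eqxx leq_addr.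
  have t0n : (0 < t0)%N by rewrite -(ltr0n R).
  have hMt : (Mt <= (Mt %/ t0).+1 * t0)%N by rewrite ltnW // ltn_ceil.
  apply: (@leq_trans (\sum_l Mm l * profile (inl l) (Some a) + Mt)); last by rewrite leq_add2l.
  rewrite -(ler_nat R) natrD /Mt !natr_sum -big_split /=.
  have /andP[_ cnt] := count a; apply: (le_trans cnt).
  rewrite -hal mulrA [_ * n%:R]mulrC mulrA [X in X <= _]mulr_sumr.
  apply: ler_sum => l _.
  have -> : (Mm l * profile (inl l) (Some a))%N%:R + (Mm l)%:R =
      (Mm l)%:R * ((profile (inl l) (Some a))%:R + 1) :> R by rewrite natrM; ring.
  have h : K / f l * pr (mu l) (D' a) < (profile (inl l) (Some a))%:R + 1.
    by rewrite natr1 truncnS_gt.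
  apply: (@le_trans _ _ (X l * (K / f l * pr (mu l) (D' a)))).
    rewrite /X le_eqVlt; apply/orP; left; apply/eqP; field.
    by rewrite !lt0r_neq0 // f_gt0.
  apply: (@le_trans _ _ ((Mm l)%:R * (K / f l * pr (mu l) (D' a)))).
    by rewrite ler_wpM2r // mulr_ge0 ?pr_ge0 // divr_ge0 ?ltW // f_gt0.
  by rewrite ler_wpM2l // ltW.
have := chi_le_greedy ext cover; rewrite sumM card_option -(ler_nat R) => /le_trans; apply.
have hMt : Mt%:R <= C1 * y + k%:R.
  rewrite /Mt natr_sum; apply: (@le_trans _ _ (\sum_l (X l + 1))).
    by apply: ler_sum => l _; rewrite /Mm -natr1 lerD2r truncn_le.
  rewrite big_split /= sumr_const card_ord lerD2r.
  rewrite le_eqVlt; apply/orP; left; apply/eqP.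
  have -> : C1 * y = (\sum_l alpha l * f l) * ((1 + eta) / (1 - eps) * y) by rewrite /C1; ring.
  rewrite mulr_suml; apply: eq_bigr => l _.
  rewrite /X /K /y; field; rewrite !lt0r_neq0 //; lra.
have hdiv : #|A|%:R * (Mt %/ t0)%N%:R <= tau * y.
  apply: (@le_trans _ _ (#|A|%:R * (Mt%:R / t0%:R))).
    rewrite ler_wpM2l // ler_pdivlMr // -natrM ler_nat leq_divM.
    by [].
  rewrite mulrA ler_pdivrMr //.
  apply: (@le_trans _ _ (#|A|%:R * ((C1 + tau) * y))).
    by rewrite ler_wpM2l // (le_trans hMt) // mulrDl lerD2l.
  rewrite mulrA; apply: (@le_trans _ _ (tau * ((1 - 2 * eps) * (2 * L) / B) * y)).
    by rewrite ler_wpM2r // ltW.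
  have tau0 : 0 <= tau by rewrite -(pmulr_lge0 _ y0) (le_trans _ hk).
  by rewrite mulrAC ler_wpM2l // mulr_ge0 // ltW.
have hZ : Z <= y * (2 * B * (kap + eta)).
  apply: (@le_trans _ _ ((kap + eta) * n%:R / ((1 - 2 * eps) * (2 * L) / B))).
    rewrite ler_wpM2l ?mulr_ge0 //; first by lra.
    by rewrite lef_pV2 ?posrE.
  have -> : (kap + eta) * n%:R / ((1 - 2 * eps) * (2 * L) / B) =
      y * (B * (kap + eta)) / (1 - 2 * eps).
    rewrite /y; field; rewrite !lt0r_neq0 //; lra.
  rewrite ler_pdivrMr; last lra.
  rewrite -[leRHS]mulrA ler_wpM2l ?(ltW y0) //.
  have : 0 <= B * (kap + eta) by rewrite mulr_ge0 ?(ltW B0) //; lra.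
  set w := B * (kap + eta) => w0.
  have -> : 2 * B * (kap + eta) = 2 * w by rewrite /w mulrA.
  nra.
have hU : (#|A|.+1 * u)%N%:R = (#|A|%:R + 1) * u%:R :> R by rewrite natrM -natr1.
rewrite natrD hU /= sum_nat_const !natrD.
have hT : (Num.truncn Z).+1%:R <= Z + 1 :> R by rewrite -natr1 lerD2r truncn_le.
have hS : (#|A| * (Mt %/ t0).+1)%N%:R = #|A|%:R * (Mt %/ t0)%N%:R + #|A|%:R :> R.
  by rewrite natrM -natr1 mulrDr mulr1.
rewrite -/Mt hS; lra.
Qed.

End Profiles.
End Upper.

(** * Asymptotics *)

Section Asymptotics.
Context {R : realType}.

(** From exp x >= (x / 3)^3: a cubic lower bound already beats a square. *)
Lemma square_le_exp (C dl : R) : 0 < dl -> \forall L \near +oo, C * L ^+ 2 <= expR (dl * L).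
Proof.
move=> dl0; near=> L.
have L0 : 0 <= L by near: L; exact: nbhs_pinfty_ge.
have LC : 27 * `|C| / dl ^+ 3 <= L by near: L; apply: nbhs_pinfty_ge; rewrite num_real.
apply: (@le_trans _ _ ((dl * L / 3) ^+ 3)).
  have -> : (dl * L / 3) ^+ 3 = (dl ^+ 3 / 27 * L) * L ^+ 2 by field.
  rewrite ler_wpM2r ?sqr_ge0 //; move: LC; rewrite ler_pdivrMr ?exprn_gt0 // => LC.
  have := ler_norm C; lra.
have -> : expR (dl * L) = expR (dl * L / 3) ^+ 3.
  by rewrite -expRM_natl; congr expR; field.
rewrite lerXn2r ?nnegrE ?expR_ge0 //; first by rewrite !mulr_ge0 // ltW.
by apply: (le_trans _ (expR_ge1Dx _)); rewrite lerDr.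
Unshelve. all: by end_near. Qed.

(** Estimates are proved for a real [L] tending to infinity, with exp L in the role of n, and then
    specialised to L = ln n. *)
Lemma near_ln (Q : R -> Prop) : (\forall L \near +oo, Q L) ->
  \forall n \near \oo, (0 < n)%N /\ Q (ln (n%:R : R)).
Proof.
move=> [M [_ hM]]; exists (Num.truncn (expR M)).+1 => // n /= nM.
have n0 : (0 < n)%N by exact: leq_trans nM.
split => //; apply: hM; rewrite -[M]expRK ltr_ln ?posrE ?expR_gt0 ?ltr0n //.
by apply: (lt_le_trans (truncnS_gt _)); rewrite ler_nat.
Qed.

(** The parameter [T]: it exceeds every entry of every profile. *)
Definition size_bound (b0 L : R) : nat := (Num.truncn (2 * L / b0)).+1.
(** The parameter [N], about n^(1 - eps / 4): large enough for the overlap sum, small enough for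
    [T * N] to be negligible against n / ln n. *)
Definition part_size (eps L : R) : nat := (Num.truncn (expR ((1 - eps / 4) * L))).+1.

(** All requirements that n be large. Here [a], [k] and [m] are the numbers of slots, measures and
    profiles, [C] collects the constants of Chebyshev's inequality, and [n] is real so that it can
    be exp L. *)
Record large (eps b0 B C1 tau rho C : R) (a k m : nat) (n L : R) : Prop := Large {
  large_10 : 10 <= L;
  large_B : 40 * B <= eps * L;
  large_T : (a.+1 * size_bound b0 L)%:R <= expR (eps / 4 * L);
  large_a : a%:R * (C1 + tau) <= tau * ((1 - 2 * eps) * (2 * L) / B);
  large_k : k%:R <= tau * (n / (2 * L));
  large_a1 : a%:R + 1 <= tau * (n / (2 * L));
  large_u : (a%:R + 1) * (size_bound b0 L * part_size eps L)%:R <= tau * (n / (2 * L));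
  large_sparse : expR (n * expR (- ((1 + eps) * L))) - 1 <= rho;
  large_extract : m%:R * expR n * expR (- (expR (3 / 2 * L) / 2)) <= rho;
  large_count : C / n <= rho }.

Lemma near_large (eps b0 B C1 tau rho C : R) (a k m : nat) :
  0 < eps <= 1 / 5 -> 0 < b0 -> 0 < B -> 0 < tau -> 0 < rho ->
  \forall L \near +oo, large eps b0 B C1 tau rho C a k m (expR L) L.
Proof.
move=> /andP[e0 e5] b00 B0 tau0 rho0.
have near_ge (c : R) : \forall L \near +oo, c <= L.
  by apply: nbhs_pinfty_ge; rewrite num_real.
have e40 : 0 < eps / 4 by rewrite divr_gt0.
have e80 : 0 < eps / 8 by rewrite divr_gt0.
near=> L.
have L10 : 10 <= L by near: L; exact: near_ge.
have L0 : 0 < L by lra.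
have L1 : 1 <= L by lra.
have LL : L <= L ^+ 2 by rewrite expr2 ler_peMr // ltW.
have LL1 : 1 <= L ^+ 2 by exact: le_trans L1 LL.
have y0 c : c * (2 * L) <= tau * expR L -> c <= tau * (expR L / (2 * L)).
  by move=> h; rewrite mulrA ler_pdivlMr // mulr_gt0.
have Lexp (c : R) : 0 <= c -> 2 * c / tau * L ^+ 2 <= expR (1 * L) -> c <= tau * (expR L / (2 * L)).
  rewrite mul1r => c0 h; apply: y0.
  apply: (@le_trans _ _ (tau * (2 * c / tau * L ^+ 2))); last by rewrite ler_wpM2l // ltW.
  have -> : tau * (2 * c / tau * L ^+ 2) = c * (2 * L ^+ 2) by field; rewrite lt0r_neq0.
  by rewrite ler_wpM2l // ler_wpM2l.
have hT : (size_bound b0 L)%:R <= (2 / b0 + 1) * L.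
  rewrite /size_bound -[leLHS]natr1 [leRHS]mulrDl mul1r lerD //.
  apply: (@le_trans _ _ (2 * L / b0)); last by rewrite mulrAC.
  by rewrite truncn_le // divr_ge0 ?mulr_ge0 // ltW.
have q0 : 0 < 2 / b0 + 1 by rewrite addr_gt0 // divr_gt0.
have expL (x : R) : 0 <= x -> 1 <= expR x by move=> x0; rewrite -expR0 ler_expR.
have hN : (part_size eps L)%:R <= 2 * expR ((1 - eps / 4) * L).
  rewrite /part_size -[leLHS]natr1.
  have h0 : 0 <= (1 - eps / 4) * L by rewrite mulr_ge0 ?(ltW L0) //; lra.
  have h1 := expL _ h0.
  have h : (Num.truncn (expR ((1 - eps / 4) * L)))%:R <= expR ((1 - eps / 4) * L).
    by rewrite truncn_le // expR_ge0.
  lra.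
split.
- exact: L10.
- have : 40 * B / eps <= L by near: L; exact: near_ge.
  by rewrite ler_pdivrMr // [L * eps]mulrC.
- have h : a.+1%:R * (2 / b0 + 1) * L ^+ 2 <= expR (eps / 4 * L).
    by near: L; exact: square_le_exp.
  apply: le_trans h; rewrite natrM -mulrA ler_wpM2l // (le_trans hT) //.
  by rewrite ler_wpM2l // ltW.
- have h : a%:R * (C1 + tau) / (tau * ((1 - 2 * eps) * 2 / B)) <= L.
    by near: L; exact: near_ge.
  have p0 : 0 < tau * ((1 - 2 * eps) * 2 / B).
    by rewrite mulr_gt0 // divr_gt0 // mulr_gt0 //; lra.
  move: h; rewrite ler_pdivrMr // => /le_trans; apply.
  by rewrite le_eqVlt; apply/orP; left; apply/eqP; ring.
- by apply: Lexp => //; near: L; exact: square_le_exp.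
- by apply: Lexp; [rewrite addr_ge0|near: L; exact: square_le_exp].
- apply: y0; rewrite natrM.
  have h : (a%:R + 1) * (2 / b0 + 1) * 4 / tau * L ^+ 2 <= expR (eps / 4 * L).
    by near: L; exact: square_le_exp.
  apply: (@le_trans _ _ ((a%:R + 1) * (((2 / b0 + 1) * L) * (2 * expR ((1 - eps / 4) * L))) * (2 * L))).
    by rewrite ler_wpM2r ?mulr_ge0 ?(ltW L0) // ler_wpM2l ?addr_ge0 // ler_pM.
  have -> : expR L = expR (eps / 4 * L) * expR ((1 - eps / 4) * L).
    by rewrite -expRD; congr expR; ring.
  set X := expR ((1 - eps / 4) * L).
  have -> : (a%:R + 1) * ((2 / b0 + 1) * L * (2 * X)) * (2 * L) =
     tau * ((a%:R + 1) * (2 / b0 + 1) * 4 / tau * L ^+ 2) * X.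
    by field; rewrite !lt0r_neq0.
  by rewrite [leRHS]mulrA ler_wpM2r ?expR_ge0 // ler_wpM2l // ltW.
- have h : - ln (ln (1 + rho)) / eps <= L by near: L; exact: near_ge.
  have r0 : 0 < ln (1 + rho) by rewrite ln_gt0 //; lra.
  rewrite lerBlDr [rho + 1]addrC -expRD.
  have -> : L + - ((1 + eps) * L) = - (eps * L) by ring.
  have -> : 1 + rho = expR (ln (1 + rho)) by rewrite lnK // posrE; lra.
  rewrite ler_expR -[leRHS]lnK ?posrE // ler_expR lerNl.
  by move: h; rewrite ler_pdivrMr // mulrC.
(* Once n^(1/2) >= 4, the failure probability exp (- n^(3/2) / 2) is at most exp (- 2 n), which
   beats a union bound with exp n terms. *)
- have h : 4 <= expR (L / 2).
    apply: (le_trans _ (expR_ge1Dx _)); lra.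
  have h2 : m%:R / rho <= L by near: L; exact: near_ge.
  have -> : expR (3 / 2 * L) = expR L * expR (L / 2) by rewrite -expRD; congr expR; field.
  have e1 : expR (- (expR L * expR (L / 2) / 2)) <= expR (- (2 * expR L)).
    rewrite ler_expR lerN2; have : expR L * 4 <= expR L * expR (L / 2) by rewrite ler_wpM2l ?expR_ge0.
    lra.
  apply: (@le_trans _ _ (m%:R * expR (expR L) * expR (- (2 * expR L)))).
    by rewrite ler_wpM2l // mulr_ge0 // expR_ge0.
  rewrite -mulrA -expRD; have -> : expR L + - (2 * expR L) = - expR L by ring.
  rewrite expRN ler_pdivrMr ?expR_gt0 // mulrC -ler_pdivrMr // (le_trans h2) //.
  have LE : L <= expR L by apply: (le_trans _ (expR_ge1Dx _)); rewrite lerDr.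
  by apply: (le_trans LE); apply: (le_trans _ (expR_ge1Dx _)); rewrite lerDr ler01.
- have h : C / rho <= L by near: L; exact: near_ge.
  rewrite ler_pdivrMr ?expR_gt0 // mulrC -ler_pdivrMr // (le_trans h) //.
  by apply: (le_trans _ (expR_ge1Dx _)); rewrite lerDr.
Unshelve. all: by end_near. Qed.

End Asymptotics.

(** * Finiteness of phi_* and near-optimal decompositions *)

Section PhiStar.
Context {R : realType}.
Variables (W : R -> R -> R) (lo hi : R).
Hypothesis lo0 : 0 < lo.
Hypothesis hi1 : hi < 1.
Hypothesis W_bounds : forall x y, I01 R x -> I01 R y -> lo <= W x y <= hi.

Let B := - ln (1 - hi).
Let b0 := - ln (1 - lo).

Lemma C_lambda_average (k : nat) (mu : 'I_k -> probability (measurableTypeR R) R)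
    (alpha : 'I_k -> R) : C_lambda mu alpha ->
  exists2 f : 'I_k -> R, (forall l, phi (mu l) W = (f l)%:E /\ b0 <= f l <= B) &
    (\sum_l (alpha l)%:E * phi (mu l) W)%E = (\sum_l alpha l * f l)%:E.
Proof.
move=> [muI _ _ _ _].
have ex l : exists f, phi (mu l) W = f%:E /\ b0 <= f <= B.
  by have [f fE fb] := phi_fin lo0 hi1 W_bounds (muI l); exists f.
have [f hf] := choice ex; exists f => //.
rewrite -sumEFin; apply: eq_bigr => l _.
by have [-> _] := hf l; rewrite EFinM.
Qed.

(** The decomposition consisting of [lambda01] alone gives the upper bound. The lower one holds
    because [phi] is at least [b0] for every measure on [0,1] and the weights sum to 1. *)
Lemma phi_star_fin : exists2 p : R, phi_star W = p%:E & b0 <= p <= B.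
Proof.
have up : (phi_star W <= B%:E)%E.
  have := @phi_star_le_family R W unit (fun=> 1) (fun=> B) (fun=> lambda01 R).
  rewrite !big_unit mul1r; apply=> // [_|A mA|_].
  - exact: on_unit_lambda01.
  - by rewrite (big_pred1 tt) ?mul1e // => -[].
  - exact: (phi_le_hi lo0 hi1 W_bounds on_unit_lambda01).
have low : (b0%:E <= phi_star W)%E.
  apply: le_ereal_inf_tmp => _ [k [mu [alpha [cl ->]]]].
  have [f hf ->] := C_lambda_average cl; have [_ _ al01 al1 _] := cl.
  rewrite lee_fin -[leLHS]mul1r -al1 mulr_suml; apply: ler_sum => l _.
  by rewrite ler_wpM2l //; [case/andP: (al01 l)|have [_ /andP[]] := hf l].
move: up low; case: (phi_star W) => [p| |] //=; rewrite !lee_fin => h1 h2.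
by exists p => //; rewrite h1 h2.
Qed.

Lemma near_optimal (p delta : R) : phi_star W = p%:E -> 0 < delta ->
  exists (k : nat) (mu : 'I_k -> probability (measurableTypeR R) R) (alpha f : 'I_k -> R),
    [/\ C_lambda mu alpha, forall l, phi (mu l) W = (f l)%:E,
        forall l, b0 <= f l <= B & \sum_l alpha l * f l <= p + delta].
Proof.
move=> pE d0; have : (phi_star W < (p + delta)%:E)%E by rewrite pE lte_fin ltrDl.
move=> /ereal_inf_lt[_ [k [mu [alpha [cl ->]]]]].
have [f hf ->] := C_lambda_average cl; rewrite lte_fin => /ltW h.
by exists k, mu, alpha, f; split => // l; case: (hf l).
Qed.

End PhiStar.

Section SlotOf.
Context {R : realType} {A : finType}.
Variable E : A -> set R.
Hypothesis disE : forall a b x, E a x -> E b x -> a = b.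

Definition slot_of (x : R) : option A := [pick a | `[< E a x >]].

Lemma slot_of_some x a : slot_of x = Some a -> E a x.
Proof. by rewrite /slot_of; case: pickP => // b /asboolP Eb [<-]. Qed.

Lemma slot_of_in x a : E a x -> slot_of x = Some a.
Proof.
rewrite /slot_of => Ea; case: pickP => [b /asboolP Eb|/(_ a)/asboolP //].
by rewrite (disE Eb Ea).
Qed.

Lemma count_slot_of (n : nat) (x : n.-tuple R) a :
  #|[set i | slot_of (tnth x i) == Some a]%SET|%:R = count_in (E a) x.
Proof.
rewrite -sum1_card natr_sum big_mkcond /=; apply: eq_bigr => i _.
rewrite inE indicE; case: eqP => [/slot_of_some Ea|nE]; first by rewrite mem_set.
by rewrite memNset // => /slot_of_in.
Qed.

End SlotOf.

(** * Both bounds for a fixed number of vertices *)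

Section FiniteSize.
Context {R : realType}.
Variables (W : R -> R -> R) (lo hi : R).
Hypothesis lo0 : 0 < lo.
Hypothesis hi1 : hi < 1.
Hypothesis W_bounds : forall x y, I01 R x -> I01 R y -> lo <= W x y <= hi.
Hypothesis hW : graphon W.
Context {A : finType}.
Variables (D D' : A -> set R) (z : A -> R) (len : A -> R).
Variables (p eps e : R).

Let B := - ln (1 - hi).
Let b0 := - ln (1 - lo).
(** Used both as the relative error of the counts and as the mass lost by the slots. Errors appear
    multiplied by [B], and B eta = eps b0 / 4 <= eps p / 4 makes them relative to [p]. *)
Let eta := eps * b0 / (4 * B).
Let tau := eps * b0.

Hypothesis pE : phi_star W = p%:E.
Hypothesis p_bounds : b0 <= p <= B.
Hypothesis eps_bounds : 0 < eps <= 1 / 5.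
Hypothesis eps_e : 9 * eps <= e.
Hypothesis hs : slots W D D' z len eta.

Variables (k : nat) (mu : 'I_k -> probability (measurableTypeR R) R) (alpha f : 'I_k -> R).
Hypothesis clam : C_lambda mu alpha.
Hypothesis fE : forall l, phi (mu l) W = (f l)%:E.
Hypothesis f_bounds : forall l, b0 <= f l <= B.
Hypothesis near_opt : \sum_l alpha l * f l <= p + eps * p.

Let C1 := (1 + eta) * (\sum_l alpha l * f l) / (1 - eps).
Let C := \sum_(j : A + A) 1 / (eta * len (match j with inl a => a | inr a => a end)) ^+ 2.

Let W_sym x y : I01 R x -> I01 R y -> W x y = W y x.
Proof. by have [_ + _] := hW; apply. Qed.

Lemma b0_pos : 0 < b0. Proof. exact: (b0_gt0 lo0 hi1 W_bounds). Qed.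
Lemma B_pos : 0 < B. Proof. exact: (B_gt0 lo0 hi1 W_bounds). Qed.
Lemma b0_B : b0 <= B. Proof. exact: (b0_le_B hi1 W_bounds). Qed.

Lemma eta_gt0 : 0 < eta.
Proof.
have /andP[e0 _] := eps_bounds.
by rewrite divr_gt0 ?mulr_gt0 ?b0_pos ?B_pos.
Qed.

Lemma eta_B : B * eta = eps * b0 / 4.
Proof. by rewrite /eta; field; rewrite lt0r_neq0 ?B_pos. Qed.

Lemma eta_le : eta <= eps / 4.
Proof.
have /andP[e0 _] := eps_bounds.
rewrite -(ler_pM2l B_pos) eta_B; have := b0_B => h.
have : eps * b0 <= eps * B by rewrite ler_wpM2l // ltW.
lra.
Qed.

Variables (n : nat) (L rho : R).
Hypothesis n0 : (0 < n)%N.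
Hypothesis hlarge : large eps b0 B C1 tau rho C #|A| k #|{: 'I_k + option A}| n%:R L.

Let y := n%:R / (2 * L).

Lemma L_gt0 : 0 < L. Proof. by have := large_10 hlarge; lra. Qed.

Section Positions.
Variable x : n.-tuple R.
Hypothesis xI : forall i, I01 R (tnth x i).
Let cl i := slot_of D (tnth x i).
Let cl' i := slot_of D' (tnth x i).
Let N := part_size eps L.
Let T := size_bound b0 L.

Hypothesis count : forall a, (1 - eta) * (len a * n%:R) <= count_in (D a) x <=
  (1 + eta) * (len a * n%:R).
Hypothesis count' : forall a, (1 - eta) * (len a * n%:R) <= count_in (D' a) x <=
  (1 + eta) * (len a * n%:R).

Lemma chi_lower (g : graph n) : sparse cl' (slot_weight W z 0) ((1 + eps) * L) g ->
  (1 - e) * p * y <= (chi g)%:R.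
Proof.
move=> sp; have /andP[e0 e5] := eps_bounds.
have et0 := eta_gt0; have et1 := eta_le; have L0 := L_gt0.
have n0' : 0 < n%:R :> R by rewrite ltr0n.
have /andP[pb _] := p_bounds; have b00 := b0_pos.
have := @phi_star_le_chi R W lo hi lo0 hi1 W_bounds W_sym A D D' z len eta hs n cl' eta
  ((1 + eps) * L) g n0.
have -> : 0 <= eta <= 1 by lra.
have -> : 0 <= eta <= 1 / 2 by lra.
have -> : 0 <= (1 + eps) * L by rewrite mulr_ge0 ?(ltW L0) //; lra.
move=> /(_ isT isT isT) h.
have c a : (1 - eta) * (len a * n%:R) <= #|[set i | cl' i == Some a]%SET|%:R
     <= (1 + eta) * (len a * n%:R).
  by rewrite (count_slot_of (slots_dis' hs)).
have {h} := h c sp; rewrite pE lee_fin.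
rewrite -/B => h.
have hq : (2 * ((1 + eps) * L) + B) / ((1 + eta) * n%:R) <= 2 * L * (1 + 2 * eps) / n%:R.
  have hB := large_B hlarge; have B0 := B_pos.
  rewrite ler_pM ?invr_ge0 //; first by rewrite addr_ge0 ?(ltW B0) // mulr_ge0 // mulr_ge0 ?(ltW L0) //; lra.
  - by rewrite mulr_ge0 ?(ltW n0') //; lra.
  - lra.
  - by rewrite lef_pV2 ?posrE ?mulr_gt0 // ?ler_peMl ?(ltW n0') //; lra.
have h2 : (1 - eps) * p <= (chi g)%:R * (2 * L * (1 + 2 * eps) / n%:R).
  have : (chi g)%:R * ((2 * ((1 + eps) * L) + B) / ((1 + eta) * n%:R)) <=
    (chi g)%:R * (2 * L * (1 + 2 * eps) / n%:R) by rewrite ler_wpM2l.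
  have : eps * b0 <= eps * p by rewrite ler_wpM2l // ltW.
  have : 0 <= eps * p by rewrite mulr_ge0 ?(ltW e0) //; lra.
  have := eta_B; lra.
have y0 : 0 < y by rewrite divr_gt0 // mulr_gt0.
have h3 : (1 - eps) * p * y <= (chi g)%:R * (1 + 2 * eps).
  have -> : (chi g)%:R * (1 + 2 * eps) =
      (chi g)%:R * (2 * L * (1 + 2 * eps) / n%:R) * y by rewrite /y; field; rewrite !lt0r_neq0.
  by rewrite ler_wpM2r // ltW.
have py : 0 < p * y by rewrite mulr_gt0 //; lra.
rewrite -(ler_pM2r (_ : 0 < 1 + 2 * eps)); last lra.
apply: le_trans h3.
have -> : (1 - e) * p * y * (1 + 2 * eps) = ((1 - e) * (1 + 2 * eps)) * (p * y) by ring.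
rewrite -[leRHS]mulrA ler_wpM2r ?(ltW py) //.
have : 9 * eps * eps <= e * eps by rewrite ler_wpM2r // ltW.
have : 0 <= eps * eps by rewrite mulr_ge0 // ltW.
have := eps_e; lra.
Qed.

Lemma chi_upper (g : graph n) : extractable cl (T * N) (profile hi D' mu f eps L) g ->
  (chi g)%:R <= (1 + e) * p * y.
Proof.
move=> ext; have /andP[e0 e5] := eps_bounds.
have et0 := eta_gt0; have et1 := eta_le; have L0 := L_gt0.
have n0' : 0 < n%:R :> R by rewrite ltr0n.
have /andP[pb _] := p_bounds; have b00 := b0_pos.
have y0 : 0 < y by rewrite divr_gt0 // mulr_gt0.
have [_ _ al01 _ almu] := clam.
have c a : (1 - eta) * (len a * n%:R) <= #|[set i | cl i == Some a]%SET|%:R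
     <= (1 + eta) * (len a * n%:R).
  by rewrite (count_slot_of (slots_dis hs)).
have hal a : \sum_l alpha l * pr (mu l) (D' a) = len a.
  apply: EFin_inj; rewrite -sumEFin -(slots_len' hs) prE; last exact: (slots_meas' hs).
  rewrite -almu; last exact: (slots_meas' hs).
  by apply: eq_bigr => l _; rewrite EFinM prE //; exact: (slots_meas' hs).
have al0 l : 0 <= alpha l by case/andP: (al01 l).
have hB : B <= eps * (2 * L) by have := large_B hlarge; have := B_pos; lra.
have k1 : 0 <= eta <= 1 by lra.
have := @chi_le_profiles R W lo hi lo0 hi1 W_bounds A D D' z len eta hs k mu f alpha eps L
  f_bounds eps_bounds L0 n cl (T * N) eta tau g n0 k1 k1 al0 hal c ext hB
  (large_a hlarge) (large_k hlarge) (large_a1 hlarge) (large_u hlarge).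
move=> /le_trans; apply; rewrite [leRHS]mulrC ler_wpM2l ?(ltW y0) //.
have p0 : 0 < p by lra.
have ep : eps * b0 <= eps * p by rewrite ler_wpM2l // ltW.
have hC1 : (1 + eta) * (\sum_l alpha l * f l) / (1 - eps) <= (1 + 4 * eps) * p.
  rewrite ler_pdivrMr; last lra.
  apply: (@le_trans _ _ ((1 + eps) * (p + eps * p))).
    apply: ler_pM => //; try lra.
    apply: sumr_ge0 => l _; rewrite mulr_ge0 //.
    by have /andP[fb _] := f_bounds l; exact: le_trans (ltW b00) fb.
  have -> : (1 + eps) * (p + eps * p) = (1 + eps) ^+ 2 * p by ring.
  rewrite [leRHS]mulrAC ler_wpM2r ?(ltW p0) //.
  have : eps * eps <= 1 / 5 * eps by rewrite ler_wpM2r // ltW.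
  lra.
(* The nine is 4 + 4 + 1: from [C1], from [4 * tau], and from [2 * B * (kap + eta)] with [kap] equal
   to [eta]. *)
have e9 : 9 * eps * p <= e * p by rewrite ler_wpM2r // ltW.
have hBe : 2 * B * (eta + eta) = eps * b0.
  have -> : 2 * B * (eta + eta) = 4 * (B * eta) by ring.
  by rewrite eta_B; field.
rewrite hBe /tau; lra.
Qed.

(** Each vertex is classified twice: by [D'], where slot weights underestimate - ln (1 - W) as the
    first moment bound requires, and by [D], where they overestimate it as the extraction of
    independent sets requires. *)
Lemma edge_probability i j :
  [/\ 0 <= W (tnth x i) (tnth x j) <= 1,
      1 - W (tnth x i) (tnth x j) <= expR (- slot_weight W z 0 (cl' i) (cl' j)) &
      expR (- slot_weight W z B (cl i) (cl j)) <= 1 - W (tnth x i) (tnth x j)].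
Proof.
have W1 : 0 < 1 - W (tnth x i) (tnth x j).
  by have /andP[_ h] := W_bounds (xI i) (xI j); have h1 := hi1; lra.
have We : 1 - W (tnth x i) (tnth x j) = expR (- logw W (tnth x i) (tnth x j)).
  by rewrite /logw opprK lnK.
split; first by have [_ _] := hW; apply.
- rewrite We ler_expR lerN2 /cl'.
  case ei: (slot_of D' (tnth x i)) => [a|] /=; last exact: (logw_ge0 lo0 hi1 W_bounds).
  case ej: (slot_of D' (tnth x j)) => [b|] /=; last exact: (logw_ge0 lo0 hi1 W_bounds).
  apply: (le_logw hi1 W_bounds); rewrite ?xI //; try exact: (slots_z hs).
  by apply: (slots_ge hs); exact: slot_of_some.
- rewrite We ler_expR lerN2 /cl.
  case ei: (slot_of D (tnth x i)) => [a|] /=; last exact: (logw_le hi1 W_bounds).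
  case ej: (slot_of D (tnth x j)) => [b|] /=; last exact: (logw_le hi1 W_bounds).
  apply: (le_logw hi1 W_bounds); rewrite ?xI //; try exact: (slots_z hs).
  by apply: (slots_le hs); exact: slot_of_some.
Qed.

Definition chi_off (g : graph n) : bool :=
  ~~ ((1 - e) * p * y <= (chi g)%:R <= (1 + e) * p * y).

Lemma prob_chi_off_given : \sum_(g | chi_off g) edge_law W x g <= 2 * rho.
Proof.
have W01 i j : 0 <= W (tnth x i) (tnth x j) <= 1 by case: (edge_probability i j).
have low := @prob_not_sparse n R W x W01 (option A) cl' (slot_weight W z 0)
  ((1 + eps) * L) (fun i j => let: And3 _ h _ := edge_probability i j in h).
have vB a b : 0 <= slot_weight W z B a b <= B.
  exact: (v_bounds lo0 hi1 W_bounds hs).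
have sT l a : (profile hi D' mu f eps L l a <= T)%N.
  rewrite -ltnS -(ltr_nat R).
  apply: (le_lt_trans (profile_le lo0 hi1 W_bounds hs mu f_bounds eps_bounds L_gt0 l a)).
  by rewrite (lt_le_trans (truncnS_gt _)) // ler_nat.
have up := @prob_not_extractable n R W x W01 (option A) _ cl (slot_weight W z B) T N
  (profile hi D' mu f eps L) eps B L n0 (slot_weight_sym W_sym hs B) vB eps_bounds B_pos
  (large_10 hlarge) (large_B hlarge) _ _ sT
  (fun l => @profile_admissible _ _ _ _ lo0 hi1 W_bounds _ _ _ _ _ _ hs _ _ _ _ _ fE
    f_bounds eps_bounds L_gt0 l)
  (fun i j => let: And3 _ _ h := edge_probability i j in h).
have {}up : \sum_(g | ~~ extractable cl (T * N) (profile hi D' mu f eps L) g)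
    edge_law W x g <= rho.
  apply: le_trans (large_extract hlarge); apply: le_trans (up _ _) _.
  - by rewrite ltW // truncnS_gt.
  - by rewrite card_option; exact: (large_T hlarge).
  rewrite ler_wpM2r ?expR_ge0 // ler_wpM2l //.
  have -> : expR n%:R = expR 1 ^+ n :> R by rewrite -expRM_natl mulr1.
  rewrite lerXn2r ?nnegrE ?expR_ge0 //.
  by apply: (le_trans _ (expR_ge1Dx _)).
have {}low := le_trans low (large_sparse hlarge).
have -> : 2 * rho = rho + rho by ring.
apply: le_trans (lerD low up).
have el0 g : 0 <= edge_law W x g by exact: edge_law_ge0.
rewrite big_mkcond [X in _ <= X + _]big_mkcond [X in _ <= _ + X]big_mkcond -big_split /=.
apply: ler_sum => g _; case: ifP => [off|_]; last first.
  by rewrite addr_ge0 //; case: ifP.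
case: (boolP (sparse _ _ _ _)) => /= [sp|_]; last first.
  by rewrite lerDl; case: ifP.
rewrite add0r; case: (boolP (extractable _ _ _ _)) => //= ext.
by move: off; rewrite /chi_off chi_lower //= chi_upper.
Qed.

End Positions.

(** At good positions, sparsity and extractability may each fail with probability at most [rho]. The
    third [rho] pays for bad positions, counted over both families of intervals. *)
Lemma prob_chi_off (d : measure_display) (T : measurableType d) (P : probability T R)
    (G : T -> graph n) : is_GnW P W G -> pr P [set w | chi_off (G w)] <= 3 * rho.
Proof.
move=> [X [mX XI Xu Xi Gl]].
pose E (j : A + A) : set R := match j with inl a => D a | inr a => D' a end.
pose ln_ (j : A + A) : R := len (match j with inl a => a | inr a => a end).
have rho0 : 0 <= 2 * rho.
  have h := large_count hlarge; have : 0 <= C / n%:R.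
    by rewrite divr_ge0 // sumr_ge0 // => j _; rewrite divr_ge0 // sqr_ge0.
  lra.
have := @prob_bad R d T P n W G X mX XI Xu Xi Gl hW (A + A)%type E ln_ eta (2 * rho)
  chi_off n0 _ _ _ eta_gt0 _ rho0.
have -> : \sum_j 1 / ((eta * ln_ j) ^+ 2 * n%:R) = C / n%:R.
  rewrite /C mulr_suml; apply: eq_bigr => j _.
  by rewrite !mul1r invfM.
move=> h; apply: (le_trans (h _ _ _ _)).
- by case=> a; [exact: (slots_meas hs)|exact: (slots_meas' hs)].
- by case=> a; [exact: (slots_len hs)|exact: (slots_len' hs)].
- by case=> a; exact: (slots_pos hs).
- move=> x xI hx; apply: prob_chi_off_given => // a.
    exact: (hx (inl a)).
  exact: (hx (inr a)).
- have := large_count hlarge; lra.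
Qed.

End FiniteSize.

Theorem corollary2p14 (R : realType) (W : R -> R -> R)
  (hW : graphon W) (hinc : block_increasing W)
  (hinf : 0 < inf (values W) <= sup (values W)) (hsup : sup (values W) < 1)
  (d : nat -> measure_display) (T : forall n : nat, measurableType (d n))
  (P : forall n : nat, probability (T n) R)
  (G : forall n : nat, T n -> graph n)
  (hG : forall n : nat, is_GnW (P n) W (G n))
  (eps : R) (heps : 0 < eps) :
  P n [set w | ((1 - eps)%:E * phi_star W * (n%:R / (2 * ln n%:R))%:E
                  <= ((chi (G n w))%:R)%:E
                  <= (1 + eps)%:E * phi_star W * (n%:R / (2 * ln n%:R))%:E)%E]
    @[n --> \oo] --> 1%E.
Proof.
have [_ _ W01] := hW; have /andP[lo0 _] := hinf.
have W_bounds x y : I01 R x -> I01 R y -> inf (values W) <= W x y <= sup (values W).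
  move=> xI yI; have vW : values W (W x y) by exists x => //; exists y.
  apply/andP; split.
    by apply: ge_inf vW; exists 0 => _ [u uI [v vI <-]]; case/andP: (W01 u v uI vI).
  by apply: ub_le_sup vW; exists 1 => _ [u uI [v vI <-]]; case/andP: (W01 u v uI vI).
have [p pE p_bounds] := phi_star_fin lo0 hsup W_bounds.
(* The accumulated relative error is at most nine times [e]; the cap 1 / 5 is the range in which the
   overlap estimate holds. *)
pose e := Num.min (eps / 9) (1 / 5).
have e_bounds : 0 < e <= 1 / 5.
  by rewrite /e lt_min ge_min lexx orbT divr_gt0 //= divr_gt0.
have e_eps : 9 * e <= eps.
  have : e <= eps / 9 by rewrite /e ge_min lexx.
  lra.
have [e0 _] := andP e_bounds.
have b0 := b0_gt0 lo0 hsup W_bounds; have B0 := B_gt0 lo0 hsup W_bounds.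
have p0 : 0 < p by case/andP: p_bounds => h _; exact: lt_le_trans h.
have [A [D [D' [z [len hs]]]]] := slots_exist hinc (eta_gt0 lo0 hsup W_bounds e_bounds).
have [k [mu [alpha [f [clam fE f_bounds near_opt]]]]] :=
  near_optimal lo0 hsup W_bounds pE (mulr_gt0 e0 p0).
pose off n : set (T n) := [set w | chi_off p eps (ln n%:R) (G n w)].
have m_off n : measurable (off n).
  by have [X [_ _ _ _ Gl]] := hG n; apply: measurable_graph_event => g; case: (Gl g).
have evE n : P n [set w | ((1 - eps)%:E * phi_star W * (n%:R / (2 * ln n%:R))%:E
                  <= ((chi (G n w))%:R)%:E
                  <= (1 + eps)%:E * phi_star W * (n%:R / (2 * ln n%:R))%:E)%E] =
    (1 - pr (P n) (off n))%:E.
  rewrite [RHS]EFinB (prE (P n) (m_off n)) -probability_setC //; congr (P n _).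
  by apply/seteqP; split => w; rewrite /off /= /chi_off pE -!EFinM !lee_fin; [move=> ->|move=> /negP; rewrite negbK].
under eq_fun do rewrite evE.
apply/fine_cvgP; split; first exact: nearW.
apply/cvgrPdist_le => /= rho rho0; have rho3 : 0 < rho / 3 by rewrite divr_gt0.
pose eta := e * - ln (1 - inf (values W)) / (4 * - ln (1 - sup (values W))).
have := near_ln (@near_large R _ _ _ ((1 + eta) * (\sum_l alpha l * f l) / (1 - e)) _ _
  (\sum_(j : A + A) 1 / (eta * len (match j with inl a => a | inr a => a end)) ^+ 2)
  #|A| k #|{: 'I_k + option A}| e_bounds b0 B0 (mulr_gt0 e0 b0) rho3).
apply: filterS => n [n0 hlarge].
have nL : n%:R = expR (ln n%:R) :> R by rewrite lnK // posrE ltr0n.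
rewrite -nL in hlarge.
rewrite opprB addrC subrK ger0_norm ?pr_ge0 //.
have := prob_chi_off lo0 hsup W_bounds hW pE p_bounds e_bounds e_eps hs clam fE f_bounds
  near_opt n0 hlarge (hG n).
by move=> /le_trans; apply; rewrite mulrC divfK.
Qed.
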